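(* Let $H^{(0)}$ be the Hamiltonian $$H^{(0)} = \omega p_1 +\sum_{j=1}^{n_2} \mathbf{i}\,\Omega_j\xi_j \eta_j +\sum_{\ell> 2} f_{\ell}^{(0,0)}(\hat{p},\xi,\eta) + \sum_{s>0}\sum_{\ell\geq 0}f_{\ell}^{(0,s)}(\hat{p},\hat{q},\xi,\eta)$$ described in the context, with $f_\ell^{(0,s)}\in\mathcal P_\ell$ of order $\mathcal O(\epsilon^s)$, and assume it is analytic in the domain $\mathcal D_{\rho,\sigma,R}$. Assume that: (H1) there exists a constant $m>0$ such that for every $v\in\mathbb R^{n_1}$ $$m \sum_{i=1}^{n_1} |v_i| \leq \sum_{i=1}^{n_1} \Bigl|\sum_{j=1}^{n_1} C_{0,ij} v_j\Bigr|,\qquad C_{0,ij}=\frac{\partial^2 f_4^{(0,0)}}{\partial \hat{p}_i \partial \hat{p}_j}\Big|_{\hat p=0};$$ (H2) there is $E>0$ such that the terms of the expansion satisfy $\|f_\ell^{(0,s)}\|_1 \leq \frac{E}{2^\ell}|\epsilon|^s$ for all $\ell,s\ge 0$; (H3) the frequencies satisfy $k_1\omega\pm \Omega_j \neq 0$ for all $k_1\in\mathbb Z$ and all $j$, and $k_1\omega\pm \Omega_l \pm \Omega_k \neq 0$ for all $k_1\in\mathbb Z\setminus\{0\}$ and all $l,k$ (for every choice of signs). Then for every integer $r\geq 1$ there exists $\epsilon_r^*>0$ such that for $|\epsilon|<\epsilon_r^*$ and for an arbitrary fixed parameter vector $q^*\in\mathbb T^{n_1-1}$ there exists an analytic canonical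 transformation $\Phi^{(r)}$ satisfying $$\mathcal D_{\frac14(\rho,\sigma,R)}\subset \Phi^{(r)}\bigl(\mathcal D_{\frac12(\rho,\sigma,R)}\bigr)\subset \mathcal D_{\frac34(\rho,\sigma,R)}$$ such that $H^{(r)}=H^{(0)}\circ\Phi^{(r)}$ has the expansion $$\begin{aligned} H^{(r)}(\hat q,\hat p,\xi,\eta;q^* ) =\ & \omega p_1 + \sum_{j=1}^{n_2} \mathbf{i}\,\Omega_j\xi_j\eta_j +\sum_{\ell> 2} f_{\ell}^{(r,0)}(\hat{p},\xi,\eta)\\ &+\sum_{s=1}^{r} \Bigl(f_{0}^{(r,s)}(q;q^* ) + f_{2}^{(r,s)}(q,\hat{p},\xi,\eta;q^* ) + f_{3}^{(r,s)}(\hat{q},\xi,\eta;q^* ) + f_{4}^{(r,s)}(\hat{q},\hat{p},\xi,\eta;q^* )\Bigr) \\ &+\sum_{s>r} \sum_{\ell=0}^{4} f_{\ell}^{(r,s)}(\hat{q},\hat{p},\xi,\eta;q^* )+\sum_{s>0}\sum_{\ell>4}f_{\ell}^{(r,s)}(\hat{q},\hat{p},\xi,\eta;q^* ),\end{aligned}$$ with $f_\ell^{(r,s)}\in\mathcal P_\ell$ of order $\mathcal O(\epsilon^s)$, which is in normal form up to order $r$, i.e., for $1\le s\leq r$: 1. $f_0^{(r,s)}$ does not depend on the fast angle $q_1$; 2. $f_1^{(r,s)}$ does not appear; 3. $f_2^{(r,s)}$ does not depend on $q_1$ and, evaluated at $\xi=\eta=0$ and $q=q^*$, is equal to zero; 4.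 $f_3^{(r,s)}$ does not depend on the actions $\hat p$; 5. $f_4^{(r,s)}$, evaluated at $\xi=\eta=0$, does not depend on $q_1$.
   Context: Let $n=n_1+n_2$ and let $\epsilon$ be a small parameter. The starting point is a Hamiltonian $H=h_0(I)+g_0(\xi,\eta)+\epsilon H_1(I,\varphi,\xi,\eta;\epsilon)$, analytic in all variables and in $\epsilon$, with action-angle variables $(I,\varphi)\in\mathcal U(I^* )\times\mathbb T^{n_1}$, $\mathcal U(I^* )\subset\mathbb R^{n_1}$ a neighbourhood of $I^*$, and complex canonical Cartesian variables $(\xi,\eta)$ in a neighbourhood of $0\in\mathbb C^{2n_2}$ ($\eta_j$ conjugate to $\xi_j$), where $g_0(\xi,\eta)=\sum_{j=1}^{n_2}\mathbf{i}\,\Omega_j\xi_j\eta_j+\text{h.o.t.}$, $\Omega_j\in\mathbb R$. The torus $I=I^*$, $\xi=\eta=0$ is completely resonant: $\frac{\partial h_0}{\partial I}(I^* )=\omega k$ with $\omega\in\mathbb R$, $k\in\mathbb Z^{n_1}$, $k_1=1$. Setting $J=I-I^*$, one passes from $(J,\varphi)$ to resonant canonical variables $(\hat p,\hat q)$ by a linear unimodular change of coordinates: $\hat q_1$ is the fast angle of the periodic orbits, the slow angles are $\hat q_j=k_j\varphi_1-\varphi_j$ for $j=2,\dots,n_1$, and $\hat p_1=\langle k,J\rangle$. Write $\hat p=(p_1,p)$, $\hat q=(q_1,q)$ with $p_1=\hat p_1$, $q_1=\hat q_1$, $p=(\hat p_2,\dots,\hat p_{n_1})$, $q=(\hat q_2,\dots,\hat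 q_{n_1})$. In these variables, expanding in powers of $\hat p,\xi,\eta$ and in Fourier series in $\hat q$, the Hamiltonian takes the form $H^{(0)}$ of the claim; the terms $f_\ell^{(0,0)}$ come from $h_0+g_0$. Classes of functions: $\widehat{\mathcal P}_{l,m}$ is the set of functions with Taylor–Fourier expansion $\sum_{|i|=l}\sum_{|m_1|+|m_2|=m}\sum_{k\in\mathbb Z^{n_1}} g_{i,m_1,m_2,k}\,\hat p^{\,i} e^{\mathbf{i}\langle k,\hat q\rangle}\xi^{m_1}\eta^{m_2}$ with complex coefficients ($i\in\mathbb N^{n_1}$, $m_1,m_2\in\mathbb N^{n_2}$); $\mathcal P_\ell$ is the set of sums of elements of the classes $\widehat{\mathcal P}_{l,m}$ with $l,m\ge0$, $2l+m=\ell$. Domains: $\mathcal D_{\rho,\sigma,R}=\mathcal G_\rho\times\mathbb T^{n_1}_\sigma\times\mathcal B_R$ with $\mathcal G_\rho=\{\hat p\in\mathbb C^{n_1}:\max_j|\hat p_j|<\rho\}$, $\mathbb T^{n_1}_\sigma=\{\hat q\in\mathbb C^{n_1}:\mathrm{Re}\,\hat q_j\in\mathbb T,\ \max_j|\mathrm{Im}\,\hat q_j|<\sigma\}$, $\mathcal B_R=\{(\xi,\eta)\in\mathbb C^{2n_2}:\max_j(|\xi_j|+|\eta_j|)<R\}$; $\mathcal D_{a(\rho,\sigma,R)}$ means $\mathcal D_{a\rho,a\sigma,aR}$. Norm: for $g$ analytic on $\mathcal D_{\rho,\sigma,R}$ with coefficients $g_{i,m_1,m_2,k}$, $\|g\|_{\rho,\sigma,R}=\sum_{i,m_1,m_2,k}|g_{i,m_1,m_2,k}|\rho^{|i|}R^{|m_1|+|m_2|}e^{|k|\sigma}$,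 and $\|g\|_{a}=\|g\|_{a\rho,a\sigma,aR}$, so $\|g\|_1=\|g\|_{\rho,\sigma,R}$. *)

(* Defs.v *)
From HB Require Import structures.
From mathcomp Require Import all_boot all_order all_algebra finmap.
From mathcomp Require Import complex.
From mathcomp Require Import all_classical all_reals all_analysis summability.

Set Implicit Arguments.
Unset Strict Implicit.
Unset Printing Implicit Defensive.

Import Order.TTheory GRing.Theory Num.Theory numFieldNormedType.Exports.

Local Open Scope classical_set_scope.
Local Open Scope ring_scope.
Local Open Scope complex_scope.

(* The library puts no topology on R[i]; it is given the one induced by the
   modulus, as is done there for every abstract numFieldType.  As a consequence
   [differentiable] between R[i]-normed spaces is complex differentiability, so
   analytic functions on open subsets of C^N are the functions that are
   differentiable at every point. *)
#[non_forgetful_inheritance]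
HB.instance Definition _ (R : rcfType) := GRing.ComAlgebra.copy R[i] R[i]^o.
#[non_forgetful_inheritance]
HB.instance Definition _ (R : rcfType) := Vector.copy R[i] R[i]^o.
#[non_forgetful_inheritance]
HB.instance Definition _ (R : rcfType) := NormedModule.copy R[i] R[i]^o.

Definition cmod (R : realType) (z : R[i]) : R := Normc.normc z.

Definition cexp (R : realType) (z : R[i]) : R[i] :=
  (expR (complex.Re z))%:C * (cos (complex.Im z) +i* sin (complex.Im z)).

(* Unconditional convergence: limit along the finite subsets of [I]. *)
Definition has_sum (R : realType) (I : choiceType) (u : I -> R[i]) (v : R[i]) :
    Prop :=
  partial_sum u @ totally --> v.

(* Real-analytic dependence of a complex-valued function on a real parameter. *)
Definition real_analytic_at (R : realType) (g : R -> R[i]) (e0 : R) : Prop :=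
  exists (a : nat -> R[i]) (delta : R), 0 < delta /\
    forall e, `|e - e0| < delta ->
      has_sum (fun n => a n * ((e - e0)%:C) ^+ n) (g e).

(* A point is the row vector (p^, q^, xi, eta).  The angles are lifted to the
   universal cover: q^ ranges over C^n1, see [torus_eq]. *)
Definition phase (R : realType) (n1 n2 : nat) : Type :=
  'rV[R[i]]_((n1 + n1) + (n2 + n2)).

Definition act (R : realType) n1 n2 (z : phase R n1 n2) : 'rV[R[i]]_n1 :=
  lsubmx (lsubmx z).
Definition ang (R : realType) n1 n2 (z : phase R n1 n2) : 'rV[R[i]]_n1 :=
  rsubmx (lsubmx z).
Definition cxi (R : realType) n1 n2 (z : phase R n1 n2) : 'rV[R[i]]_n2 :=
  lsubmx (rsubmx z).
Definition ceta (R : realType) n1 n2 (z : phase R n1 n2) : 'rV[R[i]]_n2 :=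
  rsubmx (rsubmx z).

(* The fast angle q_1 is [ang z 0 ord0]; these are the slow angles. *)
Definition slow (R : realType) d n2 (z : phase R d.+1 n2) : 'rV[R[i]]_d :=
  \row_j ang z 0 (lift ord0 j).

(* Two points of the cover representing the same point of
   C^n1 x (C / 2 pi Z)^n1 x C^(2 n2). *)
Definition torus_eq (R : realType) n1 n2 (z z' : phase R n1 n2) : Prop :=
  [/\ act z = act z', cxi z = cxi z', ceta z = ceta z' &
      exists k : 'I_n1 -> int,
        forall j, ang z' 0 j = ang z 0 j + (2 * pi * (k j)%:~R)%:C].

Definition dom (R : realType) n1 n2 (rho sigma rad : R) : set (phase R n1 n2) :=
  [set z | [/\ forall j, cmod (act z 0 j) < rho,
               forall j, `|complex.Im (ang z 0 j)| < sigma &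
               forall j, cmod (cxi z 0 j) + cmod (ceta z 0 j) < rad]].

(* The index (i, (m1, m2), k) of p^^i e^(i <k, q^>) xi^m1 eta^m2. *)
Definition tfindex (n1 n2 : nat) : choiceType :=
  ({ffun 'I_n1 -> nat} * ({ffun 'I_n2 -> nat} * {ffun 'I_n2 -> nat})
   * {ffun 'I_n1 -> int})%type.

Definition ix_i n1 n2 (x : tfindex n1 n2) : {ffun 'I_n1 -> nat} := x.1.1.
Definition ix_m1 n1 n2 (x : tfindex n1 n2) : {ffun 'I_n2 -> nat} := x.1.2.1.
Definition ix_m2 n1 n2 (x : tfindex n1 n2) : {ffun 'I_n2 -> nat} := x.1.2.2.
Definition ix_k n1 n2 (x : tfindex n1 n2) : {ffun 'I_n1 -> int} := x.2.

Definition mlen n (i : {ffun 'I_n -> nat}) : nat := (\sum_j i j)%N.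
Definition klen n (k : {ffun 'I_n -> int}) : nat := (\sum_j `|k j|)%N.

Definition tf_l n1 n2 (x : tfindex n1 n2) : nat := mlen (ix_i x).
Definition tf_m n1 n2 (x : tfindex n1 n2) : nat :=
  (mlen (ix_m1 x) + mlen (ix_m2 x))%N.

(* A Taylor-Fourier series, given by its coefficients. *)
Definition tfseries (R : realType) (n1 n2 : nat) : Type :=
  tfindex n1 n2 -> R[i].

Definition tfmono (R : realType) n1 n2 (x : tfindex n1 n2) (z : phase R n1 n2) :
    R[i] :=
  (\prod_j act z 0 j ^+ ix_i x j)
  * cexp ('i * \sum_j (ix_k x j)%:~R * ang z 0 j)
  * (\prod_j cxi z 0 j ^+ ix_m1 x j)
  * (\prod_j ceta z 0 j ^+ ix_m2 x j).

(* [sum] is the limit of the finite partial sums; it is meaningful where the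
   series converges, in particular on [dom rho sigma rad] when
   [tfnorm rho sigma rad c] is finite. *)
Definition tfeval (R : realType) n1 n2 (c : tfseries R n1 n2)
    (z : phase R n1 n2) : R[i] :=
  sum (fun x => c x * tfmono x z).

Definition tfnorm (R : realType) n1 n2 (rho sigma rad : R)
    (c : tfseries R n1 n2) : \bar R :=
  \esum_(x in [set: tfindex n1 n2])
    (cmod (c x) * rho ^+ tf_l x * rad ^+ tf_m x
     * expR ((klen (ix_k x))%:R * sigma))%:E.

(* Finite sums of elements of the classes indexed by (l, m) with
   2 l + m = ell: only monomials of these bidegrees occur. *)
Definition inP (R : realType) n1 n2 (ell : nat) (c : tfseries R n1 n2) : Prop :=
  forall x, c x != 0 -> (2 * tf_l x + tf_m x)%N = ell.

(* The terms of order 0 in eps are the homogeneous parts of h_0(I^* + J) and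
   g_0(xi, eta): [h] and [g] are the Taylor coefficients of the real function
   h_0 in the variables p^ and of the complex function g_0.  In particular the
   terms do not depend on eps and do not couple p^ with xi, eta. *)
Definition unperturbed (R : realType) n1 n2 (eps0 : R)
    (f : R -> nat -> nat -> tfseries R n1 n2) : Prop :=
  exists (h : {ffun 'I_n1 -> nat} -> R)
         (g : {ffun 'I_n2 -> nat} -> {ffun 'I_n2 -> nat} -> R[i]),
  forall eps ell x, `|eps| < eps0 -> (2 < ell)%N ->
    f eps ell 0%N x =
      if ((2 * tf_l x + tf_m x)%N == ell) && (ix_k x == [ffun=> 0]) then
        if tf_m x == 0%N then (h (ix_i x))%:C
        else if tf_l x == 0%N then g (ix_m1 x) (ix_m2 x)
        else 0
      else 0.

Definition lin_part (R : realType) d n2 (omega : R) (Omega : 'I_n2 -> R)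
    (z : phase R d.+1 n2) : R[i] :=
  omega%:C * act z 0 ord0
  + \sum_j 'i * (Omega j)%:C * cxi z 0 j * ceta z 0 j.

(* [H] is [lin_part] plus the sum of the terms [f ell s] for the pairs (ell, s)
   selected by [present]. *)
Definition expansion (R : realType) d n2 (omega : R) (Omega : 'I_n2 -> R)
    (present : nat -> nat -> bool) (f : nat -> nat -> tfseries R d.+1 n2)
    (D : set (phase R d.+1 n2)) (H : phase R d.+1 n2 -> R[i]) : Prop :=
  forall z, D z ->
    has_sum (fun x : nat * nat =>
               if present x.1 x.2 then tfeval (f x.1 x.2) z else 0)
            (H z - lin_part omega Omega z).

Definition present0 (ell s : nat) : bool := if s is 0%N then (2 < ell)%N else true.

Definition present_nf (r ell s : nat) : bool :=
  if s is 0%N then (2 < ell)%N else if (s <= r)%N then ell != 1%N else true.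

Definition e_act (R : realType) n1 n2 (i : 'I_n1) : phase R n1 n2 :=
  delta_mx 0 (lshift (n2 + n2) (lshift n1 i)).

Definition act_hessian (R : realType) n1 n2 (F : phase R n1 n2 -> R[i])
    (i j : 'I_n1) : R[i] :=
  'D_(e_act R n2 i) (fun z => 'D_(e_act R n2 j) F z) 0.

(* Matrix of the two-form sum_j dq_j /\ dp_j + sum_j dxi_j /\ deta_j in the
   coordinates (p^, q^, xi, eta). *)
Definition symp (R : realType) (n1 n2 : nat) :
    'M[R[i]]_((n1 + n1) + (n2 + n2)) :=
  block_mx (block_mx 0 (- 1%:M) 1%:M 0) 0 0 (block_mx 0 1%:M (- 1%:M) 0).

(* In the library [jacobian] acts on row vectors on the right: it is the
   transpose of the usual Jacobian matrix.  The last two clauses say that [Phi]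
   is well defined, and injective, modulo 2 pi in the angles. *)
Definition analytic_canonical (R : realType) n1 n2 (D : set (phase R n1 n2))
    (Phi : phase R n1 n2 -> phase R n1 n2) : Prop :=
  [/\ forall z, D z -> differentiable Phi z,
      forall z, D z ->
        jacobian Phi z *m symp R n1 n2 *m (jacobian Phi z)^T = symp R n1 n2,
      forall z z', D z -> D z' -> torus_eq z z' -> torus_eq (Phi z) (Phi z') &
      forall z z', D z -> D z' -> torus_eq (Phi z) (Phi z') -> torus_eq z z'].

Definition indep_q1 (R : realType) d n2 (D : set (phase R d.+1 n2))
    (F : phase R d.+1 n2 -> R[i]) : Prop :=
  forall z z', D z -> D z' -> act z = act z' -> slow z = slow z' ->
    cxi z = cxi z' -> ceta z = ceta z' -> F z = F z'.

Definition indep_q (R : realType) n1 n2 (D : set (phase R n1 n2))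
    (F : phase R n1 n2 -> R[i]) : Prop :=
  forall z z', D z -> D z' -> act z = act z' ->
    cxi z = cxi z' -> ceta z = ceta z' -> F z = F z'.

Definition indep_p (R : realType) n1 n2 (D : set (phase R n1 n2))
    (F : phase R n1 n2 -> R[i]) : Prop :=
  forall z z', D z -> D z' -> ang z = ang z' ->
    cxi z = cxi z' -> ceta z = ceta z' -> F z = F z'.

Definition origin_xieta (R : realType) n1 n2 : set (phase R n1 n2) :=
  [set z | cxi z = 0 /\ ceta z = 0].

(* The absence of the terms [f 1 s] is part of [present_nf]. *)
Definition normal_form (R : realType) d n2 (D : set (phase R d.+1 n2)) (r : nat)
    (qstar : 'rV[R]_d) (f : nat -> nat -> tfseries R d.+1 n2) : Prop :=
  forall s, (1 <= s <= r)%N ->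
  [/\ indep_q1 D (tfeval (f 0%N s)),
      indep_q1 D (tfeval (f 2%N s)),
      forall z, D z -> origin_xieta z -> slow z = map_mx (fun t => t%:C) qstar ->
        tfeval (f 2%N s) z = 0,
      indep_p D (tfeval (f 3%N s)) &
      indep_q1 (D `&` @origin_xieta R d.+1 n2) (tfeval (f 4%N s))].

(* Main.v *)
(* The transformation is a composition of finitely many near-identity symplectic
   maps.  The monomials to be removed have degree 2l+m <= 4, and by (H3) the
   Poisson bracket with the linear part acts on them with eigenvalues that are
   bounded away from zero, because only finitely many combinations of the Omega_j
   occur; so they are removed degree by degree, to leading order in eps, by
   solving the homological equation.  The integrable part has only monomials of
   degree > 2, hence its bracket with a generating function of degree l has
   degree > l and does not spoil what has already been removed.  After the
   degrees 0 and 1, a translation of the actions, found by inverting the Hessian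
   of (H1), kills the average of the coefficients of p at q = q*.  Each round of
   six steps improves the order in eps by one.
   Instead of Lie series, the flow of a generating function is replaced by the
   implicit midpoint rule, which is exactly symplectic and agrees with the
   identity plus the Hamiltonian field up to second order; all estimates are
   made on the Taylor-Fourier coefficients in weighted l^1 norms. *)

Require Import Defs.
From HB Require Import structures.
From mathcomp Require Import all_boot all_order all_algebra finmap.
From mathcomp Require Import complex.
From mathcomp Require Import all_classical all_reals all_analysis summability.
From mathcomp Require Import zify ring lra.

Set Implicit Arguments.
Unset Strict Implicit.
Unset Printing Implicit Defensive.

Import Order.TTheory GRing.Theory Num.Theory numFieldNormedType.Exports.

Local Open Scope classical_set_scope.
Local Open Scope ring_scope.
Local Open Scope complex_scope.

(** * Unordered sums of complex numbers *)

(** The order in eps is measured only by norms. For each fixed eps the perturbation is one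
    Taylor-Fourier series [g], and no expansion in powers of eps goes through the induction; only at
    the end is [g] cut into a part in normal form, of size O(eps), and a rest of size O(eps^(r+1)).
    The constant and the threshold of a state are common to all q*, which gives one threshold for
    the theorem. Derivatives cost analyticity: norms live on polydiscs whose radii exceed the final
    ones by [t], and each step uses half of the gap between [t] and [tau], so any finite number of
    steps fits. The order of the six steps is forced. A generating function of degree 0 or 1 may
    still create, through [f], terms of degree 2 and so change the averages at q*. From degree 2 on
    it cannot: what it creates has degree at least 3, and what it removes in degree 2 carries the
    fast angle. The translation itself adds only functions of the actions, hence no monomial to be
    removed. The midpoint rule costs one fixed point and a quadratic error, where a Lie series needs
    bounds for all iterated brackets. *)

Section ComplexModulus.
Variable R : realType.
Implicit Types z w : R[i].

Lemma normrE z : `|z| = (cmod z)%:C.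
Proof. by []. Qed.

Lemma cmod_ge0 z : 0 <= cmod z.
Proof. by rewrite -ler0c -normrE. Qed.

Lemma cmod0 : cmod (0 : R[i]) = 0.
Proof. exact: Normc.normc0. Qed.

Lemma cmod1 : cmod (1 : R[i]) = 1.
Proof. exact: Normc.normc1. Qed.

Lemma cmodM z w : cmod (z * w) = cmod z * cmod w.
Proof. exact: Normc.normcM. Qed.

Lemma cmodV z : cmod z^-1 = (cmod z)^-1.
Proof. exact: Normc.normcV. Qed.

Lemma cmodN z : cmod (- z) = cmod z.
Proof. exact: normcN. Qed.

Lemma cmodB z w : cmod (z - w) = cmod (w - z).
Proof. by rewrite -cmodN opprB. Qed.

Lemma cmodD z w : cmod (z + w) <= cmod z + cmod w.
Proof. exact: le_normcD. Qed.

Lemma cmod_eq0 z : cmod z = 0 -> z = 0.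
Proof. exact: Normc.eq0_normc. Qed.

Lemma cmodX z n : cmod (z ^+ n) = cmod z ^+ n.
Proof. by elim: n => [|n ih]; rewrite ?expr0 ?cmod1// !exprS cmodM ih. Qed.

Lemma cmod_real (a : R) : cmod a%:C = `|a|.
Proof. by rewrite /cmod /= expr0n /= addr0 sqrtr_sqr. Qed.

Lemma cmod_prod (I : Type) (s : seq I) (P : pred I) (F : I -> R[i]) :
  cmod (\prod_(i <- s | P i) F i) = \prod_(i <- s | P i) cmod (F i).
Proof. exact: (big_morph _ cmodM cmod1). Qed.

Lemma cmod_sum (I : Type) (s : seq I) (P : pred I) (F : I -> R[i]) :
  cmod (\sum_(i <- s | P i) F i) <= \sum_(i <- s | P i) cmod (F i).
Proof.
elim/big_ind2: _ => // [|x a y b hx hy]; first by rewrite cmod0.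
by rewrite (le_trans (cmodD _ _))// lerD.
Qed.

Lemma cmod_i : cmod ('i : R[i]) = 1.
Proof. by rewrite /cmod /= expr0n expr1n add0r sqrtr1. Qed.

Lemma le_cmod_Re z : `|complex.Re z| <= cmod z.
Proof. by rewrite -lecR -normrE normc_ge_Re. Qed.

Lemma le_cmod_Im z : `|complex.Im z| <= cmod z.
Proof.
have := le_cmod_Re (- 'i * z).
by rewrite cmodM cmodN cmod_i mul1r; case: z => a b /=; rewrite !mulNr; simpc.
Qed.

Lemma cmod_eq_le0 z : (forall e, 0 < e -> cmod z < e) -> z = 0.
Proof.
move=> h; apply: cmod_eq0; apply/eqP; rewrite eq_le cmod_ge0 andbT leNgt.
by apply/negP => /h; rewrite ltxx.
Qed.

End ComplexModulus.

Section UnorderedSums.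
Variable R : realType.
Local Notation C := R[i].

(** Radii are real here, because the order of [R[i]] is only partial; [has_sumP] identifies this
    with [has_sum]. *)
Definition hs (I : choiceType) (u : I -> C) (v : C) : Prop :=
  forall e : R, 0 < e -> exists A : {fset I}, forall B : {fset I},
    (A `<=` B)%fset -> cmod (\sum_(i <- B) u i - v) < e.

(** Absolute summability with an explicit bound, stated on finite subfamilies so that no infinite
    sum has to exist beforehand. *)
Definition absb (I : choiceType) (u : I -> C) (M : R) : Prop :=
  forall A : {fset I}, \sum_(i <- A) cmod (u i) <= M.

Lemma fset_sep_sub (I : choiceType) (A B : {fset I}) : (A `<=` B)%fset ->
  [fset x in B | x \in A]%fset = A.
Proof.
move=> AB; apply/fsetP => x; rewrite !inE /= andbC.
by case: (boolP (x \in A)) => //= xA; exact: (fsubsetP AB).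
Qed.

Lemma ler_sum_fsub (I : choiceType) (A B : {fset I}) (F : I -> R) :
  (A `<=` B)%fset -> (forall i, 0 <= F i) ->
  \sum_(i <- A) F i <= \sum_(i <- B) F i.
Proof.
move=> AB F0; rewrite [leRHS](big_fsetID _ [pred i | i \in A]) /= fset_sep_sub//.
by rewrite lerDl sumr_ge0.
Qed.

Lemma partial_sumE (I : choiceType) (u : I -> C) (A : {fset I}) :
  partial_sum u A = \sum_(i <- A) u i.
Proof. by rewrite /partial_sum big_seq_fsetE. Qed.

Lemma has_sumP (I : choiceType) (u : I -> C) v : has_sum u v <-> hs u v.
Proof.
split=> [h e e0|h].
  have /cvgrPdist_lt := h; move=> /(_ (totally_filter : Filter _) e%:C).
  rewrite ltcR => /(_ e0) [A _ hA].
  exists A => B AB; have /= := hA B AB.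
  by rewrite partial_sumE normrE ltcR cmodB.
have F : Filter (@totally I) by exact: totally_filter.
apply/cvgrPdist_lt => e e0.
have eE : e = (complex.Re e)%:C.
  by rewrite RRe_real// gtr0_real.
have e0' : 0 < complex.Re e by rewrite -ltcR -eE.
have [A hA] := h _ e0'.
exists A => // B AB /=.
by rewrite partial_sumE normrE eE ltcR cmodB; exact: hA.
Qed.

Section Basic.
Variable I : choiceType.
Implicit Types (u w : I -> C) (v : C) (A B : {fset I}).

Lemma hs_uniq u v v' : hs u v -> hs u v' -> v = v'.
Proof.
move=> h h'; apply/eqP; rewrite -subr_eq0; apply/eqP/cmod_eq_le0 => e e0.
have e2 : 0 < e / 2 by rewrite divr_gt0.
have [A hA] := h _ e2; have [B hB] := h' _ e2.
have {hA} := hA _ (fsubsetUl A B); have {hB} := hB _ (fsubsetUr A B).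
set S := \sum_(i <- _) _ => h1 h2.
have -> : v - v' = (S - v') - (S - v) by ring.
by rewrite (le_lt_trans (cmodD _ _))// cmodN (splitr e) ltrD.
Qed.

Lemma hs_sum u v : hs u v -> sum u = v.
Proof.
move=> /has_sumP h; have F : ProperFilter (@totally I) by exact: totally_filter.
by apply: (@cvg_lim _ (@norm_hausdorff _ _) _ _ F).
Qed.

Lemma eq_hs u w v : u =1 w -> hs u v -> hs w v.
Proof. by move=> /funext ->. Qed.

Lemma hs_fin u A : (forall i, i \notin A -> u i = 0) -> hs u (\sum_(i <- A) u i).
Proof.
move=> h e e0; exists A => B AB.
rewrite (big_fsetID _ [pred i | i \in A]) /= [X in _ + X - _]big1_fset ?addr0.
  by rewrite fset_sep_sub// subrr cmod0.
by move=> i; rewrite !inE /= => /andP[_ iA] _; exact: h.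
Qed.

Lemma hs0 u : (forall i, u i = 0) -> hs u 0.
Proof.
by move=> h; have := @hs_fin u fset0 (fun i _ => h i); rewrite big_seq_fset0.
Qed.

Lemma hs_add u w v v' : hs u v -> hs w v' -> hs (fun i => u i + w i) (v + v').
Proof.
move=> h h' e e0; have e2 : 0 < e / 2 by rewrite divr_gt0.
have [A hA] := h _ e2; have [B hB] := h' _ e2.
exists (A `|` B)%fset => D; rewrite fsubUset => /andP[/hA h1 /hB h2].
rewrite big_split /= opprD addrACA (le_lt_trans (cmodD _ _))// (splitr e).
by rewrite ltrD.
Qed.

Lemma hs_mull a u v : hs u v -> hs (fun i => a * u i) (a * v).
Proof.
move=> h e e0; have a1 : 0 < cmod a + 1 by rewrite ltr_wpDl ?cmod_ge0.
have [A hA] := h (e / (cmod a + 1)) (divr_gt0 e0 a1).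
exists A => B /hA; rewrite -mulr_sumr -mulrBr cmodM => hB.
rewrite (@le_lt_trans _ _ ((cmod a + 1) * cmod (\sum_(i <- B) u i - v)))//.
  by rewrite ler_wpM2r ?cmod_ge0// lerDl.
by rewrite mulrC -ltr_pdivlMr.
Qed.

Lemma hs_opp u v : hs u v -> hs (fun i => - u i) (- v).
Proof.
move=> h; have := hs_mull (-1) h.
by rewrite mulN1r; apply: eq_hs => i; rewrite mulN1r.
Qed.

Lemma absb_ge0 u M : absb u M -> 0 <= M.
Proof. by move=> /(_ fset0); rewrite big_seq_fset0. Qed.

Lemma absb_le u w M M' : (forall i, cmod (u i) <= cmod (w i)) -> M <= M' ->
  absb w M -> absb u M'.
Proof.
move=> h hM hw A; rewrite (le_trans _ hM)// (le_trans _ (hw A))//.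
exact: ler_sum.
Qed.

Lemma absb_add u w M M' : absb u M -> absb w M' ->
  absb (fun i => u i + w i) (M + M').
Proof.
move=> h h' A; rewrite (le_trans _ (lerD (h A) (h' A)))// -big_split.
by apply: ler_sum => i _; exact: cmodD.
Qed.

Lemma absb_mull a u M : absb u M -> absb (fun i => a * u i) (cmod a * M).
Proof.
move=> h A; under eq_bigr do rewrite cmodM.
by rewrite -mulr_sumr ler_wpM2l ?cmod_ge0.
Qed.

Lemma absb_hs_le u v M : absb u M -> hs u v -> cmod v <= M.
Proof.
move=> h hv; rewrite leNgt; apply/negP => lt.
have [A hA] := hv _ (eqbRL (subr_gt0 _ _) lt).
have := hA A (fsubset_refl A); set S := \sum_(i <- A) u i => hS.
have hle : cmod S <= M by rewrite (le_trans (cmod_sum _ _ _))// h.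
have : cmod v <= cmod S + cmod (S - v).
  rewrite -[X in _ + X]cmodN opprB (le_trans _ (cmodD _ _))//.
  by rewrite addrCA subrr addr0.
by move: hS hle; lra.
Qed.

(** Monotonicity: the value is the supremum of the finite subsums. *)
Lemma nneg_sum (a : I -> R) M : (forall i, 0 <= a i) ->
  (forall A, \sum_(i <- A) a i <= M) ->
  exists N, (forall A, \sum_(i <- A) a i <= N) /\ hs (fun i => (a i)%:C) N%:C.
Proof.
move=> a0 aM; pose S := [set x | exists A : {fset I}, x = \sum_(i <- A) a i].
have S0 : S !=set0 by exists 0; exists fset0; rewrite big_seq_fset0.
have ubS : has_ubound S by exists M => _ [A ->].
have aS A : \sum_(i <- A) a i <= reals.sup S by apply: ub_le_sup => //; exists A.
exists (reals.sup S); split=> // e e0.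
have [_ [A ->] hA] := sup_adherent e0 (conj S0 ubS).
exists A => B AB.
rewrite -(rmorph_sum (real_complex R)) -rmorphB cmod_real.
have h2 : \sum_(i <- A) a i <= \sum_(i <- B) a i by exact: ler_sum_fsub.
by have h1 := aS B; rewrite ler0_norm ?subr_le0// opprB; move: hA; lra.
Qed.

(** Real and imaginary parts are split into positive and negative parts, and [nneg_sum] applies to
    each of the four. *)
Lemma absb_hs u M : absb u M -> exists v, hs u v.
Proof.
move=> uM.
have hpos (f : C -> R) : (forall z, 0 <= f z) -> (forall z, f z <= cmod z) ->
    exists v, hs (fun i => (f (u i))%:C) v.
  move=> f0 fle; have [] := @nneg_sum (fun i => f (u i)) M.
  - by move=> i; exact: f0.
  - by move=> A; rewrite (le_trans _ (uM A))// ler_sum.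
  - by move=> N [_ h]; exists N%:C.
have pn (g : C -> R) : (forall z, `|g z| <= cmod z) ->
    exists v, hs (fun i => (g (u i))%:C) v.
  move=> gle.
  have [v1 h1] : exists v, hs (fun i => (Num.max (g (u i)) 0)%:C) v.
    apply: (hpos (fun z => Num.max (g z) 0)) => z; first by rewrite le_max lexx orbT.
    by rewrite ge_max cmod_ge0 andbT (le_trans (ler_norm _)).
  have [v2 h2] : exists v, hs (fun i => (Num.max (- g (u i)) 0)%:C) v.
    apply: (hpos (fun z => Num.max (- g z) 0)) => z; first by rewrite le_max lexx orbT.
    by rewrite ge_max cmod_ge0 andbT (le_trans (ler_norm _))// normrN.
  exists (v1 - v2); apply: eq_hs (hs_add h1 (hs_opp h2)) => i /=.
  rewrite -rmorphB; congr (_%:C); set x := g (u i).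
  by case: (leP x 0) => ?; case: (leP (- x) 0) => ?; lra.
have [v1 h1] := pn (@complex.Re R) (@le_cmod_Re R).
have [v2 h2] := pn (@complex.Im R) (@le_cmod_Im R).
exists (v1 + 'i * v2); apply: eq_hs (hs_add h1 (hs_mull 'i h2)) => i.
by rewrite -complexE.
Qed.

Lemma hs_bigsum (J : Type) (s : seq J) (P : pred J) (U : J -> I -> C) (v : J -> C) :
  (forall j, P j -> hs (U j) (v j)) ->
  hs (fun i => \sum_(j <- s | P j) U j i) (\sum_(j <- s | P j) v j).
Proof.
move=> h; elim: s => [|j s ih].
  by rewrite big_nil; apply: hs0 => i; rewrite big_nil.
rewrite big_cons; case: ifP => Pj.
  by apply: eq_hs (hs_add (h _ Pj) ih) => i; rewrite big_cons Pj.
by apply: eq_hs ih => i; rewrite big_cons Pj.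
Qed.

Lemma absb_sum u M : absb u M -> hs u (sum u).
Proof. by move=> /absb_hs[v hv]; rewrite (hs_sum hv). Qed.

End Basic.
End UnorderedSums.

(** * Summation by fibres, reindexing and products *)

Section Grouping.
Variable R : realType.
Local Notation C := R[i].

Section Fibres.
Variables (K I : choiceType) (p : K -> I) (u : K -> C) (s : I -> C).
Hypothesis us : forall i, hs (fun k => if p k == i then u k else 0) (s i).

(** Each of the finitely many fibres over [B] gets an equal share of [e]; the successor in the share
    covers an empty [B]. The set [A] is confined to the preimage of [B], so that its sum splits
    exactly into fibre sums. *)
Let fibre_approx (e : R) (A0 : {fset K}) (B : {fset I}) : 0 < e ->
  exists A : {fset K}, [/\ (forall k, k \in A0 -> p k \in B -> k \in A),
    (forall k, k \in A -> p k \in B) &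
    \sum_(i <- B) cmod (\sum_(k <- A) (if p k == i then u k else 0) - s i) < e].
Proof.
move=> e0.
have n0 : 0 < (#|` B|.+1%:R : R) by rewrite ltr0n.
have e1 : 0 < e / #|` B|.+1%:R by rewrite divr_gt0.
have [F hF] := boolp.choice (fun i => us i e1).
pose A1 := (A0 `|` \bigcup_(i <- B) F i)%fset.
pose A := [fset k in A1 | p k \in B]%fset.
exists A; split.
- by move=> k kA kB; rewrite !inE /= kA kB.
- by move=> k; rewrite !inE /= => /andP[].
have hS i : i \in B -> cmod (\sum_(k <- A) (if p k == i then u k else 0) - s i)
    <= e / #|` B|.+1%:R.
  move=> iB; apply/ltW.
  have -> : \sum_(k <- A) (if p k == i then u k else 0) =
            \sum_(k <- A1) (if p k == i then u k else 0).
    rewrite [RHS](big_fsetID _ [pred k | p k \in B]) /= [X in _ + X]big1_fset ?addr0//.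
    move=> k; rewrite !inE /= => /andP[_ kB] _; case: eqP => // pk.
    by move: kB; rewrite pk iB.
  apply: hF; apply/fsubsetP => k kF; rewrite !inE; apply/orP; right.
  by apply/bigfcupP; exists i => //; rewrite iB.
rewrite (@le_lt_trans _ _ (\sum_(i <- B) (e / #|` B|.+1%:R)))//.
  by rewrite big_seq [leRHS]big_seq ler_sum.
rewrite big_const_seq count_predT iter_addr_0 -[X in X < _]mulr_natr.
rewrite mulrAC ltr_pdivrMr// ltr_pM2l// ltr_nat ltnS //.
Qed.

(** As soon as [B] contains the image of a good finite set [A0], the set given by [fibre_approx]
    contains [A0]; its sum is then close both to [v] and to the sum of the [s i]. *)
Lemma hs_group v : hs u v -> hs s v.
Proof.
move=> uv e e0; have e2 : 0 < e / 2 by rewrite divr_gt0.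
have [A0 hA0] := uv _ e2.
exists (p @` A0)%fset => B AB.
have [A [A1 A2 A3]] := fibre_approx A0 B e2.
have A0A : (A0 `<=` A)%fset.
  apply/fsubsetP => k kA; apply: A1 => //; apply: (fsubsetP AB).
  exact: in_imfset.
have := hA0 _ A0A.
have -> : \sum_(k <- A) u k =
    \sum_(i <- B) \sum_(k <- A) (if p k == i then u k else 0).
  rewrite exchange_big /= big_seq [RHS]big_seq; apply: eq_bigr => k kA.
  rewrite (big_fsetD1 (p k)) /=; last exact: A2.
  rewrite eqxx big1_fset ?addr0// => i; rewrite !inE => /andP[ik _] _.
  by rewrite eq_sym (negbTE ik).
set S := \sum_(i <- B) _ => hS.
have -> : \sum_(i <- B) s i - v = (S - v) - (S - \sum_(i <- B) s i) by ring.
rewrite (le_lt_trans (cmodD _ _))// cmodN (splitr e) ltrD//.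
by rewrite /S -sumrB (le_lt_trans _ A3)// cmod_sum.
Qed.

Lemma absb_group M : absb u M -> absb s M.
Proof.
move=> uM B; rewrite leNgt; apply/negP => lt.
have [A [_ A2 A3]] := fibre_approx fset0 B (eqbRL (subr_gt0 _ _) lt).
have : \sum_(i <- B) cmod (\sum_(k <- A) (if p k == i then u k else 0)) <= M.
  apply: le_trans (uM A).
  apply: (@le_trans _ _ (\sum_(i <- B) \sum_(k <- A)
     (if p k == i then cmod (u k) else 0))).
    apply: ler_sum => i _; apply: le_trans (cmod_sum _ _ _) _.
    by apply: ler_sum => k _; case: eqP => // _; rewrite cmod0.
  rewrite exchange_big /= big_seq [leRHS]big_seq; apply: ler_sum => k kA.
  rewrite (big_fsetD1 (p k)) /=; last exact: A2.
  rewrite eqxx big1_fset ?addr0// => i; rewrite !inE => /andP[ik _] _.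
  by rewrite eq_sym (negbTE ik).
have : \sum_(i <- B) cmod (s i) <= \sum_(i <- B)
    (cmod (\sum_(k <- A) (if p k == i then u k else 0)) +
     cmod (\sum_(k <- A) (if p k == i then u k else 0) - s i)).
  apply: ler_sum => i _; set S := \sum_(k <- A) _.
  by rewrite -{1}(subKr S (s i)) (le_trans (cmodD _ _))// cmodN.
by rewrite big_split /=; move: A3; lra.
Qed.

End Fibres.

Section Reindex.
Variables (I J : choiceType) (f : I -> J).
Hypothesis injf : injective f.

(** This is [hs_group] along [f], whose fibres have at most one point. *)
Lemma hs_image (u : I -> C) (w : J -> C) v :
  (forall i, w (f i) = u i) -> (forall j, (forall i, f i <> j) -> w j = 0) ->
  hs u v -> hs w v.
Proof.
move=> wf w0 uv; apply: (@hs_group _ _ f u w) => // j.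
have [[i fi]|h] := pselect (exists i, f i = j).
  have := @hs_fin _ _ (fun k => if f k == j then u k else 0) [fset i]%fset.
  rewrite big_seq_fset1 fi eqxx -wf fi; apply => k; rewrite inE.
  by case: (f k =P j) => // fk; rewrite -fi in fk; rewrite (injf fk) eqxx.
rewrite w0; last by move=> i fi; apply: h; exists i.
by apply: hs0 => i; case: eqP => // fi; case: h; exists i.
Qed.

Lemma absb_comp (w : J -> C) M : absb w M -> absb (fun i => w (f i)) M.
Proof.
move=> h A; have := h (f @` A)%fset; rewrite big_imfset //= => x y _ _.
exact: injf.
Qed.

End Reindex.

Section Pairs.
Variables (I J : choiceType).

(** A finite set of pairs lies in the product of its two projections, so bounding rectangular sums
    is enough. *)
Lemma absb_pair (u : I -> J -> C) (M : I -> R) N :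
  (forall i, absb (u i) (M i)) -> (forall A : {fset I}, \sum_(i <- A) M i <= N) ->
  absb (fun k : I * J => u k.1 k.2) N.
Proof.
move=> uM MN A.
pose A1 := [fset k.1 | k in A]%fset; pose A2 := [fset k.2 | k in A]%fset.
apply: le_trans (MN A1).
apply: (@le_trans _ _ (\sum_(i <- A1) \sum_(j <- A2) cmod (u i j))); last first.
  by apply: ler_sum => i _; exact: uM.
rewrite -(big_allpairs_dep (h := fun (i : I) (j : J) => (i, j)) (r1 := A1)
  (r2 := fun=> A2)
  (F := fun k => cmod (u k.1 k.2))).
rewrite [leRHS](bigID (fun k => k \in A)) /= -[leLHS]addr0 lerD//.
  rewrite -[leRHS]big_filter le_eqVlt; apply/orP; left; apply/eqP.
  apply: perm_big; apply: uniq_perm.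
  - exact: fset_uniq.
  - by rewrite filter_uniq// allpairs_uniq// => -[? ?] [? ?].
  move=> k; rewrite mem_filter; case: (boolP (k \in A)) => //= kA; apply/esym.
  apply/allpairsP; exists k; split; rewrite -?surjective_pairing//.
    by apply: in_imfset.
  by apply: in_imfset.
by apply: sumr_ge0 => k _; exact: cmod_ge0.
Qed.

Lemma absb_mul (a : I -> C) (b : J -> C) Ma Mb : absb a Ma -> absb b Mb ->
  absb (fun k : I * J => a k.1 * b k.2) (Ma * Mb).
Proof.
move=> ha hb; apply: (@absb_pair (fun i j => a i * b j) (fun i => cmod (a i) * Mb)).
  by move=> i; exact: absb_mull.
by move=> A; rewrite -mulr_suml ler_wpM2r ?(absb_ge0 hb)//.
Qed.

(** Absolute convergence gives a sum over pairs; grouping it by the first index identifies its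
    value. *)
Lemma hs_mul (a : I -> C) (b : J -> C) Ma Mb va vb : absb a Ma -> absb b Mb ->
  hs a va -> hs b vb -> hs (fun k : I * J => a k.1 * b k.2) (va * vb).
Proof.
move=> ha hb hva hvb; have [v h] := absb_hs (absb_mul ha hb).
suff hs1 : hs (fun i => vb * a i) v by rewrite mulrC (hs_uniq (hs_mull vb hva) hs1).
apply: (hs_group (p := fst) _ h) => i; rewrite mulrC.
by apply: (@hs_image _ _ (pair i)) (hs_mull (a i) hvb) => [j j' []//|j/=|[i' j] /= hk];
    [rewrite eqxx | case: eqP => // ii'; case: (hk j); rewrite ii'].
Qed.

End Pairs.
End Grouping.

(** * The complex exponential as a power series *)

Section ComplexExponential.
Variable R : realType.
Local Notation C := R[i].
Implicit Types (z w : C) (x y : R).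

Lemma big_fset_iota (V : nmodType) (F : nat -> V) n :
  \sum_(i <- [fset i in iota 0 n]%fset) F i = \sum_(0 <= i < n) F i.
Proof.
apply: perm_big; apply: uniq_perm; rewrite ?fset_uniq ?iota_uniq//.
by move=> i; rewrite !inE /index_iota subn0.
Qed.

Lemma in_fset_iota i n : (i \in [fset i in iota 0 n]%fset) = (i < n)%N.
Proof. by rewrite !inE mem_iota. Qed.

Lemma fset_nat_sub (A : {fset nat}) : exists N, forall n, (N <= n)%N ->
  (A `<=` [fset i in iota 0 n])%fset.
Proof.
exists (\max_(i <- A) i).+1 => n Nn; apply/fsubsetP => i iA.
rewrite in_fset_iota (leq_trans _ Nn)// ltnS.
by rewrite (big_fsetD1 i)//= leq_maxl.
Qed.

Lemma absb_nat (u : nat -> C) M :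
  (forall n, \sum_(0 <= i < n) cmod (u i) <= M) -> absb u M.
Proof.
move=> h A; have [N hN] := fset_nat_sub A.
rewrite (le_trans _ (h N))// -big_fset_iota ler_sum_fsub//; first exact: hN.
by move=> i; exact: cmod_ge0.
Qed.

Lemma hs_series_real (a : nat -> R) M (l : R) : absb (fun n => (a n)%:C) M ->
  series a @ \oo --> l -> hs (fun n => (a n)%:C) l%:C.
Proof.
move=> aM al; have [v h] := absb_hs aM.
suff -> : l%:C = v by [].
apply/eqP; rewrite -subr_eq0; apply/eqP/cmod_eq_le0 => e e0.
have e2 : 0 < e / 2 by rewrite divr_gt0.
have [A hA] := h _ e2; have [N hN] := fset_nat_sub A.
have /cvgrPdist_lt/(_ _ e2)[N' _ hN'] := al.
have {hA} := hA _ (hN (maxn N N') (leq_maxl _ _)).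
have {hN'} /= := hN' (maxn N N') (leq_maxr _ _).
rewrite big_fset_iota -rmorph_sum /= -cmod_real rmorphB /=.
rewrite /series /=; set S := (\sum_(_ <= _ < _) _)%:C => h1 h2.
have -> : l%:C - v = (l%:C - S) + (S - v) by ring.
by rewrite (le_lt_trans (cmodD _ _))// (splitr e) ltrD.
Qed.

Lemma real_complexX x n : (x ^+ n)%:C = x%:C ^+ n.
Proof. exact: (rmorphXn (real_complex R)). Qed.

Lemma real_complex_nat n : (n%:R : R)%:C = n%:R.
Proof. exact: (rmorph_nat (real_complex R)). Qed.

Lemma real_complexV x : (x^-1)%:C = (x%:C)^-1.
Proof. exact: (fmorphV (real_complex R)). Qed.

Lemma real_complexM x y : (x * y)%:C = x%:C * y%:C.
Proof. exact: (rmorphM (real_complex R)). Qed.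

Lemma real_complexD x y : (x + y)%:C = x%:C + y%:C.
Proof. exact: (rmorphD (real_complex R)). Qed.

Lemma complex_split x y : x%:C + 'i * y%:C = x +i* y.
Proof. by rewrite [RHS]complexE. Qed.

Lemma ReD z w : complex.Re (z + w) = complex.Re z + complex.Re w.
Proof. by case: z w => [? ?] []. Qed.

Lemma ImD z w : complex.Im (z + w) = complex.Im z + complex.Im w.
Proof. by case: z w => [? ?] []. Qed.

Lemma cmod_nat n : cmod (n%:R : C) = n%:R.
Proof. by rewrite -real_complex_nat cmod_real ger0_norm. Qed.

Lemma absb_expR x : 0 <= x -> absb (fun n => (x ^+ n / n`!%:R)%:C) (expR x).
Proof.
move=> x0; apply: absb_nat => n.
under eq_bigr do rewrite cmod_real ger0_norm ?divr_ge0 ?exprn_ge0//.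
have := nondecreasing_cvgn_le _ (is_cvg_series_exp_coeff x) n; apply.
move=> a b ab; rewrite -subr_ge0 sub_series_geq// sumr_ge0// => i _.
exact: exp_coeff_ge0.
Qed.

Lemma absb_cexp z : absb (fun n => z ^+ n / n`!%:R) (expR (cmod z)).
Proof.
apply: absb_le (lexx _) (absb_expR (cmod_ge0 z)) => n.
rewrite cmod_real cmodM cmodX cmodV cmod_nat ger0_norm//.
by rewrite divr_ge0 ?exprn_ge0 ?cmod_ge0.
Qed.

Let hs_expR x : hs (fun n => x%:C ^+ n / n`!%:R) (expR x)%:C.
Proof.
have h : absb (fun n => (x ^+ n / n`!%:R)%:C) (expR (cmod x%:C)).
  apply: absb_le (lexx _) (absb_cexp x%:C) => n.
  by rewrite real_complexM real_complexV real_complex_nat real_complexX.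
have := hs_series_real h (is_cvg_series_exp_coeff x).
by apply: eq_hs => n; rewrite real_complexM real_complexV real_complex_nat real_complexX.
Qed.

Let iX y n : ('i * y%:C) ^+ n / n`!%:R =
  (cos_coeff y n)%:C + 'i * (sin_coeff y n)%:C.
Proof.
rewrite /cos_coeff /sin_coeff /=.
rewrite !real_complexM !real_complexV !real_complex_nat !real_complexX.
rewrite exprMn_comm; last exact: mulrC.
have iN m : 'i ^+ m.*2 = (-1) ^+ m :> C by rewrite -mul2n exprM sqr_i.
rewrite -{1}(odd_double_half n); case: (boolP (odd n)) => on /=.
  rewrite add1n exprS iN !mul0r mul1r add0r.
  have -> : (n.-1)./2 = n./2.
    by rewrite -{1}(odd_double_half n) on add1n /= doubleK.
  by rewrite rmorphN1 !mulrA.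
by rewrite add0n iN !mul0r !mulr0 mul1r addr0 rmorphN1.
Qed.

Let hs_cis y : hs (fun n => ('i * y%:C) ^+ n / n`!%:R) (cos y +i* sin y).
Proof.
rewrite [_ +i* _]complexE /=.
have hb := absb_cexp ('i * y%:C).
have pick (a : nat -> R) : (forall n, `|a n| <= cmod (('i * y%:C) ^+ n / n`!%:R)) ->
    absb (fun n => (a n)%:C) (expR (cmod ('i * y%:C))).
  by move=> ale; apply: absb_le (lexx _) hb => n; rewrite cmod_real.
apply: (@eq_hs _ _ (fun n => (cos_coeff y n)%:C + 'i * (sin_coeff y n)%:C)).
  by move=> n; rewrite iX.
apply: hs_add; last apply: hs_mull.
  apply: (@hs_series_real _ (expR (cmod ('i * y%:C)))).
    apply: pick => n; by rewrite iX complex_split; apply: le_trans (le_cmod_Re _).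
  by rewrite unlock; exact: is_cvg_series_cos_coeff.
apply: (@hs_series_real _ (expR (cmod ('i * y%:C)))).
  apply: pick => n; by rewrite iX complex_split; apply: le_trans (le_cmod_Im _).
by rewrite unlock; exact: is_cvg_series_sin_coeff.
Qed.

(** [cexp] is defined through [expR], [cos] and [sin]; its power series is the Cauchy product of
    those of exp(a) and exp(i b), grouped along antidiagonals. *)
Lemma hs_cexp z : hs (fun n => z ^+ n / n`!%:R) (cexp z).
Proof.
rewrite /cexp; set a := complex.Re z; set b := complex.Im z.
have zE : z = a%:C + 'i * b%:C by exact: complexE.
have := hs_mul (absb_cexp a%:C) (absb_cexp ('i * b%:C)) (hs_expR a) (hs_cis b).
apply: (hs_group (p := fun k : nat * nat => (k.1 + k.2)%N)) => n.
pose f (j : nat) := (j, (n - j)%N).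
have injf : injective f by move=> j j' [].
have := @hs_fin _ _ (fun j => if (j <= n)%N then
   (a%:C ^+ j / j`!%:R) * (('i * b%:C) ^+ (n - j) / (n - j)`!%:R) else 0)
   [fset i in iota 0 n.+1]%fset.
rewrite big_fset_iota big_mkord => h.
have -> : z ^+ n / n`!%:R = \sum_(i < n.+1) (if (i <= n)%N then
   (a%:C ^+ i / i`!%:R) * (('i * b%:C) ^+ (n - i) / (n - i)`!%:R) else 0).
  rewrite {1}zE addrC exprDn mulr_suml; apply: eq_bigr => i _.
  have hi : (i <= n)%N by rewrite -ltnS.
  rewrite hi -(bin_fact hi) !natrM mulrC -mulr_natl.
  have f1 : i`!%:R != 0 :> C by rewrite pnatr_eq0 -lt0n fact_gt0.
  have f2 : (n - i)`!%:R != 0 :> C by rewrite pnatr_eq0 -lt0n fact_gt0.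
  have f3 : 'C(n, i)%:R != 0 :> C by rewrite pnatr_eq0 -lt0n bin_gt0.
  by field; rewrite f1 f2 f3.
apply: (@hs_image _ _ _ f injf) (h _) => [j||j].
- rewrite /=; case: (leqP j n) => jn; first by rewrite subnKC ?eqxx.
  by case: eqP => // e; move: jn; rewrite -e ltnNge leq_addr.
- case=> [i j] hk /=; case: eqP => // e; case: (hk i).
  by rewrite /f -e addKn.
- by rewrite in_fset_iota ltnS => /negbTE ->.
Qed.

Lemma cmod_cexp z : cmod (cexp z) = expR (complex.Re z).
Proof.
rewrite /cexp cmodM cmod_real ger0_norm ?expR_ge0// /cmod /=.
by rewrite cos2Dsin2 sqrtr1 mulr1.
Qed.

Lemma cexpD z w : cexp (z + w) = cexp z * cexp w.
Proof.
rewrite /cexp ReD ImD expRD real_complexM mulrACA cosD sinD.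
congr (_ * _); rewrite -[RHS]/((_ - _) +i* (_ + _)).
by congr (_ +i* _); rewrite addrC.
Qed.

Lemma cexp0 : cexp (0 : C) = 1.
Proof. by rewrite /cexp /= expR0 cos0 sin0 mul1r. Qed.

Lemma cexp_sum (I : Type) (s : seq I) (P : pred I) (F : I -> C) :
  cexp (\sum_(i <- s | P i) F i) = \prod_(i <- s | P i) cexp (F i).
Proof. exact: (big_morph _ cexpD cexp0). Qed.

Lemma cexpMn z n : cexp (z *+ n) = cexp z ^+ n.
Proof. by elim: n => [|n ih]; rewrite ?mulr0n ?cexp0// mulrS exprS cexpD ih. Qed.

Lemma cexpN z : cexp (- z) = (cexp z)^-1.
Proof.
apply: (@mulfI _ (cexp z)).
  apply/eqP => h; have := cexpD z (- z).
  by rewrite subrr cexp0 h mul0r => /eqP; rewrite oner_eq0.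
rewrite -cexpD subrr cexp0 mulfV//; apply/eqP => h; have := cexpD z (- z).
by rewrite subrr cexp0 h mul0r => /eqP; rewrite oner_eq0.
Qed.

Lemma cexp_periodic (k : int) : cexp ('i * (2 * pi * k%:~R)%:C : C) = 1.
Proof.
have h : cexp ('i * (2 * pi)%:C : C) = 1.
  have -> : 'i * (2 * pi)%:C = 0 +i* (pi *+ 2) :> C.
    by rewrite -complex_split add0r mulr_natl.
  by rewrite /cexp /= expR0 mul1r cos2pi sin2pi.
have hn n : cexp ('i * (2 * pi)%:C *+ n : C) = 1 by rewrite cexpMn h expr1n.
rewrite real_complexM mulrA (rmorph_int (real_complex R)) mulrzr.
by case: k => n; [exact: hn|rewrite NegzE mulrNz cexpN hn invr1].
Qed.

End ComplexExponential.

(** * Coordinates and Taylor-Fourier series *)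

Section Coordinates.
Variables (R : realType) (n1 n2 : nat).
Local Notation C := R[i].
Local Notation Z := (phase R n1 n2).
Local Notation X := (tfindex n1 n2).

(** One finite index type for actions, angles, xi and eta: a monomial becomes a product over
    coordinates, and estimates are proved one factor at a time. *)
Definition coordinate : finType := (('I_n1 + 'I_n1) + ('I_n2 + 'I_n2))%type.
Local Notation cp i := (inl (inl i) : coordinate).
Local Notation cq i := (inl (inr i) : coordinate).
Local Notation cx j := (inr (inl j) : coordinate).
Local Notation ce j := (inr (inr j) : coordinate).

Definition is_angle (c : coordinate) : bool :=
  if c is inl (inr _) then true else false.

Definition cidx (c : coordinate) : 'I_((n1 + n1) + (n2 + n2)) :=
  match c with
  | inl (inl i) => lshift (n2 + n2) (lshift n1 i)
  | inl (inr i) => lshift (n2 + n2) (rshift n1 i)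
  | inr (inl j) => rshift (n1 + n1) (lshift n2 j)
  | inr (inr j) => rshift (n1 + n1) (rshift n2 j)
  end.

Definition coord (c : coordinate) (z : Z) : C := z 0 (cidx c).

Lemma cidx_surj k : exists c, cidx c = k.
Proof.
case: (split_ordP k) => k' ->; case: (split_ordP k') => i ->.
- by exists (cp i).
- by exists (cq i).
- by exists (cx i).
- by exists (ce i).
Qed.

Lemma cidx_inj : injective cidx.
Proof.
pose g (k : 'I_((n1 + n1) + (n2 + n2))) : coordinate :=
  match fintype.split k with
  | inl k' => inl (fintype.split k') | inr k' => inr (fintype.split k') end.
apply: (can_inj (g := g)) => -[[i|i]|[i|i]]; rewrite /g /=.
- by rewrite (unsplitK (inl _)) (unsplitK (inl _)).
- by rewrite (unsplitK (inl _)) (unsplitK (inr _)).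
- by rewrite (unsplitK (inr _)) (unsplitK (inl _)).
- by rewrite (unsplitK (inr _)) (unsplitK (inr _)).
Qed.

Lemma coord_act i z : act z 0 i = coord (cp i) z.
Proof. by rewrite !mxE. Qed.
Lemma coord_ang i z : ang z 0 i = coord (cq i) z.
Proof. by rewrite !mxE. Qed.
Lemma coord_cxi j z : cxi z 0 j = coord (cx j) z.
Proof. by rewrite !mxE. Qed.
Lemma coord_ceta j z : ceta z 0 j = coord (ce j) z.
Proof. by rewrite !mxE. Qed.

Lemma coordD c z w : coord c (z + w) = coord c z + coord c w.
Proof. by rewrite /coord !mxE. Qed.
Lemma coordN c z : coord c (- z) = - coord c z.
Proof. by rewrite /coord !mxE. Qed.
Lemma coordB c z w : coord c (z - w) = coord c z - coord c w.
Proof. by rewrite coordD coordN. Qed.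
Lemma coordZ c a z : coord c (a *: z) = a * coord c z.
Proof. by rewrite /coord !mxE. Qed.
Lemma coord0 c : coord c 0 = 0.
Proof. by rewrite /coord !mxE. Qed.

Lemma coord_inj z w : (forall c, coord c z = coord c w) -> z = w.
Proof.
by move=> h; apply/rowP => k; have [c <-] := cidx_surj k; exact: h.
Qed.

Definition mkphase (f : coordinate -> C) : Z :=
  row_mx (row_mx (\row_i f (cp i)) (\row_i f (cq i)))
         (row_mx (\row_j f (cx j)) (\row_j f (ce j))).

Lemma coord_mkphase f c : coord c (mkphase f) = f c.
Proof.
by case: c => [[i|i]|[i|i]]; rewrite /coord /= ?row_mxEl ?row_mxEr ?row_mxEl
  ?row_mxEr mxE.
Qed.

Definition xexp (c : coordinate) (x : X) : nat :=
  match c with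
  | inl (inl i) => ix_i x i
  | inl (inr i) => 0
  | inr (inl j) => ix_m1 x j
  | inr (inr j) => ix_m2 x j
  end.

Definition xfreq (c : coordinate) (x : X) : int :=
  if c is inl (inr i) then ix_k x i else 0.

Definition mkindex (n : coordinate -> nat) (k : coordinate -> int) : X :=
  ([ffun i => n (cp i)], ([ffun j => n (cx j)], [ffun j => n (ce j)]),
   [ffun i => k (cq i)]).

Lemma xexp_mk n k c : xexp c (mkindex n k) = if is_angle c then 0%N else n c.
Proof. by case: c => [[i|i]|[i|i]] //=; rewrite ffunE. Qed.

Lemma xfreq_mk n k c : xfreq c (mkindex n k) = if is_angle c then k c else 0.
Proof. by case: c => [[i|i]|[i|i]] //=; rewrite ffunE. Qed.

Lemma xexp_angle c x : is_angle c -> xexp c x = 0%N.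
Proof. by case: c => [[i|i]|[i|i]]. Qed.

Lemma xfreq_nangle c x : ~~ is_angle c -> xfreq c x = 0.
Proof. by case: c => [[i|i]|[i|i]]. Qed.

Lemma index_ext (x y : X) : (forall c, xexp c x = xexp c y) ->
  (forall c, xfreq c x = xfreq c y) -> x = y.
Proof.
case: x y => [[i [m1 m2]] k] [[i' [m1' m2']] k'] h h'.
have e1 : i = i' by apply/ffunP => j; exact: (h (cp j)).
have e2 : m1 = m1' by apply/ffunP => j; exact: (h (cx j)).
have e3 : m2 = m2' by apply/ffunP => j; exact: (h (ce j)).
have e4 : k = k' by apply/ffunP => j; exact: (h' (cq j)).
by rewrite e1 e2 e3 e4.
Qed.

Lemma prod_coordinate (V : comPzRingType) (F : coordinate -> V) : \prod_c F c =
  (\prod_i F (cp i) * \prod_i F (cq i)) * (\prod_j F (cx j) * \prod_j F (ce j)).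
Proof. by rewrite !big_sumType. Qed.

Lemma sum_coordinate (V : nmodType) (F : coordinate -> V) : \sum_c F c =
  (\sum_i F (cp i) + \sum_i F (cq i)) + (\sum_j F (cx j) + \sum_j F (ce j)).
Proof. by rewrite !big_sumType. Qed.

Definition cfactor (c : coordinate) (x : X) (y : C) : C :=
  if is_angle c then cexp ('i * (xfreq c x)%:~R * y) else y ^+ xexp c x.

Lemma tfmonoE x z : tfmono x z = \prod_c cfactor c x (coord c z).
Proof.
rewrite prod_coordinate /tfmono /cfactor /=.
rewrite mulr_sumr cexp_sum -!mulrA; congr (_ * (_ * (_ * _))).
- by apply: eq_bigr => i _; rewrite coord_act.
- by apply: eq_bigr => i _; rewrite coord_ang mulrA.
- by apply: eq_bigr => i _; rewrite coord_cxi.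
- by apply: eq_bigr => i _; rewrite coord_ceta.
Qed.

Definition cweight (c : coordinate) (x : X) (r : R) : R :=
  if is_angle c then expR (`|xfreq c x|%N%:R * r) else r ^+ xexp c x.

Lemma cweight_gt0 c x r : 0 < r -> 0 < cweight c x r.
Proof. by move=> r0; rewrite /cweight; case: ifP; rewrite ?expR_gt0 ?exprn_gt0. Qed.

Lemma cweight_le c x r r' : 0 <= r -> r <= r' -> cweight c x r <= cweight c x r'.
Proof.
move=> r0 rr'; rewrite /cweight; case: ifP => _.
  by rewrite ler_expR ler_wpM2l.
by rewrite lerXn2r// nnegrE (le_trans r0).
Qed.

(* Angles are only bounded in the imaginary direction. *)
Definition csize (c : coordinate) (y : C) : R :=
  if is_angle c then `|complex.Im y| else cmod y.

Lemma csizeD c y v : csize c (y + v) <= csize c y + cmod v.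
Proof.
rewrite /csize; case: ifP => _; last exact: cmodD.
by rewrite ImD (le_trans (ler_normD _ _))// lerD2l le_cmod_Im.
Qed.

Lemma intr_complex (k : int) : (k%:~R : C) = (k%:~R : R)%:C.
Proof. by rewrite (rmorph_int (real_complex R)). Qed.

Lemma cmod_int (k : int) : cmod (k%:~R : C) = `|k|%N%:R.
Proof. by rewrite intr_complex cmod_real -intr_norm pmulrn abszE. Qed.

Lemma Re_iM (a : R) (y : C) : complex.Re ('i * a%:C * y) = - (a * complex.Im y).
Proof.
have -> : 'i * a%:C * y = (- (a * complex.Im y)) +i* (a * complex.Re y).
  case: y => u v; rewrite /= -!complex_split rmorphN !real_complexM.
  have ii : 'i * 'i = -1 :> C by rewrite -expr2 sqr_i.
  apply: (@eq_trans _ _ (('i * 'i) * (a%:C * v%:C) + 'i * (a%:C * u%:C))); first by ring.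
  by rewrite ii mulN1r -real_complexM.
by [].
Qed.

Lemma cmod_cfactor c x y r : csize c y <= r ->
  cmod (cfactor c x y) <= cweight c x r.
Proof.
rewrite /csize /cfactor /cweight; case: ifP => _ h.
  rewrite cmod_cexp ler_expR intr_complex Re_iM.
  rewrite (le_trans (ler_norm _))// normrN normrM -intr_norm pmulrn abszE.
  by rewrite ler_wpM2l.
by rewrite cmodX lerXn2r// nnegrE ?cmod_ge0// (le_trans (cmod_ge0 _) h).
Qed.

Definition xadd (x y : X) : X :=
  mkindex (fun c => xexp c x + xexp c y)%N (fun c => xfreq c x + xfreq c y).

Lemma cfactor_add c x x' y :
  cfactor c (xadd x x') y = cfactor c x y * cfactor c x' y.
Proof.
rewrite /cfactor xexp_mk xfreq_mk; case: (is_angle c).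
  by rewrite -cexpD intrD mulrDr mulrDl.
by rewrite exprD.
Qed.


Definition xdeg (x : X) : nat := (2 * tf_l x + tf_m x)%N.

Definition cdeg (c : coordinate) : nat := if c is inl (inl _) then 2 else 1.

Lemma xdegE x : xdeg x = (\sum_c cdeg c * xexp c x)%N.
Proof.
rewrite !big_sumType /= /xdeg /tf_l /tf_m /mlen.
rewrite big_distrr /= [X in (_ + X + _)%N]big1 ?addn0//.
by congr (_ + (_ + _))%N; apply: eq_bigr => j _; rewrite mul1n.
Qed.

Lemma xdeg_add x y : xdeg (xadd x y) = (xdeg x + xdeg y)%N.
Proof.
rewrite !xdegE -big_split /=; apply: eq_bigr => c _.
rewrite xexp_mk -mulnDr; case: ifP => // a.
by rewrite !xexp_angle// addn0.
Qed.

(** Makes a single factor of a monomial a monomial in its own right, so that results on monomials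
    apply to it. *)
Definition xsel (c : coordinate) (x : X) : X :=
  mkindex (fun c' => if c' == c then xexp c x else 0%N)
          (fun c' => if c' == c then xfreq c x else 0).

Lemma cfactor_sel c x c' y :
  cfactor c' (xsel c x) y = if c' == c then cfactor c x y else 1.
Proof.
rewrite /cfactor xexp_mk xfreq_mk; case: (eqVneq c' c) => [->|_].
  by case: (is_angle c).
by case: (is_angle _); rewrite ?expr0// mulr0z mulr0 mul0r cexp0.
Qed.

Lemma cweight_sel c x c' r :
  cweight c' (xsel c x) r = if c' == c then cweight c x r else 1.
Proof.
rewrite /cweight xexp_mk xfreq_mk; case: (eqVneq c' c) => [->|_].
  by case: (is_angle c).
by case: (is_angle _); rewrite ?expr0// absz0 mul0r expR0.
Qed.

Lemma tfmono_sel c x (z : Z) : tfmono (xsel c x) z = cfactor c x (coord c z).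
Proof.
rewrite tfmonoE (bigD1 c)//= cfactor_sel eqxx big1 ?mulr1// => c' /negbTE h.
by rewrite cfactor_sel h.
Qed.

Lemma tfmono_add x y (z : Z) : tfmono (xadd x y) z = tfmono x z * tfmono y z.
Proof.
by rewrite !tfmonoE -big_split /=; apply: eq_bigr => c _; rewrite cfactor_add.
Qed.

Definition x0 : X := mkindex (fun=> 0%N) (fun=> 0).

Lemma tfmono0 (z : Z) : tfmono x0 z = 1.
Proof.
rewrite tfmonoE big1// => c _; rewrite /cfactor xexp_mk xfreq_mk.
by case: (is_angle _); rewrite ?expr0// mulr0z mulr0 mul0r cexp0.
Qed.

Lemma xdeg0 : xdeg x0 = 0%N.
Proof.
by rewrite xdegE big1// => c _; rewrite xexp_mk; case: ifP => _; rewrite muln0.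
Qed.

End Coordinates.

(** * Weighted norms of Taylor-Fourier series *)

Section Expansions.
Variables (R : realType) (n1 n2 : nat).
Local Notation C := R[i].
Local Notation Z := (phase R n1 n2).
Local Notation X := (tfindex n1 n2).
Local Notation coordinate := (coordinate n1 n2).

(* All domains used in the proof are the polydiscs of radii [rd c + t]. *)
Variable rd : coordinate -> R.
Hypothesis rd_gt0 : forall c, 0 < rd c.

Definition weight (t : R) (x : X) : R := \prod_c cweight c x (rd c + t).

Definition pdom (t : R) : set Z :=
  [set z | forall c, csize c (coord c z) < rd c + t].

(** A weighted l^1 norm of the coefficients: it dominates the supremum on [pdom t] and is
    submultiplicative. *)
Definition nle (t : R) (a : X -> C) (M : R) : Prop :=
  absb (fun x => a x * (weight t x)%:C) M.

Lemma rdD_gt0 c t : 0 <= t -> 0 < rd c + t.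
Proof. by move=> t0; rewrite ltr_wpDr. Qed.

Lemma weight_gt0 t x : 0 <= t -> 0 < weight t x.
Proof. by move=> t0; rewrite prodr_gt0// => c _; exact/cweight_gt0/rdD_gt0. Qed.

Lemma weight_ge0 t x : 0 <= t -> 0 <= weight t x.
Proof. by move=> t0; rewrite ltW// weight_gt0. Qed.

Lemma weight_neq0 t x : 0 <= t -> (weight t x)%:C != 0 :> C.
Proof.
move=> t0; apply/eqP => /(congr1 (@complex.Re R)) /= h.
by have := weight_gt0 x t0; rewrite h ltxx.
Qed.

Lemma weight_le t t' x : 0 <= t -> t <= t' -> weight t x <= weight t' x.
Proof.
move=> t0 tt'; apply: ler_prod => c _; rewrite ltW ?cweight_gt0 ?rdD_gt0//=.
by rewrite cweight_le ?lerD2l// ltW// rdD_gt0.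
Qed.

(** Exponents add exactly; for frequencies the triangle inequality for [|k + k'|] is used. This is
    the source of submultiplicativity of the norm. *)
Lemma weight_add t x y : 0 <= t -> weight t (xadd x y) <= weight t x * weight t y.
Proof.
move=> t0; rewrite /weight -big_split /=; apply: ler_prod => c _.
have r0 := rdD_gt0 c t0; rewrite ltW ?cweight_gt0//=.
rewrite /cweight xexp_mk xfreq_mk; case: (is_angle c); last by rewrite exprD.
rewrite -expRD ler_expR -mulrDl ler_wpM2r//; first exact: ltW.
by rewrite -natrD ler_nat; lia.
Qed.

Lemma weight0 t : weight t (x0 n1 n2) = 1.
Proof.
rewrite /weight big1// => c _; rewrite /cweight xexp_mk xfreq_mk.
by case: (is_angle _); rewrite ?expr0// absz0 mul0r expR0.
Qed.

Lemma weight_sel t c x : weight t (xsel c x) = cweight c x (rd c + t).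
Proof.
rewrite /weight (bigD1 c)//= cweight_sel eqxx big1 ?mulr1// => c' /negbTE h.
by rewrite cweight_sel h.
Qed.

Lemma pdom_le t t' z : t <= t' -> pdom t z -> pdom t' z.
Proof. by move=> tt' h c; rewrite (lt_le_trans (h c))// lerD2l. Qed.

Lemma pdomD t b z v : (forall c, cmod (coord c v) <= b) -> pdom t z ->
  pdom (t + b) (z + v).
Proof.
move=> hv hz c; rewrite coordD (le_lt_trans (csizeD _ _ _))// addrA.
by rewrite ltr_leD.
Qed.

Lemma cmod_tfmono t x z : pdom t z -> cmod (tfmono x z) <= weight t x.
Proof.
move=> hz; rewrite tfmonoE cmod_prod; apply: ler_prod => c _.
by rewrite cmod_ge0 cmod_cfactor// ltW.
Qed.

Lemma nle_absb t a M z : 0 <= t -> nle t a M -> pdom t z ->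
  absb (fun x => a x * tfmono x z) M.
Proof.
move=> t0 h hz; apply: absb_le (lexx _) h => x.
rewrite cmodM [leRHS]cmodM ler_wpM2l ?cmod_ge0// cmod_real ger0_norm ?weight_ge0//.
exact: cmod_tfmono.
Qed.

Lemma nle_hs t a M z : 0 <= t -> nle t a M -> pdom t z ->
  hs (fun x => a x * tfmono x z) (tfeval a z).
Proof. by move=> t0 h hz; apply: absb_sum (nle_absb t0 h hz). Qed.

Lemma nle_tfeval t a M z : 0 <= t -> nle t a M -> pdom t z ->
  cmod (tfeval a z) <= M.
Proof.
by move=> t0 h hz; apply: absb_hs_le (nle_absb t0 h hz) (nle_hs t0 h hz).
Qed.

Lemma nle_le t t' a b M M' : 0 <= t -> t <= t' -> M <= M' ->
  (forall x, cmod (a x) <= cmod (b x)) -> nle t' b M -> nle t a M'.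
Proof.
move=> t0 tt' MM' ab; apply: absb_le => // x; rewrite !cmodM.
have w0 := weight_gt0 x t0; have w1 := weight_gt0 x (le_trans t0 tt').
by rewrite ler_pM ?cmod_ge0// !cmod_real !ger0_norm ?weight_le// ltW.
Qed.

Lemma nle_add t a b M N : nle t a M -> nle t b N ->
  nle t (fun x => a x + b x) (M + N).
Proof.
move=> ha hb; have := absb_add ha hb; apply: absb_le => // x.
by rewrite -mulrDl.
Qed.

Lemma nle_scale t k a M : nle t a M -> nle t (fun x => k * a x) (cmod k * M).
Proof.
by move=> /(absb_mull k); apply: absb_le => // x; rewrite mulrA.
Qed.

(** A predicate on functions instead of coefficients, so that products and composites can be bounded
    without writing their coefficients; [d] is a lower bound for the degrees that occur. *)
Definition ex (d : nat) (t : R) (F : Z -> C) (M : R) : Prop :=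
  exists a : X -> C, [/\ nle t a M, forall x, (xdeg x < d)%N -> a x = 0 &
    forall z, pdom t z -> hs (fun x => a x * tfmono x z) (F z)].

Lemma exP d t F M : 0 <= t -> ex d t F M -> exists a : X -> C,
  [/\ nle t a M, forall x, (xdeg x < d)%N -> a x = 0 &
    forall z, pdom t z -> F z = tfeval a z].
Proof.
move=> t0 [a [h1 h2 h3]]; exists a; split=> // z hz.
exact: hs_uniq (h3 _ hz) (nle_hs t0 h1 hz).
Qed.

Lemma ex_tfeval d t a M : 0 <= t -> nle t a M ->
  (forall x, (xdeg x < d)%N -> a x = 0) -> ex d t (tfeval a) M.
Proof. by move=> t0 h1 h2; exists a; split=> // z hz; exact: nle_hs hz. Qed.

Lemma ex_cmod_le d t F M z : 0 <= t -> ex d t F M -> pdom t z -> cmod (F z) <= M.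
Proof.
by move=> t0 /(exP t0)[a [h1 _ h3]] hz; rewrite h3//; exact: nle_tfeval h1 hz.
Qed.

Lemma eq_ex d t F G M : (forall z, pdom t z -> F z = G z) -> ex d t F M ->
  ex d t G M.
Proof.
by move=> FG [a [h1 h2 h3]]; exists a; split=> // z hz; rewrite -FG//; exact: h3.
Qed.

Lemma ex_le d d' t t' F M M' : (d <= d')%N -> 0 <= t -> t <= t' -> M <= M' ->
  ex d' t' F M -> ex d t F M'.
Proof.
move=> dd' t0 tt' MM' [a [h1 h2 h3]]; exists a; split.
- exact: nle_le h1.
- by move=> x xd; apply: h2; exact: leq_trans xd dd'.
- by move=> z hz; apply: h3; exact: pdom_le hz.
Qed.

Lemma ex_leM d t F M M' : 0 <= t -> M <= M' -> ex d t F M -> ex d t F M'.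
Proof. by move=> t0 h; apply: ex_le. Qed.

Lemma ex_ge0 d t F M : ex d t F M -> 0 <= M.
Proof. by move=> [a [h _ _]]; exact: absb_ge0 h. Qed.

Lemma ex_add d t F G M N : ex d t F M -> ex d t G N ->
  ex d t (fun z => F z + G z) (M + N).
Proof.
move=> [a [h1 h2 h3]] [b [g1 g2 g3]]; exists (fun x => a x + b x); split.
- exact: nle_add.
- by move=> x xd; rewrite h2// g2// addr0.
- move=> z hz; apply: eq_hs (hs_add (h3 _ hz) (g3 _ hz)) => x.
  by rewrite mulrDl.
Qed.

Lemma ex_scale d t k F M : ex d t F M -> ex d t (fun z => k * F z) (cmod k * M).
Proof.
move=> [a [h1 h2 h3]]; exists (fun x => k * a x); split.
- exact: nle_scale.
- by move=> x xd; rewrite h2// mulr0.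
- by move=> z hz; apply: eq_hs (hs_mull k (h3 _ hz)) => x; rewrite mulrA.
Qed.

(** Terms carrying the same monomial are collected, which does not increase the norm. Products and
    series of functions are both obtained from this case. *)
Lemma ex_family (K : choiceType) (a : K -> C) (p : K -> X) d t F M : 0 <= t ->
  absb (fun k => a k * (weight t (p k))%:C) M ->
  (forall k, (xdeg (p k) < d)%N -> a k = 0) ->
  (forall z, pdom t z -> hs (fun k => a k * tfmono (p k) z) (F z)) ->
  ex d t F M.
Proof.
move=> t0 aM ad aF.
have hw x : (weight t x)%:C != 0 :> C.
  exact: weight_neq0.
have fib x : exists s, hs (fun k => if p k == x then a k else 0) s.
  apply: (@absb_hs _ _ _ (cmod ((weight t x)%:C^-1) * M)).
  apply: absb_le (lexx _) (absb_mull ((weight t x)%:C)^-1 aM) => k.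
  case: eqP => [<-|_]; last by rewrite cmod0 cmod_ge0.
  by rewrite mulrCA mulVf ?mulr1.
have [e he] := boolp.choice fib.
exists e; split.
- apply: (absb_group (p := p) _ aM) => x.
  rewrite mulrC; apply: eq_hs (hs_mull (weight t x)%:C (he x)) => k.
  by case: eqP => [->|_]; rewrite ?mulr0// mulrC.
- move=> x xd; apply: hs_uniq (he x) _.
  apply: hs0 => k.
  by case: eqP => // px; rewrite ad// px.
- move=> z hz; apply: (hs_group (p := p) _ (aF _ hz)) => x.
  rewrite mulrC; apply: eq_hs (hs_mull (tfmono x z) (he x)) => k.
  by case: eqP => [->|_]; rewrite ?mulr0// mulrC.
Qed.

Lemma ex_mono t x : 0 <= t -> ex (xdeg x) t (tfmono x) (weight t x).
Proof.
move=> t0; apply: (@ex_family unit (fun=> 1) (fun=> x)) => //.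
- move=> A; apply: (@le_trans _ _ (\sum_(i <- [fset tt]%fset) weight t x)).
    apply: (@le_trans _ _ (\sum_(i <- A) weight t x)).
      by apply: ler_sum => i _; rewrite mul1r cmod_real ger0_norm// weight_ge0.
    apply: ler_sum_fsub; last by move=> _; exact: weight_ge0.
    by apply/fsubsetP => -[] _; rewrite inE.
  by rewrite big_seq_fset1.
- by move=> k; rewrite ltnn.
- move=> z hz; have := @hs_fin _ _ (fun _ : unit => 1 * tfmono x z) [fset tt]%fset.
  by rewrite big_seq_fset1 mul1r; apply => -[]; rewrite inE.
Qed.

Lemma ex_cst t k : 0 <= t -> ex 0 t (fun=> k) (cmod k).
Proof.
move=> t0; have := ex_scale k (ex_mono (x0 n1 n2) t0).
rewrite xdeg0 weight0 mulr1; apply: eq_ex => z _.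
by rewrite tfmono0 mulr1.
Qed.

Lemma ex_zero d t : 0 <= t -> ex d t (fun=> 0) 0.
Proof.
move=> t0; exists (fun=> 0); split=> //.
- by move=> A; rewrite big1// => x _; rewrite mul0r cmod0.
- by move=> z _; apply: hs0 => x; rewrite mul0r.
Qed.

Lemma ex_series (I : choiceType) d t (F : I -> Z -> C) (M : I -> R) N G :
  0 <= t -> (forall i, ex d t (F i) (M i)) ->
  (forall A : {fset I}, \sum_(i <- A) M i <= N) ->
  (forall z, pdom t z -> hs (fun i => F i z) (G z)) -> ex d t G N.
Proof.
move=> t0 hF MN FG; have [a ha] := boolp.choice hF.
apply: (@ex_family (I * X)%type (fun k => a k.1 k.2) snd) => //.
- apply: (absb_pair (u := fun i x => a i x * (weight t x)%:C) (M := M)) => // i.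
  by have [] := ha i.
- by move=> [i x] /= xd; have [_ h _] := ha i; exact: h.
- move=> z hz.
  have hb i : absb (fun x => a i x * tfmono x z) (M i).
    by have [h _ _] := ha i; exact: nle_absb h hz.
  have [v hv] := absb_hs (absb_pair hb MN).
  suff -> : G z = v by [].
  apply: hs_uniq (FG _ hz) _.
  apply: (hs_group (p := fst) _ hv) => i; have [_ _ /(_ _ hz) hi] := ha i.
  apply: (@hs_image _ _ _ (pair i)) hi => [x x' []//|x/=|[i' x] /= hk].
    by rewrite eqxx.
  by case: eqP => // ii'; case: (hk x); rewrite ii'.
Qed.

Lemma ex_mul d d' t F G M N : 0 <= t -> ex d t F M -> ex d' t G N ->
  ex (d + d') t (fun z => F z * G z) (M * N).
Proof.
move=> t0 [a [h1 h2 h3]] [b [g1 g2 g3]].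
apply: (@ex_family (X * X)%type (fun k => a k.1 * b k.2) (fun k => xadd k.1 k.2)) => //.
- apply: absb_le (lexx _) (absb_mul h1 g1) => -[x y] /=.
  rewrite mulrACA !cmodM ler_wpM2l ?mulr_ge0 ?cmod_ge0//.
  by rewrite !cmod_real !ger0_norm ?weight_ge0// weight_add.
- move=> [x y] /=; rewrite xdeg_add => lt.
  case: (ltnP (xdeg x) d) => hx; first by rewrite h2// mul0r.
  rewrite g2 ?mulr0// ltnNge; apply/negP => hy.
  by move: lt; rewrite ltnNge leq_add.
- move=> z hz; have := hs_mul (nle_absb t0 h1 hz) (nle_absb t0 g1 hz) (h3 _ hz) (g3 _ hz).
  by apply: eq_hs => -[x y] /=; rewrite tfmono_add mulrACA.
Qed.

Lemma ex_sum (I : Type) (s : seq I) (P : pred I) d t (F : I -> Z -> C) (M : I -> R) :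
  0 <= t -> (forall i, P i -> ex d t (F i) (M i)) ->
  ex d t (fun z => \sum_(i <- s | P i) F i z) (\sum_(i <- s | P i) M i).
Proof.
move=> t0 h; elim: s => [|i s ih].
  rewrite big_nil; apply: eq_ex (ex_zero d t0) => z _.
  by rewrite big_nil.
rewrite big_cons; case: ifP => Pi.
  by apply: eq_ex (ex_add (h _ Pi) ih) => z _; rewrite big_cons Pi.
by apply: eq_ex ih => z _; rewrite big_cons Pi.
Qed.

Lemma ex_exp t F M n : 0 <= t -> ex 0 t F M -> ex 0 t (fun z => F z ^+ n) (M ^+ n).
Proof.
move=> t0 h; elim: n => [|n ih].
  by rewrite expr0 -(@cmod1 R); exact: ex_cst.
by rewrite exprS; apply: eq_ex (ex_mul t0 h ih) => z _; rewrite exprS.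
Qed.

Lemma ex_cfactor t c x : 0 <= t ->
  ex 0 t (fun z => cfactor c x (coord c z)) (cweight c x (rd c + t)).
Proof.
move=> t0; rewrite -weight_sel.
apply: (@ex_le _ (xdeg (xsel c x)) _ t _ (weight t (xsel c x))) => //.
by apply: eq_ex (ex_mono _ t0) => z _; rewrite tfmono_sel.
Qed.

Lemma ex_coord t c : 0 <= t -> ~~ is_angle c -> ex 0 t (coord c) (rd c + t).
Proof.
move=> t0 ca; pose x : X := mkindex (fun=> 1%N) (fun=> 0).
have := ex_cfactor c x t0.
rewrite /cweight (negbTE ca) xexp_mk (negbTE ca) expr1; apply: eq_ex => z _.
by rewrite /cfactor (negbTE ca) xexp_mk (negbTE ca) expr1.
Qed.

(** Integer frequencies make every monomial invariant under shifts of the angles by multiples of 2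
    pi. *)
Lemma ex_torus d t F M z z' : 0 <= t -> ex d t F M -> torus_eq z z' ->
  pdom t z -> pdom t z' -> F z = F z'.
Proof.
move=> t0 [a [_ _ h]] [e1 e2 e3 [k hk]] hz hz'.
apply: hs_uniq (h _ hz) _; apply: eq_hs (h _ hz') => x; congr (_ * _).
rewrite !tfmonoE; apply: eq_bigr => -[[i|i]|[i|i]] _.
- by rewrite -!coord_act e1.
- rewrite -!coord_ang hk /cfactor /= mulrDr cexpD.
  have -> : 'i * (ix_k x i)%:~R * (2 * pi * (k i)%:~R)%:C =
      'i * (2 * pi * (ix_k x i * k i)%:~R)%:C :> C.
    by rewrite intr_complex -mulrA -real_complexM mulrCA intrM.
  by rewrite cexp_periodic mulr1.
- by rewrite -!coord_cxi e2.
- by rewrite -!coord_ceta e3.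
Qed.

End Expansions.

(** * Partial derivatives and Cauchy estimates on coefficients *)

Section Derivatives.
Variables (R : realType) (n1 n2 : nat).
Local Notation C := R[i].
Local Notation Z := (phase R n1 n2).
Local Notation X := (tfindex n1 n2).
Local Notation coordinate := (coordinate n1 n2).
Variable rd : coordinate -> R.
Hypothesis rd_gt0 : forall c, 0 < rd c.
Local Notation weight := (weight rd).
Local Notation nle := (nle rd).
Local Notation ex := (ex rd).
Local Notation pdom := (pdom rd).

Definition dcfactor (c : coordinate) (x : X) (y : C) : C :=
  if is_angle c then 'i * (xfreq c x)%:~R * cexp ('i * (xfreq c x)%:~R * y)
  else (xexp c x)%:R * y ^+ (xexp c x).-1.

Definition dmono (c : coordinate) (x : X) (z : Z) : C :=
  dcfactor c x (coord c z) * \prod_(c' | c' != c) cfactor c' x (coord c' z).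

Definition xunit (c : coordinate) : X := mkindex (fun c' => (c' == c) : nat) (fun=> 0).

(* The coefficients of the partial derivative with respect to [c]. *)
Definition dco (c : coordinate) (a : X -> C) : X -> C := fun x =>
  if is_angle c then 'i * (xfreq c x)%:~R * a x
  else (xexp c x).+1%:R * a (xadd x (xunit c)).

Lemma xexp_add c (x y : X) : xexp c (xadd x y) = (xexp c x + xexp c y)%N.
Proof.
by rewrite xexp_mk; case: ifP => // a; rewrite !xexp_angle.
Qed.

Lemma xfreq_add c (x y : X) : xfreq c (xadd x y) = xfreq c x + xfreq c y.
Proof.
by rewrite xfreq_mk; case: ifP => // /negbT a; rewrite !xfreq_nangle.
Qed.

Lemma xexp_unit c c' : xexp c' (xunit c) = (~~ is_angle c) && (c' == c) :> nat.
Proof.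
rewrite xexp_mk; case: (eqVneq c' c) => [->|]; last by rewrite andbF; case: ifP.
by rewrite andbT; case: (is_angle c).
Qed.

Lemma xfreq_unit c c' : xfreq c' (xunit c) = 0.
Proof. by rewrite xfreq_mk; case: ifP. Qed.

Lemma xadd_inj y : injective (fun x : X => xadd x y).
Proof.
move=> x x' h; apply: index_ext => c.
  by have := congr1 (xexp c) h; rewrite !xexp_add => /addIn.
by have := congr1 (xfreq c) h; rewrite !xfreq_add => /addIr.
Qed.

Lemma dcoC c c' a : dco c (dco c' a) =1 dco c' (dco c a).
Proof.
move=> x; rewrite /dco; case: (boolP (is_angle c)) => hc; case: (boolP (is_angle c')) => hc'.
- by rewrite [LHS]mulrCA.
- by rewrite xfreq_add xfreq_unit addr0 [LHS]mulrCA.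
- by rewrite xfreq_add xfreq_unit addr0 [LHS]mulrCA.
- have -> : xadd (xadd x (xunit c)) (xunit c') = xadd (xadd x (xunit c')) (xunit c).
    apply: index_ext => c0; rewrite ?xexp_add ?xfreq_add.
      by rewrite addnAC.
    by rewrite addrAC.
  rewrite !xexp_add !xexp_unit hc hc' /= (eq_sym c').
  case: (eqVneq c c') => [->|_] //=.
  by rewrite !addn0 [LHS]mulrCA.
Qed.

Lemma dmono_angle c (x : X) (z : Z) : is_angle c -> dmono c x z = 'i * (xfreq c x)%:~R * tfmono x z.
Proof.
move=> hc; rewrite tfmonoE (bigD1 c)//= /dmono /dcfactor hc -[LHS]mulrA.
by rewrite {2}/cfactor hc.
Qed.

Lemma dmono_shift c (x : X) (z : Z) : ~~ is_angle c ->
  dmono c (xadd x (xunit c)) z = (xexp c x).+1%:R * tfmono x z.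
Proof.
move=> hc; rewrite tfmonoE (bigD1 c)//= /dmono /dcfactor (negbTE hc).
rewrite !xexp_add !xexp_unit hc eqxx addn1 -!mulrA; congr (_ * _).
rewrite {2}/cfactor (negbTE hc); congr (_ * _); apply: eq_bigr => c' h.
by rewrite /cfactor xexp_add xexp_unit (negbTE h) andbF addn0 xfreq_add xfreq_unit addr0.
Qed.

Lemma dmono_const c (x : X) (z : Z) : ~~ is_angle c -> xexp c x = 0%N -> dmono c x z = 0.
Proof. by move=> hc h; rewrite /dmono /dcfactor (negbTE hc) h mul0r mul0r. Qed.

Lemma xunit_split c (x : X) : ~~ is_angle c -> (0 < xexp c x)%N ->
  exists y, xadd y (xunit c) = x.
Proof.
move=> hc h; exists (mkindex (fun c' => (xexp c' x - (c' == c))%N) (fun c' => xfreq c' x)).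
apply: index_ext => c'.
  rewrite xexp_add xexp_mk xexp_unit hc /=; case: (boolP (is_angle c')) => a.
    rewrite [RHS]xexp_angle//; case: eqP => // e; by rewrite e (negbTE hc) in a.
  by case: eqP => [->|_]; rewrite ?subn0 ?addn0// subn1 addn1 prednK.
rewrite xfreq_add xfreq_unit addr0 xfreq_mk.
by case: ifP => // /negbT a; rewrite xfreq_nangle.
Qed.

(** One term of the binomial expansion is at most the whole. The induction also carries the term
    r^(n+1). *)
Let pow_ineq (r s : R) n : 0 <= r -> 0 <= s ->
  s * n.+1%:R * r ^+ n <= (r + s) ^+ n.+1.
Proof.
move=> r0 s0.
suff : r ^+ n.+1 + s * n.+1%:R * r ^+ n <= (r + s) ^+ n.+1.
  by apply: le_trans; rewrite lerDr exprn_ge0.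
elim: n => [|n ih]; first by rewrite !expr1 expr0; lra.
rewrite [leRHS]exprS; apply: le_trans (ler_wpM2l (addr_ge0 r0 s0) ih).
rewrite -(natr1 n.+1) -subr_ge0 [r ^+ n.+2]exprS [r ^+ n.+1]exprS.
have -> : (r + s) * (r * r ^+ n + s * n.+1%:R * r ^+ n) -
   (r * (r * r ^+ n) + s * (n.+1%:R + 1) * (r * r ^+ n)) =
   s * s * n.+1%:R * r ^+ n by ring.
by rewrite !mulr_ge0// exprn_ge0.
Qed.

(** The frequency brought down by the derivative is absorbed by [s |k| <= exp (s |k|)]. *)
Let weight_dco_angle c t s x : is_angle c -> 0 <= t -> 0 < s ->
  s * (`|xfreq c x|%N%:R * weight t x) <= weight (t + s) x.
Proof.
move=> hc t0 s0.
rewrite /weight (bigD1 c)//= [leRHS](bigD1 c)//= !mulrA ler_pM//.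
- by rewrite !mulr_ge0// ltW// ?cweight_gt0 ?rdD_gt0.
- by apply: prodr_ge0 => c' _; rewrite ltW// cweight_gt0// rdD_gt0.
- rewrite /cweight hc addrA [in leRHS]mulrDr [leRHS]expRD mulrC.
  rewrite ler_wpM2l ?expR_ge0//.
  by rewrite mulrC (le_trans _ (expR_ge1Dx _))// lerDr.
- apply: ler_prod => c' _; rewrite ltW ?cweight_gt0 ?rdD_gt0//=.
  by rewrite cweight_le ?addrA ?lerDl// ltW// rdD_gt0.
Qed.

Let weight_dco_nangle c t s (x : X) : ~~ is_angle c -> 0 <= t -> 0 < s ->
  s * ((xexp c x).+1%:R * weight t x) <= weight (t + s) (xadd x (xunit c)).
Proof.
move=> hc t0 s0.
rewrite /weight (bigD1 c)//= [leRHS](bigD1 c)//= !mulrA ler_pM//.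
- by rewrite !mulr_ge0// ltW// ?cweight_gt0 ?rdD_gt0.
- by apply: prodr_ge0 => c' _; rewrite ltW// cweight_gt0// rdD_gt0.
- rewrite /cweight (negbTE hc) xexp_add xexp_unit hc eqxx addn1 addrA.
  by rewrite pow_ineq// ltW// rdD_gt0.
- apply: ler_prod => c' hc'; rewrite ltW ?cweight_gt0 ?rdD_gt0//=.
  have -> : cweight c' (xadd x (xunit c)) = cweight c' x :> (R -> R).
    apply/funext => r; rewrite /cweight xexp_add xexp_unit (negbTE hc') andbF.
    by rewrite addn0 xfreq_add xfreq_unit addr0.
  by rewrite cweight_le ?addrA ?lerDl// ltW// rdD_gt0.
Qed.

(** Cauchy estimate, coefficient by coefficient: a loss [s] of all radii costs a factor 1/s. When
    [c] is not an angle the coefficients are moved along an injection of the indices. *)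
Lemma nle_dco c t s a M : 0 <= t -> 0 < s -> nle (t + s) a M ->
  nle t (dco c a) (M / s).
Proof.
move=> t0 s0 h; have ts0 : 0 <= t + s by rewrite addr_ge0// ltW.
have h' : absb (fun x => (s^-1)%:C * (a x * (weight (t + s) x)%:C)) (M / s).
  have := absb_mull (s^-1)%:C h.
  by rewrite cmod_real gtr0_norm ?invr_gt0// mulrC.
have e2 x : cmod ((s^-1)%:C * (a x * (weight (t + s) x)%:C)) =
    cmod (a x) * (s^-1 * weight (t + s) x).
  rewrite 2!cmodM !cmod_real gtr0_norm ?invr_gt0// ger0_norm ?weight_ge0//.
  by rewrite mulrCA.
rewrite /dco /nle; case: (boolP (is_angle c)) => hc.
  apply: absb_le (lexx _) h' => x; rewrite e2.
  rewrite 3!cmodM cmod_i cmod_int cmod_real ger0_norm ?weight_ge0// mul1r.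
  rewrite mulrAC mulrC ler_wpM2l ?cmod_ge0// ler_pdivlMl//.
  exact: weight_dco_angle.
apply: absb_le (lexx _) (absb_comp (@xadd_inj (xunit c)) h') => x; rewrite e2.
rewrite 2!cmodM cmod_nat cmod_real ger0_norm ?weight_ge0//.
rewrite mulrAC mulrC ler_wpM2l ?cmod_ge0// ler_pdivlMl//.
exact: weight_dco_nangle.
Qed.

(** Termwise differentiation. When [c] is not an angle, the reindexing misses exactly the monomials
    free of [c], whose derivative is zero. *)
Lemma hs_dmono c t s a M z : 0 <= t -> 0 < s -> nle (t + s) a M -> pdom t z ->
  hs (fun x => a x * dmono c x z) (tfeval (dco c a) z).
Proof.
move=> t0 s0 h hz.
have hd := nle_hs rd_gt0 t0 (nle_dco c t0 s0 h) hz.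
case: (boolP (is_angle c)) => hc.
  by apply: eq_hs hd => x; rewrite /dco hc dmono_angle// [RHS]mulrCA -[LHS]mulrA.
apply: (@hs_image _ _ _ _ (@xadd_inj (xunit c))) hd => x.
  by rewrite dmono_shift// /dco (negbTE hc) [LHS]mulrCA -[RHS]mulrA.
move=> h'; rewrite dmono_const ?mulr0//; apply/eqP; rewrite -leqn0 leqNgt.
by apply/negP => /(xunit_split hc)[y]; exact: h'.
Qed.

Lemma xdeg_unit c : ~~ is_angle c -> xdeg (xunit c) = cdeg c.
Proof.
move=> hc; rewrite xdegE (bigD1 c)//= big1 ?addn0.
  by rewrite xexp_unit hc eqxx muln1.
by move=> c' h'; rewrite xexp_unit (negbTE h') andbF muln0.
Qed.

Lemma dco_deg c d a : (forall x, (xdeg x < d)%N -> a x = 0) ->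
  forall x, (xdeg x < d - (if is_angle c then 0 else cdeg c))%N -> dco c a x = 0.
Proof.
move=> h x; rewrite /dco; case: (boolP (is_angle c)) => hc xd.
  by rewrite h ?mulr0// (leq_trans xd)// leq_subr.
rewrite h ?mulr0// xdeg_add xdeg_unit//.
by move: xd; lia.
Qed.

End Derivatives.

(** * Composition with near-identity maps *)

Section Jets.
Variables (R : realType) (n1 n2 : nat).
Local Notation C := R[i].
Local Notation Z := (phase R n1 n2).
Local Notation X := (tfindex n1 n2).
Local Notation coordinate := (coordinate n1 n2).
Variable rd : coordinate -> R.
Hypothesis rd_gt0 : forall c, 0 < rd c.
Local Notation weight := (weight rd).
Local Notation nle := (nle rd).
Local Notation ex := (ex rd).
Local Notation pdom := (pdom rd).

Lemma ex_exp_term t k (F : Z -> C) M n : 0 <= t -> ex 0 t F M ->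
  ex 0 t (fun z => (k * F z) ^+ n / n`!%:R) ((cmod k * M) ^+ n / n`!%:R).
Proof.
move=> t0 h; have := ex_scale (n`!%:R^-1) (ex_exp rd_gt0 n t0 (ex_scale k h)).
rewrite cmodV cmod_nat mulrC; apply: eq_ex => z _.
by rewrite mulrC.
Qed.

Lemma ex_cexp t k (F : Z -> C) M : 0 <= t -> ex 0 t F M ->
  ex 0 t (fun z => cexp (k * F z)) (expR (cmod k * M)).
Proof.
move=> t0 h; have M0 := ex_ge0 h.
apply: (@ex_series _ _ _ _ rd_gt0 nat 0 t (fun n z => (k * F z) ^+ n / n`!%:R)
  (fun n => (cmod k * M) ^+ n / n`!%:R)) => //.
- by move=> n; exact: ex_exp_term.
- move=> A; have kM : 0 <= cmod k * M by rewrite mulr_ge0 ?cmod_ge0.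
  apply: le_trans (absb_expR kM A); apply: ler_sum => n _.
  by rewrite cmod_real ler_norm.
- by move=> z _; exact: hs_cexp.
Qed.

(* [A] depends on a small parameter [lam]: its value at 0 is [A0], its first
   order part is [A1], and the rest is quadratic; the total norm is at most
   [M] when [lam] is 1. *)
Definition jet (t lam : R) (A0 A1 A : Z -> C) (M : R) : Prop :=
  exists M0 M1 M2 : R, [/\ 0 <= M1, 0 <= M2, M0 + M1 + M2 <= M,
    ex 0 t A0 M0 & ex 0 t A1 (lam * M1) /\
    ex 0 t (fun z => A z - A0 z - A1 z) (lam ^+ 2 * M2)].

Lemma eq_jet t lam A0 A1 A B0 B1 B M :
  (forall z, pdom t z -> A0 z = B0 z) -> (forall z, pdom t z -> A1 z = B1 z) ->
  (forall z, pdom t z -> A z = B z) ->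
  jet t lam A0 A1 A M -> jet t lam B0 B1 B M.
Proof.
move=> e0 e1 e [M0 [M1 [M2 [h1 h2 h3 h4 [h5 h6]]]]].
exists M0, M1, M2; split=> //; first exact: eq_ex h4.
split; first exact: eq_ex h5.
by apply: eq_ex h6 => z hz; rewrite e0// e1// e.
Qed.

Lemma jet_const t lam A M : 0 <= t -> 0 <= lam -> ex 0 t A M ->
  jet t lam A (fun=> 0) A M.
Proof.
move=> t0 l0 h; exists M, 0, 0; split=> //; first by rewrite !addr0.
rewrite !mulr0; split; first exact: ex_zero.
by apply: eq_ex (ex_zero rd 0 t0) => z _; rewrite subr0 subrr.
Qed.

(** The majorant M0 + M1 + M2 multiplies, and products with more than two factors [lam] go into the
    quadratic part because [lam <= 1]. *)
Lemma jet_mul t lam A0 A1 A B0 B1 B M N : 0 <= t -> 0 <= lam <= 1 ->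
  jet t lam A0 A1 A M -> jet t lam B0 B1 B N ->
  jet t lam (fun z => A0 z * B0 z) (fun z => A0 z * B1 z + A1 z * B0 z)
    (fun z => A z * B z) (M * N).
Proof.
move=> t0 /andP[l0 l1] [M0 [M1 [M2 [hM1 hM2 hM hA0 [hA1 hA2]]]]].
move=> [N0 [N1 [N2 [hN1 hN2 hN hB0 [hB1 hB2]]]]].
have M00 := ex_ge0 hA0; have N00 := ex_ge0 hB0.
exists (M0 * N0), (M0 * N1 + M1 * N0),
  (M0 * N2 + M1 * N1 + M2 * N0 + M1 * N2 + M2 * N1 + M2 * N2); split.
- by rewrite addr_ge0// mulr_ge0.
- by rewrite !addr_ge0// mulr_ge0.
- apply: le_trans (ler_pM _ _ hM hN); rewrite ?addr_ge0//.
  by rewrite le_eqVlt; apply/orP; left; apply/eqP; ring.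
- exact: ex_mul hA0 hB0.
split.
  rewrite mulrDr mulrCA (mulrA lam M1).
  exact: ex_add (ex_mul rd_gt0 t0 hA0 hB1) (ex_mul rd_gt0 t0 hA1 hB0).
have l2 : lam ^+ 2 = lam * lam by rewrite expr2.
have lll x : 0 <= x -> lam * x <= x by move=> x0; rewrite ler_piMl.
have h02 := ex_mul rd_gt0 t0 hA0 hB2; have h11 := ex_mul rd_gt0 t0 hA1 hB1.
have h20 := ex_mul rd_gt0 t0 hA2 hB0; have h12 := ex_mul rd_gt0 t0 hA1 hB2.
have h21 := ex_mul rd_gt0 t0 hA2 hB1; have h22 := ex_mul rd_gt0 t0 hA2 hB2.
have := ex_add (ex_add (ex_add (ex_add (ex_add h02 h11) h20) h12) h21) h22.
move=> h; apply: (ex_leM rd_gt0 t0 _ (eq_ex _ h)); last by move=> z _; ring.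
rewrite l2 !mulrDr !lerD//.
- by rewrite mulrCA.
- by rewrite mulrACA.
- by rewrite mulrA.
- rewrite (_ : lam * M1 * _ = lam * (lam * lam * (M1 * N2))); last by ring.
  by rewrite lll// !mulr_ge0.
- rewrite (_ : lam * lam * M2 * _ = lam * (lam * lam * (M2 * N1))); last by ring.
  by rewrite lll// !mulr_ge0.
- rewrite (_ : lam * lam * M2 * _ = lam * (lam * (lam * lam * (M2 * N2)))); last by ring.
  by rewrite (le_trans (lll _ _))// ?lll// !mulr_ge0.
Qed.

Lemma jet_exp t lam A0 A1 A M n : 0 <= t -> 0 <= lam <= 1 ->
  jet t lam A0 A1 A M ->
  jet t lam (fun z => A0 z ^+ n) (fun z => n%:R * A0 z ^+ n.-1 * A1 z)
    (fun z => A z ^+ n) (M ^+ n).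
Proof.
move=> t0 l01 h; have l0 : 0 <= lam by case/andP: l01.
elim: n => [|n ih].
  rewrite expr0 -[X in jet _ _ _ _ _ X](@cmod1 R).
  apply: eq_jet (jet_const t0 l0 (ex_cst rd_gt0 1 t0)) => [z _|z _|z _].
  - by rewrite expr0.
  - by rewrite mul0r mul0r.
  - by rewrite expr0.
rewrite exprS; apply: eq_jet (jet_mul t0 l01 h ih) => z _ /=.
- by rewrite exprS.
- by case: n {ih} => [|n]; rewrite -?[n.+2%:R]natr1 /= ?expr0 ?exprS; ring.
- by rewrite exprS.
Qed.

Lemma jet_prod (I : eqType) (s : seq I) t lam (A0 A1 A : I -> Z -> C) (M : I -> R) :
  0 <= t -> 0 <= lam <= 1 -> uniq s ->
  (forall i, jet t lam (A0 i) (A1 i) (A i) (M i)) ->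
  jet t lam (fun z => \prod_(i <- s) A0 i z)
    (fun z => \sum_(i <- s) A1 i z * \prod_(j <- s | j != i) A0 j z)
    (fun z => \prod_(i <- s) A i z) (\prod_(i <- s) M i).
Proof.
move=> t0 l01 us h; have l0 : 0 <= lam by case/andP: l01.
elim: s us => [_|i s ih /andP[nis us]].
  rewrite big_nil -[X in jet _ _ _ _ _ X](@cmod1 R).
  apply: eq_jet (jet_const t0 l0 (ex_cst rd_gt0 1 t0)) => [z _|z _|z _].
  - by rewrite big_nil.
  - by rewrite big_nil.
  - by rewrite big_nil.
rewrite big_cons; apply: eq_jet (jet_mul t0 l01 (h i) (ih us)) => z _.
- by rewrite big_cons.
- rewrite big_cons [in RHS]big_cons eqxx /= addrC; congr (_ * _ + _).
    rewrite big_seq [RHS]big_seq_cond /=; rewrite -big_seq big_seq_cond.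
    rewrite [LHS]big_seq_cond [RHS]big_seq_cond.
    apply: eq_bigl => j; case: (boolP (j \in s)) => //= js.
    by case: eqP => // ji; rewrite -ji js in nis.
  rewrite [in LHS]mulr_sumr [LHS]big_seq [RHS]big_seq; apply: eq_bigr => j js.
  rewrite big_cons; case: eqP => [ij|_]; first by rewrite ij js in nis.
  by rewrite mulrCA.
- by rewrite big_cons.
Qed.

(** The first two terms of the exponential series are the jet; in the others [lam ^+ n <= lam ^+ 2],
    so the tail of the real exponential bounds the rest. *)
Lemma jet_cexp t lam k (F : Z -> C) s : 0 <= t -> 0 <= lam <= 1 -> 0 <= s ->
  ex 0 t F (lam * s) ->
  jet t lam (fun=> 1) (fun z => k * F z) (fun z => cexp (k * F z))
    (expR (cmod k * s)).
Proof.
move=> t0 /andP[l0 l1] s0 h; have ks0 : 0 <= cmod k * s by rewrite mulr_ge0 ?cmod_ge0.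
pose u n : R := (cmod k * s) ^+ n / n`!%:R.
have u0 n : 0 <= u n by rewrite divr_ge0 ?exprn_ge0.
have uM (A : {fset nat}) : \sum_(n <- A) u n <= expR (cmod k * s).
  apply: le_trans (absb_expR ks0 A); apply: ler_sum => n _.
  by rewrite cmod_real ler_norm.
have u2M (A : {fset nat}) :
    \sum_(n <- A) (if (n < 2)%N then 0 else u n) <= expR (cmod k * s) - 1 - cmod k * s.
  pose B := [fset i in iota 0 2]%fset.
  have inB i : (i \in B) = (i < 2)%N by exact: in_fset_iota.
  have sumB : \sum_(n <- B) u n = 1 + cmod k * s.
    rewrite big_fset_iota big_mkord !big_ord_recl big_ord0 /u expr0 expr1.
    by rewrite !fact0 !divr1 addr0.
  move: B inB sumB => B inB sumB.
  have := uM (B `|` A)%fset.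
  rewrite (big_fsetID _ [pred n | (n < 2)%N]) /=.
  have -> : [fset x in B `|` A | (x < 2)%N]%fset = B.
    by apply/fsetP => n; rewrite !inE inB /=; case: (n < 2)%N; rewrite ?andbF.
  have : \sum_(n <- A) (if (n < 2)%N then 0 else u n) <=
     \sum_(i <- [fset x in B `|` A | ~~ (x < 2)%N]%fset) u i.
    rewrite (big_fsetID _ [pred n | (n < 2)%N]) /= big1_fset ?add0r; last first.
      by move=> i; rewrite !inE /= => /andP[_ ->].
    rewrite [leLHS](_ : _ =
        \sum_(i <- [fset x in A | ~~ (x < 2)%N]%fset) u i); last first.
      rewrite big_seq [RHS]big_seq; apply: eq_bigr => i.
      by rewrite !inE /= => /andP[_ /negbTE ->].
    apply: ler_sum_fsub => //; apply/fsubsetP => i; rewrite !inE /= => /andP[iA ->].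
    by rewrite iA orbT.
  rewrite sumB.
  by lra.
exists 1, (cmod k * s), (expR (cmod k * s) - 1 - cmod k * s); split=> //.
- by have := u2M fset0; rewrite big_seq_fset0.
- by lra.
- by have := ex_cst rd_gt0 1 t0; rewrite cmod1.
split; first by rewrite mulrCA; exact: ex_scale.
apply: (@ex_series _ _ _ _ rd_gt0 nat 0 t
  (fun n z => if (n < 2)%N then 0 else (k * F z) ^+ n / n`!%:R)
  (fun n => lam ^+ 2 * (if (n < 2)%N then 0 else u n))) => //.
- move=> n; case: (ltnP n 2) => n2'; first by rewrite mulr0; exact: ex_zero.
  apply: (ex_leM rd_gt0 t0 _ (ex_exp_term k n t0 h)).
  have -> : (cmod k * (lam * s)) ^+ n = lam ^+ n * (cmod k * s) ^+ n.
    by rewrite mulrCA exprMn.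
  by rewrite -mulrA ler_wpM2r ?u0// ler_wiXn2l.
- by move=> A; rewrite -mulr_sumr ler_wpM2l// exprn_ge0.
- move=> z _; have h1 := hs_cexp (k * F z).
  have h2 := @hs_fin _ _ (fun n => if (n < 2)%N then (k * F z) ^+ n / n`!%:R else 0)
    [fset i in iota 0 2]%fset.
  rewrite big_fset_iota big_mkord !big_ord_recl big_ord0 /= expr0 expr1 !divr1 addr0 in h2.
  have h3 n : n \notin [fset i in iota 0 2]%fset ->
      (if (n < 2)%N then (k * F z) ^+ n / n`!%:R else 0) = 0.
    by rewrite in_fset_iota => /negbTE ->.
  rewrite -addrA -opprD; apply: eq_hs (hs_add h1 (hs_opp (h2 h3))) => n.
  by case: ifP => _; rewrite ?subrr ?subr0.
Qed.

End Jets.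

(** * Taylor formulas for composition with a near-identity map *)

Section Composition.
Variables (R : realType) (n1 n2 : nat).
Local Notation C := R[i].
Local Notation Z := (phase R n1 n2).
Local Notation X := (tfindex n1 n2).
Local Notation coordinate := (coordinate n1 n2).
Variable rd : coordinate -> R.
Hypothesis rd_gt0 : forall c, 0 < rd c.
Local Notation weight := (weight rd).
Local Notation nle := (nle rd).
Local Notation ex := (ex rd).
Local Notation pdom := (pdom rd).
Local Notation jet := (jet rd).

(** Displacements, not maps, are measured: the angles themselves are not Taylor-Fourier series, but
    their displacements are. *)
Definition exv (t : R) (v : Z -> Z) (b : R) : Prop :=
  forall c, ex 0 t (fun z => coord c (v z)) b.

Lemma jet_factor t b s lam (v w : Z -> Z) c x : 0 <= t -> 0 <= b -> 0 <= s ->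
  0 <= lam <= 1 -> exv t v b -> exv t w (lam * s) ->
  jet t lam (fun z => cfactor c x (coord c (z + v z)))
    (fun z => dcfactor c x (coord c (z + v z)) * coord c (w z))
    (fun z => cfactor c x (coord c (z + v z + w z)))
    (cweight c x (rd c + (t + b + s))).
Proof.
move=> t0 b0 s0 l01 hv hw; have l0 : 0 <= lam by case/andP: l01.
rewrite /cfactor /dcfactor /cweight; case: (boolP (is_angle c)) => hc.
  set k := 'i * (xfreq c x)%:~R.
  have ck : cmod k = `|xfreq c x|%N%:R by rewrite cmodM cmod_i mul1r cmod_int.
  have j1 := jet_const t0 l0 (ex_cfactor rd_gt0 c x t0).
  have j2 := jet_const t0 l0 (ex_cexp rd_gt0 k t0 (hv c)).
  have j3 := jet_cexp rd_gt0 k t0 l01 s0 (hw c).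
  have := jet_mul rd_gt0 t0 l01 (jet_mul rd_gt0 t0 l01 j1 j2) j3.
  rewrite /cweight hc -ck -!expRD -!mulrDr !addrA; apply: eq_jet => z _ /=.
  - by rewrite /cfactor hc -/k mulr1 coordD mulrDr cexpD.
  - by rewrite /cfactor hc -/k coordD mulrDr cexpD; ring.
  - by rewrite /cfactor hc -/k !coordD !mulrDr !cexpD.
have j : jet t lam (fun z => coord c (z + v z)) (fun z => coord c (w z))
   (fun z => coord c (z + v z + w z)) (rd c + (t + b + s)).
  exists (rd c + t + b), s, 0; split=> //; first by rewrite addr0 !addrA.
    apply: eq_ex (ex_add (ex_coord rd_gt0 t0 hc) (hv c)) => z _.
    by rewrite coordD.
  split; first exact: hw.
  rewrite mulr0; apply: eq_ex (ex_zero rd 0 t0) => z _.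
  by rewrite !coordD; ring.
exact: jet_exp.
Qed.

Lemma jet_mono t b s lam (v w : Z -> Z) x : 0 <= t -> 0 <= b -> 0 <= s ->
  0 <= lam <= 1 -> exv t v b -> exv t w (lam * s) ->
  jet t lam (fun z => tfmono x (z + v z))
    (fun z => \sum_c dmono c x (z + v z) * coord c (w z))
    (fun z => tfmono x (z + v z + w z)) (weight (t + b + s) x).
Proof.
move=> t0 b0 s0 l01 hv hw.
have := jet_prod rd_gt0 t0 l01 (index_enum_uniq _)
  (fun c => jet_factor c x t0 b0 s0 l01 hv hw).
apply: eq_jet => z _; rewrite ?tfmonoE//.
apply: eq_bigr => c _; rewrite /dmono mulrAC.
by [].
Qed.

(** The jets of the monomials are summed against the coefficients. Their majorants are the weights
    at [t + b + s], so the norm of [a] there bounds the three parts together and no further constant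
    appears. *)
Lemma jet_comp t b s lam (v w : Z -> Z) a M : 0 <= t -> 0 <= b -> 0 < s ->
  0 <= lam <= 1 -> exv t v b -> exv t w (lam * s) -> nle (t + b + s) a M ->
  jet t lam (fun z => tfeval a (z + v z))
    (fun z => \sum_c tfeval (dco c a) (z + v z) * coord c (w z))
    (fun z => tfeval a (z + v z + w z)) M.
Proof.
move=> t0 b0 s0 l01 hv hw aM; have s0' := ltW s0.
have [l0 l1] : 0 <= lam /\ lam <= 1 by case/andP: l01.
have tb0 : 0 <= t + b by rewrite addr_ge0.
have tbs0 : 0 <= t + b + s by rewrite addr_ge0.
have hvd z : pdom t z -> pdom (t + b) (z + v z).
  by move=> hz; apply: pdomD => // c; exact: (ex_cmod_le rd_gt0 t0 (hv c) hz).
have hwd z : pdom t z -> pdom (t + b + s) (z + v z + w z).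
  move=> hz; apply: pdomD (hvd _ hz) => c.
  apply: ex_cmod_le (ex_leM rd_gt0 t0 _ (hw c)) hz => //.
  by rewrite ler_piMl.
have [m0 /boolp.choice[m1 /boolp.choice[m2 hm]]] :=
  boolp.choice (fun x => jet_mono x t0 b0 s0' l01 hv hw).
have m0_ge0 x : 0 <= m0 x by have [_ _ _ /ex_ge0] := hm x.
have m1_ge0 x : 0 <= m1 x by have [] := hm x.
have m2_ge0 x : 0 <= m2 x by have [] := hm x.
have m_le x : m0 x + m1 x + m2 x <= weight (t + b + s) x by have [] := hm x.
have tot (A : {fset X}) : \sum_(x <- A) cmod (a x) * m0 x +
    \sum_(x <- A) cmod (a x) * m1 x + \sum_(x <- A) cmod (a x) * m2 x <= M.
  rewrite -!big_split /=; apply: le_trans (aM A); apply: ler_sum => x _.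
  rewrite -!mulrDr cmodM ler_wpM2l ?cmod_ge0// cmod_real ger0_norm//.
  exact: weight_ge0.
have nn (m : X -> R) (A : {fset X}) : (forall x, 0 <= m x) ->
    0 <= \sum_(x <- A) cmod (a x) * m x.
  by move=> h; rewrite sumr_ge0// => x _; rewrite mulr_ge0 ?cmod_ge0.
have [|A|N0 [hN0 sN0]] := @nneg_sum _ _ (fun x => cmod (a x) * m0 x) M.
- by move=> x; rewrite mulr_ge0 ?cmod_ge0.
- by have := tot A; have := nn _ A m1_ge0; have := nn _ A m2_ge0; lra.
have [|A|N1 [hN1 sN1]] := @nneg_sum _ _ (fun x => cmod (a x) * m1 x) M.
- by move=> x; rewrite mulr_ge0 ?cmod_ge0.
- by have := tot A; have := nn _ A m0_ge0; have := nn _ A m2_ge0; lra.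
have [|A|N2 [hN2 sN2]] := @nneg_sum _ _ (fun x => cmod (a x) * m2 x) M.
- by move=> x; rewrite mulr_ge0 ?cmod_ge0.
- by have := tot A; have := nn _ A m0_ge0; have := nn _ A m1_ge0; lra.
have aMb : nle (t + b) a M by apply: nle_le aM; rewrite ?lerDl.
have hs0' z : pdom t z -> hs (fun x => a x * tfmono x (z + v z)) (tfeval a (z + v z)).
  by move=> hz; apply: nle_hs aMb (hvd _ hz).
have hs1' z : pdom t z -> hs (fun x => a x * \sum_c dmono c x (z + v z) * coord c (w z))
    (\sum_c tfeval (dco c a) (z + v z) * coord c (w z)).
  move=> hz.
  apply: (@eq_hs _ _ (fun x => \sum_c coord c (w z) * (a x * dmono c x (z + v z)))).
    by move=> x; rewrite mulr_sumr; apply: eq_bigr => c _; rewrite mulrCA (mulrC (coord _ _)).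
  apply: hs_bigsum => c _; rewrite mulrC; apply: hs_mull.
  exact: (hs_dmono rd_gt0 c tb0 s0 aM (hvd _ hz)).
have hs2' z : pdom t z -> hs (fun x => a x * tfmono x (z + v z + w z))
    (tfeval a (z + v z + w z)).
  by move=> hz; apply: nle_hs aM (hwd _ hz).
exists N0, N1, N2; split.
- by have := hN1 fset0; rewrite big_seq_fset0.
- by have := hN2 fset0; rewrite big_seq_fset0.
- have h012 : hs (fun x => (cmod (a x) * m0 x + cmod (a x) * m1 x +
      cmod (a x) * m2 x)%:C) (N0 + N1 + N2)%:C.
    rewrite !real_complexD; apply: eq_hs (hs_add (hs_add sN0 sN1) sN2) => x.
    by rewrite !real_complexD.
  have : cmod (N0 + N1 + N2)%:C <= M.
    apply: absb_hs_le h012 => A; apply: le_trans (tot A).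
    rewrite -!big_split; apply: ler_sum => x _.
    by rewrite cmod_real ger0_norm// !addr_ge0// mulr_ge0 ?cmod_ge0.
  by rewrite cmod_real; apply: le_trans; rewrite ler_norm.
- apply: (@ex_series _ _ _ _ rd_gt0 X 0 t (fun x z => a x * tfmono x (z + v z))
    (fun x => cmod (a x) * m0 x)) => // x.
  by apply: ex_scale; have [] := hm x.
split.
- apply: (@ex_series _ _ _ _ rd_gt0 X 0 t
    (fun x z => a x * \sum_c dmono c x (z + v z) * coord c (w z))
    (fun x => lam * (cmod (a x) * m1 x))) => //.
    by move=> x; rewrite mulrCA; apply: ex_scale; have [_ _ _ _ []] := hm x.
  by move=> A; rewrite -mulr_sumr ler_wpM2l.
- apply: (@ex_series _ _ _ _ rd_gt0 X 0 t
    (fun x z => a x * (tfmono x (z + v z + w z) - tfmono x (z + v z) -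
       \sum_c dmono c x (z + v z) * coord c (w z)))
    (fun x => lam ^+ 2 * (cmod (a x) * m2 x))) => //.
  + by move=> x; rewrite mulrCA; apply: ex_scale; have [_ _ _ _ []] := hm x.
  + by move=> A; rewrite -mulr_sumr ler_wpM2l// exprn_ge0.
  + move=> z hz; have := hs_add (hs_add (hs2' _ hz) (hs_opp (hs0' _ hz))) (hs_opp (hs1' _ hz)).
    by apply: eq_hs => x; rewrite !mulrBr.
Qed.

Lemma exv_zero t : 0 <= t -> exv t (fun=> 0) 0.
Proof. by move=> t0 c; apply: eq_ex (ex_zero rd 0 t0) => z _; rewrite coord0. Qed.

Lemma exv_le t t' v b b' : 0 <= t -> t <= t' -> b <= b' -> exv t' v b -> exv t v b'.
Proof. by move=> t0 tt' bb' h c; exact: (ex_le rd_gt0 (leqnn 0) t0 tt' bb' (h c)). Qed.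

Lemma exv_add t v w b b' : exv t v b -> exv t w b' ->
  exv t (fun z => v z + w z) (b + b').
Proof.
by move=> h h' c; apply: eq_ex (ex_add (h c) (h' c)) => z _; rewrite coordD.
Qed.

Lemma eq_exv t v w b : (forall z, pdom t z -> v z = w z) -> exv t v b -> exv t w b.
Proof. by move=> vw h c; apply: eq_ex (h c) => z hz; rewrite vw. Qed.

Lemma exv_ge0 t v b : exv t v b -> coordinate -> 0 <= b.
Proof. by move=> h c; exact: ex_ge0 (h c). Qed.

Lemma exv_cmod_le t v b z c : 0 <= t -> exv t v b -> pdom t z -> cmod (coord c (v z)) <= b.
Proof. by move=> t0 h hz; exact: (ex_cmod_le rd_gt0 t0 (h c) hz). Qed.

Lemma exv_pdom t v b z : 0 <= t -> exv t v b -> pdom t z -> pdom (t + b) (z + v z).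
Proof. by move=> t0 h hz; apply: pdomD => // c; exact: exv_cmod_le hz. Qed.

(** Jets with zero second displacement: the norm of a displaced monomial is at most its weight at
    the enlarged radii. *)
Lemma ex_comp t b v a M : 0 <= t -> 0 <= b -> exv t v b -> nle (t + b) a M ->
  ex 0 t (fun z => tfeval a (z + v z)) M.
Proof.
move=> t0 b0 hv aM.
have z01 : 0 <= (0 : R) <= 1 by rewrite lexx ler01.
have hw : exv t (fun=> 0) (0 * 0) by rewrite mul0r; exact: exv_zero.
have hm x : ex 0 t (fun z => tfmono x (z + v z)) (weight (t + b) x).
  have [M0 [M1 [M2 [h1 h2 h3 h4 _]]]] := jet_mono x t0 b0 (lexx 0) z01 hv hw.
  apply: (ex_leM rd_gt0 t0 _ h4); rewrite -[t + b]addr0 (le_trans _ h3)//.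
  by rewrite -addrA lerDl addr_ge0.
apply: (@ex_series _ _ _ _ rd_gt0 X 0 t (fun x z => a x * tfmono x (z + v z))
    (fun x => cmod (a x) * weight (t + b) x)) => //.
- by move=> x; exact: ex_scale.
- move=> A; apply: le_trans (aM A); apply: ler_sum => x _.
  by rewrite cmodM cmod_real ler_wpM2l ?cmod_ge0// ler_norm.
- by move=> z hz; apply: nle_hs aM (exv_pdom t0 hv hz) => //; rewrite addr_ge0.
Qed.

Lemma ex_comp_diff t b s lam v w a M : 0 <= t -> 0 <= b -> 0 < s ->
  0 <= lam <= 1 -> exv t v b -> exv t w (lam * s) -> nle (t + b + s) a M ->
  ex 0 t (fun z => tfeval a (z + v z + w z) - tfeval a (z + v z)) (lam * M).
Proof.
move=> t0 b0 s0 l01 hv hw aM.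
have [M0 [M1 [M2 [h1 h2 h3 h4 [h5 h6]]]]] := jet_comp t0 b0 s0 l01 hv hw aM.
have := ex_add h6 h5; have M00 := ex_ge0 h4; have /andP[l0 l1] := l01.
move=> h; apply: (ex_leM rd_gt0 t0 _ (eq_ex _ h)); last first.
  by move=> z _; rewrite subrK.
apply: (@le_trans _ _ (lam * (M2 + M1))).
  by rewrite mulrDr lerD2r ler_wpM2r// expr2 ler_piMl.
by rewrite ler_wpM2l//; move: h3; lra.
Qed.

Lemma ex_taylor2 t s lam w a M : 0 <= t -> 0 < s ->
  0 <= lam <= 1 -> exv t w (lam * s) -> nle (t + s) a M ->
  ex 0 t (fun z => tfeval a (z + w z) - tfeval a z -
    \sum_c tfeval (dco c a) z * coord c (w z)) (lam ^+ 2 * M).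
Proof.
move=> t0 s0 l01 hw aM; have aM' : nle (t + 0 + s) a M by rewrite addr0.
have [M0 [M1 [M2 [h1 h2 h3 h4 [h5 h6]]]]] :=
  jet_comp t0 (lexx 0) s0 l01 (exv_zero t0) hw aM'.
have M00 := ex_ge0 h4.
apply: (ex_leM rd_gt0 t0 _ (eq_ex _ h6)) => [|z _].
  by rewrite ler_wpM2l ?exprn_ge0//; [case/andP: l01|move: h3; lra].
by rewrite !addr0.
Qed.

End Composition.

Lemma addrBsub (V : zmodType) (x y w : V) : x + y + (w - y) = x + w.
Proof. by rewrite -addrA [y + _]addrC subrK. Qed.

(** * Fixed points of displacement equations *)

Section Picard.
Variables (R : realType) (n1 n2 : nat).
Local Notation C := R[i].
Local Notation Z := (phase R n1 n2).
Local Notation X := (tfindex n1 n2).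
Local Notation coordinate := (coordinate n1 n2).
Variable rd : coordinate -> R.
Hypothesis rd_gt0 : forall c, 0 < rd c.
Local Notation nle := (nle rd).
Local Notation ex := (ex rd).
Local Notation exv := (exv rd).
Local Notation pdom := (pdom rd).

Let half_gt0 n : 0 < 2^-1 ^+ n :> R.
Proof. by rewrite exprn_gt0// invr_gt0. Qed.

Let half_small (K e : R) : 0 <= K -> 0 < e -> exists n, K * 2^-1 ^+ n < e.
Proof.
move=> K0 e0; pose n := Num.bound (K / e); exists n.
have h : K / e < n%:R by apply: archi_boundP; rewrite divr_ge0// ltW.
rewrite exprVn ltr_pdivrMr ?exprn_gt0// mulrC -ltr_pdivrMr// (lt_le_trans h)//.
by rewrite -natrX ler_nat ltnW// ltn_expl.
Qed.

Let geometric_tail n (A : {fset nat}) :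
  \sum_(m <- A) (if (m < n)%N then 0 else 2^-1 ^+ m) <= 2 * 2^-1 ^+ n :> R.
Proof.
have [N hN] := fset_nat_sub A.
have h m : 0 <= (if (m < n)%N then 0 else 2^-1 ^+ m) :> R.
  by case: ifP => // _; rewrite ltW.
apply: le_trans (ler_sum_fsub (hN _ (leqnn N)) h) _; rewrite big_fset_iota.
have -> : \sum_(0 <= m < N) (if (m < n)%N then 0 else 2^-1 ^+ m) =
    (if (N <= n)%N then 0 else 2 * 2^-1 ^+ n - 2 * 2^-1 ^+ N) :> R.
  elim: N {hN} => [|N ih]; first by rewrite big_geq.
  rewrite big_nat_recr//= ih; case: (ltngtP N n) => Nn.
  - by rewrite addr0.
  - by rewrite exprS; field.
  - by rewrite Nn exprS add0r; field.
case: ifP => _; first by rewrite mulr_ge0// ltW.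
by rewrite gerBl mulr_ge0// ltW.
Qed.

(** All iterates stay bounded by [B], and [B / s <= 1/2] makes the iteration contract by one half:
    the increments are at most B 2^-n, whence the bound [2 * B] for the limit. *)
Lemma picard t s B (a : coordinate -> X -> C) : 0 <= t -> 0 < s ->
  0 <= B -> 2 * B <= s -> (forall c, nle (t + s + s) (a c) B) ->
  exists u : Z -> Z, exv t u (2 * B) /\
    forall z, pdom t z -> forall c, coord c (u z) = tfeval (a c) (z + u z).
Proof.
move=> t0 s0 B0 Bs aB; have s0' := ltW s0.
pose U := fix U n (z : Z) : Z :=
  if n is m.+1 then mkphase (fun c => tfeval (a c) (z + U m z)) else 0.
have UE n c z : coord c (U n.+1 z) = tfeval (a c) (z + U n z).
  by rewrite coord_mkphase.
have UB n : exv t (U n) B.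
  elim: n => [|n ih] c.
    by apply: ex_leM (exv_zero rd t0 c).
  apply: (@eq_ex _ _ _ _ _ _ (fun z => tfeval (a c) (z + U n z))).
    by move=> z _; rewrite UE.
  apply: (ex_comp rd_gt0 t0 B0 ih); apply: nle_le (aB c) => //.
    by rewrite addr_ge0.
  by move: B0 Bs s0; lra.
pose D n z := U n.+1 z - U n z.
have UD n z : z + U n z + D n z = z + U n.+1 z by exact: addrBsub.
have DE n c z : coord c (D n.+1 z) =
    tfeval (a c) (z + U n.+1 z) - tfeval (a c) (z + U n z).
  by rewrite -(UE n.+1) -(UE n) -coordB.
have tBs : t + B + s <= t + s + s by move: B0 Bs s0; lra.
have aB' c : nle (t + B + s) (a c) B.
  by apply: nle_le (aB c) => //; rewrite ?addr_ge0.
have DB n : exv t (D n) (B * 2^-1 ^+ n).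
  elim: n => [|n ih] c.
    rewrite expr0 mulr1; apply: eq_ex (UB 1%N c) => z _.
    by rewrite /D subr0.
  (* Chosen so that [lam * s] is the size of the last increment; the next one then gains the factor
     [B / s]. *)
  pose lam := B * 2^-1 ^+ n / s.
  have l0 : 0 <= lam by rewrite divr_ge0// mulr_ge0// ltW.
  have n1' : 2^-1 ^+ n <= 1 :> R by rewrite exprn_ile1 ?invr_ge0// invf_le1// ler1n.
  have l1 : lam <= 1.
    rewrite ler_pdivrMr// mul1r (@le_trans _ _ B)//; last by move: Bs B0; lra.
    by rewrite ler_piMr.
  have ih' : exv t (D n) (lam * s) by rewrite divfK// gt_eqF.
  have l01 : 0 <= lam <= 1 by rewrite l0.
  have := ex_comp_diff rd_gt0 t0 B0 s0 l01 (UB n) ih' (aB' c).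
  move=> h; apply: (ex_leM rd_gt0 t0 _ (eq_ex _ h)) => [|z _].
    rewrite /lam exprS (_ : _ * B = (B * 2^-1 ^+ n) * (B / s)); last by ring.
    rewrite (mulrC 2^-1) [leRHS]mulrA ler_wpM2l//; first by rewrite mulr_ge0// ltW.
    by rewrite ler_pdivrMr//; move: Bs; lra.
  by rewrite UD DE.
have DA n (A : {fset nat}) : \sum_(m <- A) (if (m < n)%N then 0 else B * 2^-1 ^+ m)
    <= 2 * B * 2^-1 ^+ n.
  have := ler_wpM2l B0 (geometric_tail n A).
  rewrite mulr_sumr mulrCA mulrA; apply: le_trans; apply: ler_sum => m _.
  by case: ifP; rewrite ?mulr0.
pose u z := mkphase (fun c => sum (fun n => coord c (D n z))).
have uD c z : pdom t z -> hs (fun n => coord c (D n z)) (coord c (u z)).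
  move=> hz; rewrite coord_mkphase; apply: (@absb_sum _ _ _ (2 * B)) => A.
  have := DA 0%N A; rewrite expr0 mulr1; apply: le_trans; apply: ler_sum => m _.
  exact: (exv_cmod_le rd_gt0 c t0 (DB m) hz).
have uU n : exv t (fun z => u z - U n z) (2 * B * 2^-1 ^+ n).
  move=> c.
  apply: (@ex_series _ _ _ _ rd_gt0 nat 0 t
    (fun m z => if (m < n)%N then 0 else coord c (D m z))
    (fun m => if (m < n)%N then 0 else B * 2^-1 ^+ m)) => //.
    by move=> m; case: ifP => _; [exact: ex_zero|exact: DB].
  move=> z hz.
  have h1 := @hs_fin _ _ (fun m => if (m < n)%N then coord c (D m z) else 0)
    [fset i in iota 0 n]%fset.
  have h2 m : m \notin [fset i in iota 0 n]%fset ->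
      (if (m < n)%N then coord c (D m z) else 0) = 0.
    by rewrite in_fset_iota => /negbTE ->.
  have e : \sum_(i <- [fset i in iota 0 n]%fset)
      (if (i < n)%N then coord c (D i z) else 0) = coord c (U n z).
    rewrite big_fset_iota big_nat (eq_bigr (fun m => coord c (U m.+1 z) - coord c (U m z))).
      by rewrite -big_nat (telescope_sumr (fun m => coord c (U m z)))//= coord0 subr0.
    by move=> m /andP[_ ->]; rewrite coordB.
  rewrite coordB -e; apply: eq_hs (hs_add (uD c z hz) (hs_opp (h1 h2))) => m.
  by case: ifP; rewrite ?subrr ?subr0.
exists u; split.
  apply: (@eq_exv _ _ _ _ _ (fun z => u z - U 0%N z)) => [z _|].
    by rewrite subr0.
  by have := uU 0%N; rewrite expr0 mulr1.
(* Through comparison with the iterates [U n] and [U n.+1], the two sides differ by at most 2 B 2^-n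
   for every [n]. *)
move=> z hz c; apply/eqP; rewrite -subr_eq0; apply/eqP/cmod_eq_le0 => e e0.
have [n hn] := half_small (mulr_ge0 (ler0n _ 2) B0) e0.
apply: le_lt_trans hn.
have -> : coord c (u z) - tfeval (a c) (z + u z) = coord c (u z - U n.+1 z) -
    (tfeval (a c) (z + U n z + (u z - U n z)) - tfeval (a c) (z + U n z)).
  by rewrite addrBsub coordB UE opprB [RHS]addrA subrK.
apply: le_trans (cmodD _ _) _; rewrite cmodN.
have h1 := exv_cmod_le rd_gt0 c t0 (uU n.+1) hz.
pose lam := 2 * B * 2^-1 ^+ n / s.
have l0 : 0 <= lam by rewrite divr_ge0// !mulr_ge0// ltW.
have n1' : 2^-1 ^+ n <= 1 :> R by rewrite exprn_ile1 ?invr_ge0// invf_le1// ler1n.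
have l1 : lam <= 1.
  rewrite ler_pdivrMr// mul1r (@le_trans _ _ (2 * B))//.
  by rewrite ler_piMr// mulr_ge0.
have uU' : exv t (fun z => u z - U n z) (lam * s) by rewrite divfK// gt_eqF.
have l01 : 0 <= lam <= 1 by rewrite l0.
have := ex_comp_diff rd_gt0 t0 B0 s0 l01 (UB n) uU' (aB' c).
move=> /(ex_cmod_le rd_gt0 t0)/(_ hz) h2.
apply: (le_trans (lerD h1 h2)).
have h3 : lam * B <= 2 * B * 2^-1 ^+ n / 2.
  rewrite /lam (_ : _ * B = (2 * B * 2^-1 ^+ n) * (B / s)); last by ring.
  rewrite ler_wpM2l//; first by rewrite !mulr_ge0// ltW.
  by rewrite ler_pdivrMr//; move: Bs; lra.
move: h3; rewrite exprS; set p := 2^-1 ^+ n; lra.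
Qed.

End Picard.

(** * Differentials and the symplectic midpoint map *)

Section RowNorm.
Variables (K : numDomainType) (N : nat).

Lemma ler_row_norm (h : 'rV[K]_N) k : `|h 0 k| <= `|h|.
Proof.
rewrite [leRHS](_ : _ = mx_norm h)// mx_normE -[leLHS]nngE num_le.
exact: (le_bigmax _ (fun i : 'I_1 * 'I_N => `|h i.1 i.2|%:nng) (0, k)).
Qed.

Lemma row_norm_ler (h : 'rV[K]_N) (r : {nonneg K}) :
  (forall k, `|h 0 k| <= r%:num) -> `|h| <= r%:num.
Proof.
move=> hr; rewrite [leLHS](_ : _ = mx_norm h)// mx_normE num_le.
have r0 : 0 <= r%:num by [].
apply/bigmax_leP; split=> [|[i k] _]; first exact: r0.
by rewrite ord1; exact: hr.
Qed.

End RowNorm.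

Section RowNormComplex.
Variables (R : realType) (N : nat).
Local Notation C := R[i].

Lemma row_norm_ge (h : 'rV[C]_N) k : (cmod (h 0 k))%:C <= `|h|.
Proof. exact: (ler_row_norm h k). Qed.

Lemma row_norm_le (h : 'rV[C]_N) (r : R) : 0 <= r ->
  (forall k, cmod (h 0 k) <= r) -> `|h| <= r%:C.
Proof.
move=> r0 hr; rewrite -ler0c in r0.
apply: (row_norm_ler (r := NngNum r0)) => k /=.
by have := hr k; rewrite -lecR.
Qed.

End RowNormComplex.

Section RowDifferential.
Variables (K : numFieldType) (N m : nat).

Lemma mulmxr_row_continuous (M : 'M[K]_(N, m)) :
  continuous (mulmxr M : 'rV[K]_N -> 'rV[K]_m).
Proof.
apply: bounded_linear_continuous; apply/ex_bound.
have S0 : 0 <= \sum_i \sum_k `|M i k|.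
  by rewrite sumr_ge0// => i _; rewrite sumr_ge0.
exists (\sum_i \sum_k `|M i k|); apply/nbhs_ballP; exists 1 => //= x; rewrite -ball_normE /ball_ /= sub0r normrN => x1.
apply: (row_norm_ler (r := NngNum S0)) => k /=.
rewrite mxE (le_trans (ler_norm_sum _ _ _))//; apply: ler_sum => i _.
rewrite normrM (bigD1 k)//= -[leLHS]addr0 lerD//; last first.
  by rewrite sumr_ge0.
rewrite ler_piMl// (le_trans (ler_row_norm _ _))//.
exact: ltW.
Qed.

(** Uniqueness of the differential, for a continuous linear part written as a matrix acting on rows
    from the right, which is the convention of [jacobian]. *)
Lemma row_differential (f : 'rV[K]_N -> 'rV[K]_m) (x : 'rV[K]_N) (M : 'M[K]_(N, m)) :
  (forall e, 0 < e -> exists2 d, 0 < d & forall h : 'rV[K]_N, `|h| < d ->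
    `|f (x + h) - f x - h *m M| <= e * `|h|) ->
  differentiable f x /\ jacobian f x = M.
Proof.
move=> hf.
have ho : f \o shift x = cst (f x) + (mulmxr M : 'rV[K]_N -> 'rV[K]_m) +o_ (0 : 'rV[K]_N) id.
  apply/eqaddoP => e /hf[d d0 hd]; apply/nbhs_ballP; exists d => // h; rewrite -ball_normE /ball_ /= sub0r normrN => /hd.
  by rewrite opprD addrA (addrC x).
have dE := diff_unique (@mulmxr_row_continuous M) ho.
split; last by apply/matrixP => i k; rewrite /jacobian mxE dE /= -rowE mxE.
apply/diff_locallyP; split; first by rewrite dE; exact: mulmxr_row_continuous.
by rewrite dE.
Qed.

End RowDifferential.

Section ComplexRowDifferential.
Variables (R : realType) (N m : nat).
Local Notation C := R[i].

Lemma quadratic_differential (f : 'rV[C]_N -> 'rV[C]_m) (x : 'rV[C]_N) (M : 'M[C]_(N, m)) (K d : R) :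
  0 < d -> 0 <= K ->
  (forall (h : 'rV[C]_N) (r : R), 0 <= r <= d -> (forall k, cmod (h 0 k) <= r) ->
    forall k, cmod ((f (x + h) - f x - h *m M) 0 k) <= K * r ^+ 2) ->
  differentiable f x /\ jacobian f x = M.
Proof.
move=> d0 K0 hf; apply: row_differential => e' e'0.
have [e e0 ->] : exists2 e : R, 0 < e & e' = e%:C.
  exists (complex.Re e'); last by rewrite RRe_real// gtr0_real.
  by rewrite -ltcR RRe_real// gtr0_real.
have K1 : 0 < K + 1 by rewrite ltr_wpDl.
(* Below [r0] the quadratic remainder satisfies K r^2 <= e r. *)
pose r0 := Num.min d (e / (K + 1)).
have r00 : 0 < r0 by rewrite lt_min d0 divr_gt0.
exists r0%:C; first by rewrite ltcR.
move=> h hr0.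
have hR : `|h| = (complex.Re `|h|)%:C by rewrite RRe_real// normr_real.
set r := complex.Re `|h| in hR.
have r_ge0 : 0 <= r by rewrite -ler0c -hR normr_ge0.
have rr0 : r < r0 by rewrite -ltcR -hR.
have rd : r <= d by rewrite ltW// (lt_le_trans rr0)// ge_min lexx.
have re : r * (K + 1) <= e.
  by rewrite -ler_pdivlMr// ltW// (lt_le_trans rr0)// ge_min lexx orbT.
have hk k : cmod (h 0 k) <= r by rewrite -lecR -hR row_norm_ge.
rewrite hR -real_complexM; apply: row_norm_le; first by rewrite mulr_ge0 ?(ltW e0).
move=> k; have := hf h r _ hk k; rewrite r_ge0 rd => /(_ isT) /le_trans; apply.
rewrite expr2 mulrA ler_wpM2r// (le_trans _ re)//.
by rewrite mulrC ler_wpM2l// lerDl.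
Qed.

End ComplexRowDifferential.

Section Fields.
Variables (R : realType) (n1 n2 : nat).
Local Notation C := R[i].
Local Notation Z := (phase R n1 n2).
Local Notation X := (tfindex n1 n2).
Local Notation coordinate := (coordinate n1 n2).
Local Notation N := ((n1 + n1) + (n2 + n2))%N.
Variable rd : coordinate -> R.
Hypothesis rd_gt0 : forall c, 0 < rd c.
Local Notation nle := (nle rd).
Local Notation ex := (ex rd).
Local Notation exv := (exv rd).
Local Notation pdom := (pdom rd).

Definition cof (k : 'I_N) : coordinate :=
  match fintype.split k with
  | inl k' => inl (fintype.split k')
  | inr k' => inr (fintype.split k')
  end.

Lemma cidxK : cancel (@cidx n1 n2) cof.
Proof.
move=> [[i|i]|[i|i]]; rewrite /cof /=.
- by rewrite (unsplitK (inl _)) (unsplitK (inl _)).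
- by rewrite (unsplitK (inl _)) (unsplitK (inr _)).
- by rewrite (unsplitK (inr _)) (unsplitK (inl _)).
- by rewrite (unsplitK (inr _)) (unsplitK (inr _)).
Qed.

Lemma cofK : cancel cof (@cidx n1 n2).
Proof. by move=> k; have [c <-] := cidx_surj k; rewrite cidxK. Qed.

Lemma sum_cidx (V : nmodType) (F : 'I_N -> V) : \sum_k F k = \sum_c F (cidx c).
Proof.
by rewrite (reindex (@cidx n1 n2))//; exists cof => k _; rewrite ?cidxK ?cofK.
Qed.

Lemma tfeval_scale t k a M z : 0 <= t -> nle t a M -> pdom t z ->
  tfeval (fun x => k * a x) z = k * tfeval a z.
Proof.
move=> t0 aM hz; apply: hs_sum.
by apply: eq_hs (hs_mull k (nle_hs rd_gt0 t0 aM hz)) => x; rewrite mulrA.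
Qed.

Lemma tfeval_add t a b M M' z : 0 <= t -> nle t a M -> nle t b M' -> pdom t z ->
  tfeval (fun x => a x + b x) z = tfeval a z + tfeval b z.
Proof.
move=> t0 aM bM hz; apply: hs_sum.
apply: eq_hs (hs_add (nle_hs rd_gt0 t0 aM hz) (nle_hs rd_gt0 t0 bM hz)) => x.
by rewrite mulrDl.
Qed.

Lemma exv_cst t (h : Z) r : 0 <= t -> (forall c, cmod (coord c h) <= r) ->
  exv t (fun=> h) r.
Proof. by move=> t0 hr c; apply: ex_leM (hr c) (ex_cst rd_gt0 _ t0). Qed.

(** A constant displacement is a vector field of scale [r / s], so [ex_taylor2] gives the pointwise
    Taylor bound. *)
Lemma tfeval_quadratic t s a M z h r : 0 <= t -> 0 < s -> nle (t + s) a M ->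
  pdom t z -> 0 <= r <= s -> (forall c, cmod (coord c h) <= r) ->
  cmod (tfeval a (z + h) - tfeval a z - \sum_c tfeval (dco c a) z * coord c h)
    <= M / s ^+ 2 * r ^+ 2.
Proof.
move=> t0 s0 aM hz /andP[r0 rs] hr.
have l01 : 0 <= r / s <= 1 by rewrite divr_ge0// ?(ltW s0)//= ler_pdivrMr// mul1r.
have hw : exv t (fun=> h) (r / s * s) by apply: exv_cst => //; rewrite divfK ?gt_eqF.
have /(ex_cmod_le rd_gt0 t0)/(_ hz) := ex_taylor2 rd_gt0 t0 s0 l01 hw aM.
by move=> /le_trans; apply; rewrite mulrC exprMn exprVn mulrA mulrAC.
Qed.

Lemma tfeval_lipschitz t s a M z h r : 0 <= t -> 0 < s -> nle (t + s) a M ->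
  pdom t z -> 0 <= r <= s -> (forall c, cmod (coord c h) <= r) ->
  cmod (tfeval a (z + h) - tfeval a z) <= M / s * r.
Proof.
move=> t0 s0 aM hz /andP[r0 rs] hr.
have l01 : 0 <= r / s <= 1 by rewrite divr_ge0// ?(ltW s0)//= ler_pdivrMr// mul1r.
have hw : exv t (fun=> h) (r / s * s) by apply: exv_cst => //; rewrite divfK ?gt_eqF.
have aM' : nle (t + 0 + s) a M by rewrite addr0.
have := ex_comp_diff rd_gt0 t0 (lexx 0) s0 l01 (exv_zero rd t0) hw aM'.
move=> /(ex_cmod_le rd_gt0 t0)/(_ hz); rewrite addr0 => /le_trans; apply.
by rewrite (_ : r / s * M = M / s * r)//; ring.
Qed.

(** The scalar [k] is 1 for near-identity maps and 0 for fields; the linear part must be kept apart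
    because an angle is not a Taylor-Fourier series. *)
Lemma field_differential t s (b : coordinate -> X -> C) M (k : C) (f : Z -> Z) z :
  0 <= t -> 0 < s -> 0 <= M -> (forall c, nle (t + s) (b c) M) ->
  (forall z c, pdom (t + s) z -> coord c (f z) = k * coord c z + tfeval (b c) z) ->
  pdom t z ->
  differentiable f z /\
  jacobian f z = k%:M + \matrix_(i, j) tfeval (dco (cof i) (b (cof j))) z.
Proof.
move=> t0 s0 M0 bM fb hz; apply: (quadratic_differential (d := s) (K := M / s ^+ 2)) => //.
  by rewrite divr_ge0// exprn_ge0// ltW.
move=> h r r0s hr j; have hr' c : cmod (coord c h) <= r by exact: hr.
have hzs : pdom (t + s) z by apply: pdom_le hz; rewrite lerDl ltW.
have hzh : pdom (t + s) (z + h).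
  by apply: pdomD hz => c; rewrite (le_trans (hr' c))//; case/andP: r0s.
apply: le_trans (tfeval_quadratic t0 s0 (bM (cof j)) hz r0s hr').
rewrite le_eqVlt; apply/orP; left; apply/eqP; congr cmod.
have e (y : Z) : y 0 j = coord (cof j) y by rewrite /coord cofK.
rewrite e !coordB (fb (z + h))// (fb z)// coordD.
rewrite mulmxDr mul_mx_scalar coordD coordZ.
have -> : coord (cof j) (h *m \matrix_(i, j) tfeval (dco (cof i) (b (cof j))) z) =
   \sum_c tfeval (dco c (b (cof j))) z * coord c h.
  rewrite /coord mxE sum_cidx; apply: eq_bigr => c _.
  by rewrite mxE cidxK cidxK mulrC.
by ring.
Qed.

End Fields.

(** The factors stand in the order of application since derivatives act on rows from the right. *)
Lemma jacobian_comp (R : realType) (n m p : nat) (f : 'rV[R[i]]_n -> 'rV[R[i]]_m)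
    (g : 'rV[R[i]]_m -> 'rV[R[i]]_p) (x : 'rV[R[i]]_n) :
  differentiable f x -> differentiable g (f x) ->
  jacobian (g \o f) x = jacobian f x *m jacobian g (f x).
Proof.
move=> df dg; apply/row_matrixP => i; rewrite row_mul /jacobian.
by rewrite !rowE !mul_rV_lin1 diff_comp.
Qed.

(** * Symplectic matrices and the Cayley transform *)

Section Symplectic.
Variables (R : realType) (n1 n2 : nat).
Local Notation C := R[i].
Local Notation coordinate := (coordinate n1 n2).
Local Notation S := (symp R n1 n2).

Definition cconj (c : coordinate) : coordinate :=
  match c with
  | inl (inl i) => inl (inr i)
  | inl (inr i) => inl (inl i)
  | inr (inl i) => inr (inr i)
  | inr (inr i) => inr (inl i)
  end.

Definition csign (c : coordinate) : C :=
  match c with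
  | inl (inl i) => -1
  | inl (inr i) => 1
  | inr (inl i) => 1
  | inr (inr i) => -1
  end.

Lemma cconjK : involutive cconj.
Proof. by case=> [[]|[]]. Qed.

Lemma cmod_csign c : cmod (csign c) = 1.
Proof.
have h1 := @cmod1 R; have h2 : cmod (-1 : C) = 1 by rewrite cmodN.
by case: c => [[i|i]|[i|i]].
Qed.

Lemma sympE c c' : S (cidx c) (cidx c') = if c' == cconj c then csign c else 0.
Proof.
have delta m (i j : 'I_m) (a : C) : (if j == i then a else 0) = a *+ (i == j).
  by rewrite eq_sym; case: (i == j).
case: c => [[i|i]|[i|i]]; case: c' => [[j|j]|[j|j]]; rewrite /symp /cidx /cconj /csign.
- by rewrite block_mxEul block_mxEul mxE.
- by rewrite block_mxEul block_mxEur [LHS]mxE mxE delta; case: (i == j); rewrite ?oppr0.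
- by rewrite block_mxEur mxE.
- by rewrite block_mxEur mxE.
- by rewrite block_mxEul block_mxEdl mxE delta; case: (i == j).
- by rewrite block_mxEul block_mxEdr mxE.
- by rewrite block_mxEur mxE.
- by rewrite block_mxEur mxE.
- by rewrite block_mxEdl mxE.
- by rewrite block_mxEdl mxE.
- by rewrite block_mxEdr block_mxEul mxE.
- by rewrite block_mxEdr block_mxEur mxE delta; case: (i == j).
- by rewrite block_mxEdl mxE.
- by rewrite block_mxEdl mxE.
- by rewrite block_mxEdr block_mxEdl [LHS]mxE mxE delta; case: (i == j); rewrite ?oppr0.
- by rewrite block_mxEdr block_mxEdr mxE.
Qed.

(** The first hypothesis says that [1 + U] inverts [1 - A], so [1 + 2 U] is the Cayley transform of
    [A]. The second makes [(1 + A) S (1 + A)^T] and [(1 - A) S (1 - A)^T] equal: their cross terms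
    cancel. *)
Lemma symp_cayley (A U : 'M[C]_((n1 + n1) + (n2 + n2))) :
  U = (1%:M + U) *m A -> A *m S + S *m A^T = 0 ->
  (1%:M + 2 *: U) *m S *m (1%:M + 2 *: U)^T = S.
Proof.
move=> UA AS; set B := 1%:M + U.
have BQ : B *m (1%:M - A) = 1%:M.
  by rewrite mulmxBr mulmx1 -UA /B addrK.
have QB : (1%:M - A) *m B = 1%:M by exact: mulmx1C.
have -> : 1%:M + 2 *: U = B *m (1%:M + A).
  by rewrite mulmxDr mulmx1 -UA /B -addrA scaler_nat mulr2n.
have BP : B *m (1%:M + A) = (1%:M + A) *m B.
  rewrite (_ : 1%:M + A = 2%:M - (1%:M - A)); last first.
    have -> : 2%:M = 1%:M + 1%:M :> 'M[C]_((n1 + n1) + (n2 + n2)).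
      by rewrite -raddfD.
    by rewrite opprB addrBsub.
  by rewrite mulmxBr mulmxBl BQ QB mul_mx_scalar mul_scalar_mx.
have PQ : (1%:M + A) *m S *m (1%:M + A)^T = (1%:M - A) *m S *m (1%:M - A)^T.
  have SA : S *m A^T = - (A *m S) by apply/eqP; rewrite -addr_eq0 addrC AS.
  have trP : (1%:M + A)^T = 1%:M + A^T by rewrite linearD /= trmx1.
  have trQ : (1%:M - A)^T = 1%:M - A^T by rewrite linearB /= trmx1.
  rewrite trP trQ mulmxDr mulmxBr !mulmx1 !mulmxDl !mul1mx !mulNmx SA.
  move: (A *m S) (A *m S *m A^T) => P Q.
  by apply/matrixP => i j; rewrite !mxE; ring.
have -> : B *m (1%:M + A) *m S *m (B *m (1%:M + A))^T =
    B *m ((1%:M + A) *m S *m (1%:M + A)^T) *m B^T.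
  by rewrite trmx_mul !mulmxA.
rewrite PQ !mulmxA BQ mul1mx -mulmxA -trmx_mul BQ trmx1 mulmx1.
by [].
Qed.

End Symplectic.

(** * The implicit midpoint map of a generating function *)

Section Midpoint.
Variables (R : realType) (n1 n2 : nat).
Local Notation C := R[i].
Local Notation Z := (phase R n1 n2).
Local Notation X := (tfindex n1 n2).
Local Notation coordinate := (coordinate n1 n2).
Variable rd : coordinate -> R.
Hypothesis rd_gt0 : forall c, 0 < rd c.
Local Notation nle := (nle rd).
Local Notation ex := (ex rd).
Local Notation exv := (exv rd).
Local Notation pdom := (pdom rd).
Local Notation S := (symp R n1 n2).

Lemma dcoZ c k (a : X -> C) : dco c (fun x => k * a x) = (fun x => k * dco c a x).
Proof. by apply/funext => x; rewrite /dco; case: ifP => _; rewrite mulrCA. Qed.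

Lemma tfeval_dcoZ t s c k a M z : 0 <= t -> 0 < s -> nle (t + s) a M -> pdom t z ->
  tfeval (dco c (fun x => k * a x)) z = k * tfeval (dco c a) z.
Proof.
by move=> t0 s0 aM hz; rewrite dcoZ (tfeval_scale rd_gt0 k t0 (nle_dco rd_gt0 c t0 s0 aM) hz).
Qed.

(* The coefficients of the components of the Hamiltonian field of [chi]. *)
Definition hamco (chi : X -> C) (c : coordinate) : X -> C :=
  fun x => csign R c * dco (cconj c) chi x.

Lemma csignK (c : coordinate) : csign R c * csign R c = 1 :> C.
Proof. by case: c => [[i|i]|[i|i]]; rewrite /csign ?mulrNN mulr1. Qed.

Lemma csign_conj (c : coordinate) : csign R c * csign R (cconj c) = -1 :> C.
Proof. by case: c => [[i|i]|[i|i]]; rewrite /csign ?mulN1r ?mul1r ?opprK. Qed.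

Lemma nle_hamco t s chi B c : 0 <= t -> 0 < s -> nle (t + s) chi B ->
  nle t (hamco chi c) (B / s).
Proof.
move=> t0 s0 h; have := nle_scale (csign R c) (nle_dco rd_gt0 (cconj c) t0 s0 h).
by rewrite cmod_csign mul1r.
Qed.

(** Symmetry of second derivatives: [A *m S] is half the Hessian of [chi], and the other term is
    minus its transpose. *)
Lemma hamco_hessian t s chi B z : 0 <= t -> 0 < s -> nle (t + s + s) chi B ->
  pdom t z ->
  let A := \matrix_(i, j) tfeval (dco (cof i) (fun x => 2^-1 * hamco chi (cof j) x)) z in
  A *m S + S *m A^T = 0.
Proof.
move=> t0 s0 h hz A; have ts0 : 0 <= t + s by rewrite addr_ge0// ltW.
pose Hs c c' := tfeval (dco c (dco c' chi)) z.
have AE c c' : A (cidx c) (cidx c') = 2^-1 * (csign R c' * Hs c (cconj c')).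
  rewrite mxE !cidxK (tfeval_dcoZ _ _ t0 s0 (nle_hamco c' ts0 s0 h) hz).
  by rewrite (tfeval_dcoZ _ _ t0 s0 (nle_dco rd_gt0 (cconj c') ts0 s0 h) hz).
have HC c c' : Hs c c' = Hs c' c.
  by rewrite /Hs (_ : dco c _ = dco c' (dco c chi))//; apply/funext/dcoC.
have ext (P Q : 'M[C]_((n1 + n1) + (n2 + n2))) :
    (forall c c', P (cidx c) (cidx c') = Q (cidx c) (cidx c')) -> P = Q.
  move=> e; apply/matrixP => i j; have [c <-] := cidx_surj i.
  by have [c' <-] := cidx_surj j.
apply: ext => c c'; rewrite [LHS]mxE [RHS]mxE.
have -> : (A *m S) (cidx c) (cidx c') = 2^-1 * Hs c c'.
  rewrite mxE sum_cidx (bigD1 (cconj c'))//= big1 ?addr0.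
    rewrite sympE cconjK eqxx AE cconjK -[RHS]mulr1 -(csignK (cconj c')).
    by ring.
  move=> k hk; rewrite sympE; case: eqP => [e|_]; rewrite ?mulr0//.
  by rewrite e cconjK eqxx in hk.
have -> : (S *m A^T) (cidx c) (cidx c') = - (2^-1 * Hs c' c).
  rewrite mxE sum_cidx (bigD1 (cconj c))//= big1 ?addr0.
    by rewrite sympE eqxx mxE AE cconjK -mulrN1 -(csign_conj c); ring.
  by move=> k hk; rewrite sympE (negbTE hk) mul0r.
by rewrite HC subrr.
Qed.

(* The implicit midpoint rule: with [m = z + u] and [u = X_chi(m) / 2], the map
   [z + 2 u] is symplectic because its differential is the Cayley transform of
   a Hamiltonian matrix. *)
Lemma midpoint t s chi B : 0 <= t -> 0 < s -> 0 <= B -> B <= s ^+ 2 ->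
  nle (t + s + s + s + s) chi B ->
  exists w : Z -> Z, [/\ exv (t + s) w (2 * B / s),
    forall z, pdom t z -> differentiable (fun z => z + w z) z /\
      jacobian (fun z => z + w z) z *m S *m (jacobian (fun z => z + w z) z)^T = S &
    forall c, ex 0 t (fun z => coord c (w z) - tfeval (hamco chi c) z) (B ^+ 2 / s ^+ 3)].
Proof.
move=> t0 s0 B0 Bs chiB; have s0' := ltW s0.
have ts0 : 0 <= t + s by rewrite addr_ge0.
have tss0 : 0 <= t + s + s by rewrite addr_ge0.
have tsss0 : 0 <= t + s + s + s by rewrite addr_ge0.
pose a c x := 2^-1 * hamco chi c x.
(* Bound of the half field after a Cauchy estimate; [B <= s ^+ 2] is exactly the condition
   [2 * B1 <= s] of [picard]. *)
pose B1 := B / s / 2.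
have B10 : 0 <= B1 by rewrite !divr_ge0.
have B2s : 2 * B1 <= s.
  by rewrite /B1 mulrC divfK// ler_pdivrMr// -expr2.
have c2 : cmod (2^-1 : C) = 2^-1 by rewrite cmodV cmod_nat.
have aB c : nle (t + s + s + s) (a c) B1.
  have := nle_scale (2^-1) (nle_hamco c tsss0 s0 chiB).
  by rewrite c2 mulrC.
have [u [uB uE]] := picard rd_gt0 ts0 s0 B10 B2s aB.
have [b hb] := boolp.choice (fun c => exP rd_gt0 ts0 (uB c)).
have bB c : nle (t + s) (b c) (2 * B1) by have [] := hb c.
have bE c z : pdom (t + s) z -> coord c (u z) = tfeval (b c) z.
  by move=> hz; have [_ _ ->] := hb c.
pose w z := 2 *: u z.
exists w; split.
- move=> c; have := ex_scale 2 (uB c); rewrite cmod_nat.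
  rewrite (_ : 2 * B / s = 2 * (2 * B1)); last by rewrite /B1; field; rewrite gt_eqF.
  by apply: eq_ex => z _; rewrite coordZ.
- move=> z hz.
  have B20 : 0 <= 2 * B1 by rewrite mulr_ge0.
  pose F z := z + u z.
  pose G m : Z := mkphase (fun c => tfeval (a c) m).
  have hFz : pdom (t + s) (F z).
    apply: (pdomD _ hz) => c; apply: le_trans B2s.
    apply: (exv_cmod_le rd_gt0 c t0 _ hz).
    by apply: (exv_le rd_gt0 t0 _ (lexx _) uB); rewrite lerDl.
  pose U := \matrix_(i, j) tfeval (dco (cof i) (b (cof j))) z.
  have [dF jF] : differentiable F z /\ jacobian F z = 1%:M + U.
    apply: (field_differential rd_gt0 t0 s0 B20 bB _ hz) => z' c hz'.
    by rewrite /F coordD mul1r bE.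
  have aB' c : nle (t + s + s) (a c) B1.
    by apply: nle_le (aB c) => //; rewrite lerDl.
  have [dG jG] := field_differential (f := G) (k := 0) rd_gt0 ts0 s0 B10 aB'
     (fun z' c _ => esym (etrans (congr1 (fun x => x + _) (mul0r _)) (etrans (add0r _) (esym (coord_mkphase _ c))))) hFz.
  have [_ jGF] : differentiable (G \o F) z /\ jacobian (G \o F) z = 0%:M + U.
    apply: (field_differential rd_gt0 t0 s0 B20 bB _ hz) => z' c hz'.
    by rewrite mul0r add0r /G /= coord_mkphase -uE// bE.
  (* The chain rule applied to the fixed point equation u = G(z + u). *)
  have UA : U = (1%:M + U) *m (\matrix_(i, j) tfeval (dco (cof i) (a (cof j))) (F z)).
    have z0 : 0%:M = 0 :> 'M[C]_((n1 + n1) + (n2 + n2)) by exact: raddf0.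
    have jc := jacobian_comp dF dG; rewrite z0 add0r in jG; rewrite z0 add0r in jGF.
    by rewrite -jG -jF -jGF.
  have [dP jP] : differentiable (fun z => z + w z) z /\
      jacobian (fun z => z + w z) z = 1%:M + 2 *: U.
    have b2 c : nle (t + s) (fun x => 2 * b c x) (2 * (2 * B1)).
      by have := nle_scale 2 (bB c); rewrite cmod_nat.
    have B40 : 0 <= 2 * (2 * B1) by rewrite mulr_ge0.
    have -> : 2 *: U = \matrix_(i, j) tfeval (dco (cof i) (fun x => 2 * b (cof j) x)) z.
      apply/matrixP => i j; rewrite !mxE.
      by rewrite (tfeval_dcoZ _ _ t0 s0 (bB (cof j)) hz).
    apply: (field_differential rd_gt0 t0 s0 B40 b2 _ hz) => z' c hz'.
    rewrite coordD coordZ mul1r (tfeval_scale rd_gt0 _ ts0 (bB c) hz').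
    by rewrite -bE.
  split=> //; rewrite jP; apply: (symp_cayley UA).
  have chiB' : nle (t + s + s + s) chi B by apply: nle_le chiB => //; rewrite lerDl.
  exact: (hamco_hessian ts0 s0 chiB' hFz).
- move=> c.
  (* The field moves from [z] to the midpoint at distance at most [2 * B1]; the resulting error
     [2 * (lam * B1)] is the announced constant. *)
  pose lam := 2 * B1 / s.
  have l01 : 0 <= lam <= 1.
    apply/andP; split; last by rewrite ler_pdivrMr// mul1r.
    by apply: divr_ge0 => //; apply: mulr_ge0.
  have uB' : exv t u (lam * s).
    by rewrite divfK ?gt_eqF//; apply: exv_le uB => //; rewrite lerDl.
  have aB' : nle (t + 0 + s) (a c) B1.
    by rewrite addr0; apply: nle_le (aB c) => //; rewrite -addrA lerDl addr_ge0.
  have := ex_comp_diff rd_gt0 t0 (lexx 0) s0 l01 (exv_zero rd t0) uB' aB'.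
  move=> /(ex_scale 2); rewrite cmod_nat.
  rewrite (_ : 2 * (lam * B1) = B ^+ 2 / s ^+ 3); last first.
    by rewrite /lam /B1; field; rewrite gt_eqF.
  apply: eq_ex => z hz; have hzs : pdom (t + s) z by apply: pdom_le hz; rewrite lerDl.
  rewrite addr0 -uE// mulrBr coordZ; congr (_ - _).
  rewrite (tfeval_scale rd_gt0 _ tsss0 (nle_hamco c tsss0 s0 chiB)).
    by rewrite mulrA mulfV ?mul1r// pnatr_eq0.
  by apply: pdom_le hz; rewrite -!addrA lerDl !addr_ge0.
Qed.

End Midpoint.

(** * Effect of a transformation on the Hamiltonian *)

Section LinearPart.
Variables (R : realType) (d n2 : nat).
Local Notation C := R[i].
Local Notation Z := (phase R d.+1 n2).
Local Notation X := (tfindex d.+1 n2).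
Local Notation coordinate := (coordinate d.+1 n2).
Variables (omega : R) (Omega : 'I_n2 -> R).
Variable rd : coordinate -> R.
Hypothesis rd_gt0 : forall c, 0 < rd c.
Local Notation nle := (nle rd).
Local Notation ex := (ex rd).
Local Notation exv := (exv rd).
Local Notation pdom := (pdom rd).
Local Notation lin := (@lin_part R d n2 omega Omega).

Definition dlin (c : coordinate) (z : Z) : C :=
  match c with
  | inl (inl i) => if i == ord0 then omega%:C else 0
  | inl (inr i) => 0
  | inr (inl j) => 'i * (Omega j)%:C * coord (inr (inr j)) z
  | inr (inr j) => 'i * (Omega j)%:C * coord (inr (inl j)) z
  end.

Definition quad_lin (z : Z) : C :=
  \sum_j 'i * (Omega j)%:C * (coord (inr (inl j)) z * coord (inr (inr j)) z).

Lemma linE z : lin z = omega%:C * coord (inl (inl ord0)) z + quad_lin z.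
Proof.
rewrite /lin_part coord_act; congr (_ + _); apply: eq_bigr => j _.
by rewrite coord_cxi coord_ceta mulrA.
Qed.

Lemma sum_dlin (F : coordinate -> C) z : \sum_c dlin c z * F c =
  omega%:C * F (inl (inl ord0)) +
  \sum_j 'i * (Omega j)%:C * (coord (inr (inr j)) z * F (inr (inl j)) +
                              coord (inr (inl j)) z * F (inr (inr j))).
Proof.
rewrite sum_coordinate.
have -> : \sum_i dlin (inl (inl i)) z * F (inl (inl i)) =
    omega%:C * F (inl (inl ord0)).
  by rewrite (bigD1 ord0)//= big1 ?addr0// => i /negbTE ->; rewrite mul0r.
have -> : \sum_i dlin (inl (inr i)) z * F (inl (inr i)) = 0.
  by rewrite big1// => i _; rewrite mul0r.
rewrite addr0 -big_split; congr (_ + _); apply: eq_bigr => j _ /=.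
by rewrite mulrDr !mulrA.
Qed.

Lemma lin_add z w :
  lin (z + w) = lin z + \sum_c dlin c z * coord c w + quad_lin w.
Proof.
rewrite !linE coordD mulrDr sum_dlin.
have -> : quad_lin (z + w) = quad_lin z + quad_lin w +
    \sum_j 'i * (Omega j)%:C * (coord (inr (inr j)) z * coord (inr (inl j)) w +
       coord (inr (inl j)) z * coord (inr (inr j)) w); last by ring.
rewrite /quad_lin -!big_split /=; apply: eq_bigr => j _.
by rewrite !coordD; ring.
Qed.

(* [- 'i * eigval x] is the eigenvalue at the monomial of index [x] of the
   Poisson bracket with the linear part. *)
Definition eigval (x : X) : R := omega * (xfreq (inl (inr ord0)) x)%:~R +
  \sum_j Omega j * ((xexp (inr (inl j)) x)%:R - (xexp (inr (inr j)) x)%:R).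

Lemma coord_dmono c (x : X) (z : Z) : ~~ is_angle c ->
  coord c z * dmono c x z = (xexp c x)%:R * tfmono x z.
Proof.
move=> hc; case: (posnP (xexp c x)) => [e|/(xunit_split hc)[y <-]].
  by rewrite dmono_const// e mulr0 mul0r.
rewrite dmono_shift// tfmono_add xexp_add xexp_unit hc eqxx addn1 mulrCA.
congr (_ * _); rewrite mulrC; congr (_ * _).
rewrite tfmonoE (bigD1 c)//= big1 => [|c' hc'].
  by rewrite /cfactor (negbTE hc) xexp_unit hc eqxx expr1 mulr1.
rewrite /cfactor xexp_unit (negbTE hc') andbF xfreq_unit.
by case: ifP => _; rewrite ?expr0// mulr0z mulr0 mul0r cexp0.
Qed.

(** Monomials diagonalize the bracket with the linear part: the fast angle contributes its frequency
    and, by Euler's identity, each pair xi_j, eta_j the difference of its exponents. *)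
Lemma dlin_mono x z :
  \sum_c dlin c z * (csign R c * dmono (cconj c) x z) =
  - ('i * (eigval x)%:C) * tfmono x z.
Proof.
rewrite (sum_dlin (fun c => csign R c * dmono (cconj c) x z)) /=.
rewrite dmono_angle// /eigval real_complexD real_complexM -intr_complex.
rewrite rmorph_sum /= mulrDr opprD mulrDl; congr (_ + _).
  by rewrite /xfreq; ring.
rewrite mulr_sumr -sumrN mulr_suml; apply: eq_bigr => j _.
have h1 := @coord_dmono (inr (inl j)) x z isT.
have h2 := @coord_dmono (inr (inr j)) x z isT.
rewrite mul1r mulN1r mulrN h1 h2 real_complexM rmorphB /=.
rewrite (rmorph_nat (real_complex R)) (rmorph_nat (real_complex R)).
by ring.
Qed.

Lemma ex_dlin tau : 0 <= tau -> exists2 K, 0 <= K &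
  forall t c, 0 <= t -> t <= tau -> ex 0 t (dlin c) K.
Proof.
move=> tau0.
have h c : exists K, ex 0 tau (dlin c) K.
  case: c => [[i|i]|[j|j]].
  - by eexists; exact: ex_cst.
  - by eexists; exact: ex_cst.
  - by eexists; apply: ex_scale; exact: ex_coord.
  - by eexists; apply: ex_scale; exact: ex_coord.
have [k hk] := boolp.choice h.
have k0 c : 0 <= k c by exact: ex_ge0 (hk c).
exists (\sum_c k c); first exact: sumr_ge0.
move=> t c t0 tt; apply: (ex_le rd_gt0 (leqnn 0) t0 tt _ (hk c)).
by rewrite (bigD1 c)//= lerDl sumr_ge0.
Qed.

Lemma ex_quad_lin t w b : 0 <= t -> exv t w b ->
  ex 0 t (fun z => quad_lin (w z)) ((\sum_j `|Omega j|) * b ^+ 2).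
Proof.
move=> t0 hw; rewrite mulr_suml.
have h j : ex 0 t (fun z => 'i * (Omega j)%:C *
    (coord (inr (inl j)) (w z) * coord (inr (inr j)) (w z))) (`|Omega j| * b ^+ 2).
  have := ex_scale ('i * (Omega j)%:C)
    (ex_mul rd_gt0 t0 (hw (inr (inl j))) (hw (inr (inr j)))).
  by rewrite cmodM cmod_i mul1r cmod_real expr2.
exact: (ex_sum (index_enum _) (P := xpredT) t0 (fun j _ => h j)).
Qed.

Lemma ex_gradient t s w b a M : 0 <= t -> 0 < s -> nle (t + s) a M -> exv t w b ->
  ex 0 t (fun z => \sum_c tfeval (dco c a) z * coord c (w z))
    (#|{: coordinate}|%:R * (M / s * b)).
Proof.
move=> t0 s0 aM hw.
rewrite mulr_natl -sumr_const.
have h c : ex 0 t (fun z => tfeval (dco c a) z * coord c (w z)) (M / s * b).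
  apply: (ex_mul (d := 0) (d' := 0) rd_gt0 t0) => //.
  by apply: (ex_tfeval rd_gt0) => //; exact: nle_dco.
exact: (ex_sum (index_enum _) (P := xpredT) t0 (fun c _ => h c)).
Qed.

Lemma ex_dlin_sum t w b K : 0 <= t -> (forall c, ex 0 t (dlin c) K) -> exv t w b ->
  ex 0 t (fun z => \sum_c dlin c z * coord c (w z)) (#|{: coordinate}|%:R * (K * b)).
Proof.
move=> t0 hK hw; rewrite mulr_natl -sumr_const.
have h c : ex 0 t (fun z => dlin c z * coord c (w z)) (K * b).
  exact: (ex_mul (d := 0) (d' := 0) rd_gt0 t0).
exact: (ex_sum (index_enum _) (P := xpredT) t0 (fun c _ => h c)).
Qed.

(* The effect on a Hamiltonian [lin + f + g] of a change of variables [id + w]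
   whose first order effect on [lin + f] is [v], up to an error of size [Kr]. *)
Lemma step_expand t s f Kf g Kg w b v Kv Kr : 0 <= t -> 0 < s -> b <= s ->
  nle (t + s) f Kf -> nle (t + s) g Kg -> exv t w b -> nle t v Kv ->
  ex 0 t (fun z => \sum_c dlin c z * coord c (w z) +
    \sum_c tfeval (dco c f) z * coord c (w z) - tfeval v z) Kr ->
  exists e, nle t e (Kr + ((\sum_j `|Omega j|) * b ^+ 2 + b ^+ 2 * (Kf / s ^+ 2) + b * (Kg / s))) /\
  forall z, pdom t z ->
    lin (z + w z) + tfeval f (z + w z) + tfeval g (z + w z) =
    lin z + tfeval f z + tfeval (fun x => g x + v x + e x) z.
Proof.
move=> t0 s0 bs fK gK hw hv hr; have s0' := ltW s0.
have b0 : 0 <= b by exact: exv_ge0 hw (inl (inl ord0)).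
have bE : b = b / s * s by rewrite divfK// gt_eqF.
have l01 : 0 <= b / s <= 1.
  by apply/andP; split; [exact: divr_ge0|rewrite ler_pdivrMr// mul1r].
have hw' := hw; rewrite bE in hw'.
(* Besides the error in [v] there are three others: the quadratic part of [lin], the Taylor
   remainder of [f], and the whole variation of [g], which is small because both [g] and [w] are. *)
have q1 := ex_quad_lin t0 hw.
have q2 := ex_taylor2 rd_gt0 t0 s0 l01 hw' fK.
have gK0 : nle (t + 0 + s) g Kg by rewrite addr0.
have q3 := ex_comp_diff rd_gt0 t0 (lexx 0) s0 l01 (exv_zero rd t0) hw' gK0.
have /(exP rd_gt0 t0)[e [e1 _ e2]] := ex_add hr (ex_add (ex_add q1 q2) q3).
exists e; split.
  apply: nle_le e1 => //; rewrite lerD2l -!addrA lerD2l.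
  by rewrite le_eqVlt; apply/orP; left; apply/eqP; field; rewrite gt_eqF.
move=> z hz.
have tg : nle t g Kg by apply: nle_le gK => //; rewrite lerDl.
have tgv := nle_add tg hv.
rewrite (tfeval_add rd_gt0 t0 tgv e1 hz) (tfeval_add rd_gt0 t0 tg hv hz).
rewrite -e2// addr0 lin_add.
move: (\sum_c dlin c z * _) (\sum_c tfeval (dco c f) z * _) (quad_lin (w z))
  (tfeval f (z + w z)) (tfeval g (z + w z)) (tfeval f z) (tfeval g z) (tfeval v z) (lin z).
by move=> a1 a2 a3 a4 a5 a6 a7 a8 a9; ring.
Qed.

End LinearPart.

(** * The normalization steps *)

Section NormalFormState.
Variables (R : realType) (d n2 : nat).
Local Notation C := R[i].
Local Notation Z := (phase R d.+1 n2).
Local Notation X := (tfindex d.+1 n2).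
Local Notation coordinate := (coordinate d.+1 n2).
Variables (omega : R) (Omega : 'I_n2 -> R).
Variable rd : coordinate -> R.
Hypothesis rd_gt0 : forall c, 0 < rd c.
Local Notation nle := (nle rd).
Local Notation ex := (ex rd).
Local Notation exv := (exv rd).
Local Notation pdom := (pdom rd).
Local Notation lin := (@lin_part R d n2 omega Omega).
Local Notation dlin := (@dlin R d n2 omega Omega).

Definition fast (x : X) : int := xfreq (inl (inr ord0)) x.

(* The monomials that have to disappear in the normal form. *)
Definition bad (x : X) : bool :=
  ((tf_m x == 1%N) && (tf_l x <= 1)%N) ||
  ((fast x != 0) && ((tf_l x, tf_m x) \in [:: (0, 0); (1, 0); (0, 2); (2, 0)]%N)).

Definition proj (l : nat) (g : X -> C) : X -> C :=
  fun x => if bad x && (xdeg x == l) then g x else 0.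

Definition slowpart (g : X -> C) : X -> C := fun x => if fast x == 0 then g x else 0.

(** [unlift ord0] fails exactly at the fast angle, which is put to 0. *)
Definition zstar (qs : 'rV[R]_d) : Z := mkphase (fun c =>
  if c is inl (inr j) then (if unlift ord0 j is Some j' then (qs 0 j')%:C else 0)
  else 0).

(* The coefficient of [p_i] in the average of [g] over the fast angle, at
   [xi = eta = 0] and [q = qs]. *)
Definition av (qs : 'rV[R]_d) (i : 'I_d.+1) (g : X -> C) : C :=
  tfeval (dco (inl (inl i)) (slowpart g)) (zstar qs).

Lemma nle_slowpart t g M : 0 <= t -> nle t g M -> nle t (slowpart g) M.
Proof.
move=> t0; apply: nle_le => // x.
by rewrite /slowpart; case: ifP => // _; rewrite cmod0 cmod_ge0.
Qed.

Lemma nle_proj t l g M : 0 <= t -> nle t g M -> nle t (proj l g) M.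
Proof.
move=> t0; apply: nle_le => // x.
by rewrite /proj; case: ifP => // _; rewrite cmod0 cmod_ge0.
Qed.

Lemma pdom_zstar t qs : 0 <= t -> pdom t (zstar qs).
Proof.
move=> t0 c; rewrite coord_mkphase; apply: le_lt_trans (rdD_gt0 rd_gt0 c t0).
have h0 : cmod (0 : C) <= 0 by rewrite cmod0.
have h (a : R) : `|complex.Im a%:C| <= 0 by rewrite normr0.
case: c => [[i|i]|[i|i]]; rewrite /csize /is_angle //.
by case: (unlift ord0 i) => [j|]; [exact: (h (qs 0 j)) | exact: (h 0)].
Qed.

Lemma dcoD c (a b : X -> C) : dco c (fun x => a x + b x) =
  (fun x => dco c a x + dco c b x).
Proof. by apply/funext => x; rewrite /dco; case: ifP => _; rewrite mulrDr. Qed.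

Lemma av_add s qs i g g' M M' : 0 < s -> nle s g M -> nle s g' M' ->
  av qs i (fun x => g x + g' x) = av qs i g + av qs i g'.
Proof.
move=> s0 h h'; rewrite /av.
have -> : slowpart (fun x => g x + g' x) = (fun x => slowpart g x + slowpart g' x).
  by apply/funext => x; rewrite /slowpart; case: ifP => _; rewrite ?addr0.
rewrite dcoD; apply: (tfeval_add rd_gt0 (lexx 0) _ _ (pdom_zstar qs (lexx 0))).
  by apply: (nle_dco rd_gt0 _ (lexx 0) s0); rewrite add0r; apply: nle_slowpart h; exact: ltW.
by apply: (nle_dco rd_gt0 _ (lexx 0) s0); rewrite add0r; apply: nle_slowpart h'; exact: ltW.
Qed.

Lemma av_bound s qs i g M : 0 < s -> nle s g M -> cmod (av qs i g) <= M / s.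
Proof.
move=> s0 h; apply: (nle_tfeval rd_gt0 (lexx 0) _ (pdom_zstar qs (lexx 0))).
by apply: (nle_dco rd_gt0 _ (lexx 0) s0); rewrite add0r; apply: nle_slowpart h; exact: ltW.
Qed.

Lemma tfmono_zstar qs x : (0 < xdeg x)%N -> tfmono x (zstar qs) = 0.
Proof.
rewrite xdegE lt0n sum_nat_eq0 negb_forall => /existsP[c] /=.
rewrite muln_eq0 negb_or => /andP[_ hc].
have nc : ~~ is_angle c by apply: contraNN hc => a; rewrite xexp_angle.
rewrite tfmonoE (bigD1 c)//= /cfactor (negbTE nc) coord_mkphase.
rewrite (_ : (if c is inl (inr j) then _ else 0) = 0) ?expr0n.
  by rewrite (negbTE hc) mul0r.
by case: c nc {hc} => [[]|].
Qed.

(** Only p_i times a Fourier factor in the slow angles contributes to [av], and such a monomial has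
    degree 2. *)
Lemma av0 qs i g : (forall x, g x != 0 -> (fast x != 0) || (2 < xdeg x)%N) ->
  av qs i g = 0.
Proof.
move=> h; apply: hs_sum; apply: hs0 => x; rewrite /dco /=.
case: (posnP (xdeg x)) => [x0|/tfmono_zstar ->]; last by rewrite mulr0.
have -> : slowpart g (xadd x (xunit (inl (inl i)))) = 0.
  rewrite /slowpart; case: eqP => // fx; apply/eqP/negPn/negP => /h.
  by rewrite fx eqxx xdeg_add x0 add0n xdeg_unit.
by rewrite mulr0 mul0r.
Qed.

(** Item 2 is the averages, so beyond it the degree lags one behind the item number. *)
Definition ldeg (j : nat) : nat := if (j < 2)%N then j else j.-1.

(* What has to be made small, in the order in which this is done: the bad terms
   of degrees 0 and 1, the numbers [av], the bad terms of degrees 2, 3 and 4. *)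
Definition item (qs : 'rV[R]_d) (t : R) (j : nat) (g : X -> C) (b : R) : Prop :=
  if j == 2%N then forall i, cmod (av qs i g) <= b else nle t (proj (ldeg j) g) b.

Lemma item_le qs t t' j g b b' : 0 <= t -> t <= t' -> b <= b' -> item qs t' j g b ->
  item qs t j g b'.
Proof.
move=> t0 tt bb; rewrite /item; case: ifP => _ h; first by move=> i; exact: le_trans bb.
exact: nle_le h.
Qed.

Lemma projD l g g' : proj l (fun x => g x + g' x) = (fun x => proj l g x + proj l g' x).
Proof. by apply/funext => x; rewrite /proj; case: ifP => _; rewrite ?addr0. Qed.

Lemma item_add qs t j g g' b b' M M' : 0 < t -> nle t g M -> nle t g' M' ->
  item qs t j g b -> item qs t j g' b' -> item qs t j (fun x => g x + g' x) (b + b').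
Proof.
move=> t0 gM gM'; rewrite /item; case: ifP => _ h h'.
  by move=> i; rewrite (av_add qs i t0 gM gM') (le_trans (cmodD _ _))// lerD.
by rewrite projD; exact: nle_add.
Qed.

(** The constant serves both kinds of items: [t^-1] comes from the Cauchy estimate for the averages,
    1 from the projections. *)
Lemma item_nle qs t j g M : 0 < t -> nle t g M -> item qs t j g ((t^-1 + 1) * M).
Proof.
move=> t0 h; have M0 : 0 <= M by exact: absb_ge0 h.
have t0' : 0 <= t^-1 * M by rewrite mulr_ge0// invr_ge0 ltW.
rewrite mulrDl mul1r /item; case: ifP => _.
  by move=> i; rewrite (le_trans (av_bound qs i t0 h))// mulrC lerDl.
by apply: (nle_le rd_gt0 (ltW t0) (lexx t) _ (fun=> lexx _) (nle_proj _ (ltW t0) h)); rewrite lerDr.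
Qed.

Lemma nle0 t : nle t (fun=> 0) 0.
Proof. by move=> A; rewrite big1// => x _; rewrite mul0r cmod0. Qed.

Definition sympl (t : R) (Phi : Z -> Z) : Prop := forall z, pdom t z ->
  differentiable Phi z /\ jacobian Phi z *m symp R d.+1 n2 *m (jacobian Phi z)^T =
                          symp R d.+1 n2.

Variables (f : X -> C) (Kf tau : R) (g0 : R -> X -> C).
Hypothesis fK : nle tau f Kf.

Definition ham (eps : R) (z : Z) : C := lin z + tfeval f z + tfeval (g0 eps) z.

(** [phi] is the displacement of the whole transformation so far, [g] the perturbation in the new
    variables, and [n j] the order in eps reached by item [j]. *)
Definition state_at (n : nat -> nat) (t K : R) (qs : 'rV[R]_d) (eps : R)
    (phi : Z -> Z) (g : X -> C) : Prop :=
  [/\ exv t phi (K * `|eps|), sympl t (fun z => z + phi z),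
    forall z, pdom t z -> ham eps (z + phi z) = lin z + tfeval f z + tfeval g z,
    nle t g (K * `|eps|) &
    forall j, (j < 6)%N -> item qs t j g (K * `|eps| ^+ n j)].

(** The constants precede [qs]: this uniformity gives a threshold valid for every q*. *)
Definition state (n : nat -> nat) (t : R) : Prop :=
  exists K e1 : R, [/\ 0 <= K, 0 < e1 & forall qs (eps : R), `|eps| < e1 ->
    exists phi g, state_at n t K qs eps phi g].

Lemma jacobian_symp (P Q : 'M[C]_((d.+1 + d.+1) + (n2 + n2))) :
  P *m symp R d.+1 n2 *m P^T = symp R d.+1 n2 ->
  Q *m symp R d.+1 n2 *m Q^T = symp R d.+1 n2 ->
  (P *m Q) *m symp R d.+1 n2 *m (P *m Q)^T = symp R d.+1 n2.
Proof.
move=> hP hQ; rewrite trmx_mul -[RHS]hP -[in RHS]hQ !mulmxA.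
by [].
Qed.

Lemma sympl_comp t T (P Q : Z -> Z) : sympl t P -> (forall z, pdom t z -> pdom T (P z)) ->
  sympl T Q -> sympl t (Q \o P).
Proof.
move=> hP hPQ hQ z hz; have [dP jP] := hP z hz; have [dQ jQ] := hQ _ (hPQ z hz).
split; first exact: (differentiable_comp dP dQ).
rewrite (jacobian_comp dP dQ).
exact: (jacobian_symp jP jQ).
Qed.

(** Everything common to the six steps. The errors left by a map of order [s] are quadratic in it or
    pair it with [g], hence of order [s.+1]; items aiming at no more than that order absorb them. *)
Lemma state_step (n n' : nat -> nat) (s : nat) (t T dl : R) : 0 < t -> 0 < dl ->
  t + dl <= T -> T <= tau -> (0 < s)%N -> (forall j, (n' j <= s.+1)%N) ->
  state n T ->
  (forall K : R, 0 <= K -> exists K' e' : R, [/\ 0 <= K', 0 < e' & forall qs (eps : R) g,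
    `|eps| < e' -> nle T g (K * `|eps|) ->
    (forall j, (j < 6)%N -> item qs T j g (K * `|eps| ^+ n j)) ->
    exists w v, [/\ exv t w (K' * `|eps| ^+ s), sympl t (fun z => z + w z),
      nle t v (K' * `|eps| ^+ s),
      ex 0 t (fun z => \sum_c dlin c z * coord c (w z) +
        \sum_c tfeval (dco c f) z * coord c (w z) - tfeval v z) (K' * `|eps| ^+ s.+1) &
      forall j, (j < 6)%N -> item qs t j (fun x => g x + v x) (K' * `|eps| ^+ n' j)]]) ->
  state n' t.
Proof.
move=> t0 dl0 tT Ttau s0 n's [K [e1 [K0 e10 hst]]] hstep.
have t0' := ltW t0; have dl0' := ltW dl0.
have tdl0 : 0 <= t + dl by rewrite addr_ge0.
have [K' [e' [K'0 e'0 hstep']]] := hstep K K0.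
pose SO := \sum_j `|Omega j|.
have SO0 : 0 <= SO by exact: sumr_ge0.
have Kf0 : 0 <= Kf by exact: absb_ge0 fK.
(* The bound of [step_expand] with one power [s.+1] of eps taken out of each term. *)
pose K2 := K' + (SO * K' ^+ 2 + K' ^+ 2 * (Kf / dl ^+ 2) + K' * (K / dl)).
have K20 : 0 <= K2 by rewrite /K2 !addr_ge0 ?mulr_ge0 ?exprn_ge0 ?invr_ge0 ?exprn_ge0.
pose c := t^-1 + 1; have c0 : 0 <= c by rewrite addr_ge0// invr_ge0.
pose K3 := K + K' + K2 + (K' + c * K2).
have cK2 : 0 <= c * K2 by exact: mulr_ge0.
have KcK2 : 0 <= K' + c * K2 by exact: addr_ge0.
have KK2 : 0 <= K + K' + K2 by apply: addr_ge0 => //; exact: addr_ge0.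
have K30 : 0 <= K3 by exact: addr_ge0.
(* The last entry keeps the displacement within [dl]; the added 1 avoids a zero divisor. *)
pose e2 := Num.min (Num.min e1 e') (Num.min 1 (dl / (K' + 1))).
exists K3, e2; split=> //.
  by rewrite !lt_min e10 e'0 ltr01 divr_gt0// ltr_wpDl.
move=> qs eps; rewrite !lt_min => /andP[/andP[ee1 ee'] /andP[ee1' edl]].
have [phi [g [phiK phiS phiH gK gI]]] := hst qs eps ee1.
have [w [v [wK wS vK vE vI]]] := hstep' qs eps g ee' gK gI.
set e := `|eps| in ee1 ee' ee1' edl phiK gK gI wK vK vE vI *.
have e0 : 0 <= e by exact: normr_ge0.
have e1' := ltW ee1'.
have pw a b : (b <= a)%N -> e ^+ a <= e ^+ b by move=> h; rewrite ler_wiXn2l.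
have ese : e ^+ s <= e by rewrite -[leRHS]expr1; exact: pw.
have bdl : K' * e ^+ s <= dl.
  apply: (@le_trans _ _ ((K' + 1) * e)).
    by apply: ler_pM => //; [exact: exprn_ge0|rewrite lerDl].
  by move: edl; rewrite ltr_pdivlMr ?ltr_wpDl// mulrC => /ltW.
have b0 : 0 <= K' * e ^+ s by rewrite mulr_ge0// exprn_ge0.
have tdf : nle (t + dl) f Kf by apply: nle_le fK => //; exact: le_trans Ttau.
have tdg : nle (t + dl) g (K * e) by apply: nle_le gK.
have [r [rK rE]] := step_expand rd_gt0 t0' dl0 bdl tdf tdg wK vK vE.
(* Starting at order 1 is what makes quadratic errors gain an order. *)
have h2s : (s.+1 <= s * 2)%N by move: s0; clear; lia.
have i1 : SO * (K' * e ^+ s) ^+ 2 <= SO * K' ^+ 2 * e ^+ s.+1.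
  rewrite exprMn -exprM mulrA; apply: ler_wpM2l; last exact: pw.
  by apply: mulr_ge0 => //; exact: exprn_ge0.
have i2 : (K' * e ^+ s) ^+ 2 * (Kf / dl ^+ 2) <= K' ^+ 2 * (Kf / dl ^+ 2) * e ^+ s.+1.
  rewrite exprMn -exprM mulrAC; apply: ler_wpM2l; last exact: pw.
  by apply: mulr_ge0; [exact: exprn_ge0|apply: divr_ge0 => //; exact: exprn_ge0].
have i3 : K' * e ^+ s * (K * e / dl) = K' * (K / dl) * e ^+ s.+1.
  by rewrite exprSr; ring.
have {}rK : nle t r (K2 * e ^+ s.+1).
  apply: (nle_le rd_gt0 t0' (lexx t) _ (fun=> lexx _) rK).
  rewrite -/SO i3 /K2 mulrDl lerD2l !mulrDl lerD2r.
  exact: lerD.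
have cE : t^-1 + 1 = c by [].
have K3E : K3 = K + K' + K2 + (K' + c * K2) by [].
clearbody K3 c K2.
have wdl : exv t w dl by apply: exv_le wK.
have hw z : pdom t z -> pdom T (z + w z).
  by move=> hz; apply: pdom_le tT (exv_pdom rd_gt0 t0' wdl hz).
(* The new map acts first, so the old estimates are used on the larger polydisc [T]. *)
exists (fun z => w z + phi (z + w z)), (fun x => g x + v x + r x).
have tg : nle t g (K * e) by apply: nle_le gK => //; rewrite (le_trans _ tT)// lerDl.
have T0 : 0 <= T by exact: le_trans tT.
rewrite /state_at -/e; split.
- have : exv t (fun z => w z + phi (z + w z)) (K' * e ^+ s + K * e).
    apply: exv_add wK _ => i.
    have [a [aK _ aE]] := exP rd_gt0 T0 (phiK i).
    apply: (@eq_ex _ _ _ _ _ _ (fun z => tfeval a (z + w z))).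
      by move=> z hz; rewrite aE//; exact: hw.
    by apply: (ex_comp rd_gt0 t0' dl0' wdl); apply: nle_le aK.
  apply: (exv_le rd_gt0 t0' (lexx t)); rewrite K3E.
  have : K' * e ^+ s <= K' * e by rewrite ler_wpM2l.
  have : 0 <= K2 * e by rewrite mulr_ge0.
  have : 0 <= (K' + c * K2) * e by exact: mulr_ge0.
  by rewrite !mulrDl; lra.
- rewrite (_ : (fun z => _) = (fun z => z + phi z) \o (fun z => z + w z)).
    exact: (sympl_comp wS hw phiS).
  by apply/funext => y /=; rewrite addrA.
- by move=> z hz; rewrite addrA (phiH _ (hw z hz)) (rE z hz).
- have := nle_add (nle_add tg vK) rK; apply: nle_le => //.
  have h1 : K' * e ^+ s <= K' * e by rewrite ler_wpM2l.
  have h2 : K2 * e ^+ s.+1 <= K2 * e.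
    by rewrite ler_wpM2l// -[leRHS]expr1 pw.
  have : 0 <= (K' + c * K2) * e by exact: mulr_ge0.
  by rewrite K3E !mulrDl; lra.
- move=> j j6; have h1 := vI j j6; have h2 := item_nle qs j t0 rK.
  have := item_add t0 (nle_add tg vK) rK h1 h2; apply: item_le => //.
  rewrite cE mulrA; have h3 : c * K2 * e ^+ s.+1 <= c * K2 * e ^+ n' j.
    by rewrite ler_wpM2l// pw.
  have : 0 <= (K + K' + K2) * e ^+ n' j by apply: mulr_ge0 => //; exact: exprn_ge0.
  by rewrite K3E !mulrDl; lra.
Qed.

End NormalFormState.

(** * Removal of bad monomials by the homological equation *)

Section Stages.
Variables (R : realType) (d n2 : nat).
Local Notation C := R[i].
Local Notation Z := (phase R d.+1 n2).
Local Notation X := (tfindex d.+1 n2).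
Local Notation coordinate := (coordinate d.+1 n2).
Variables (omega : R) (Omega : 'I_n2 -> R).
Variable rd : coordinate -> R.
Hypothesis rd_gt0 : forall c, 0 < rd c.
Local Notation nle := (nle rd).
Local Notation ex := (ex rd).
Local Notation exv := (exv rd).
Local Notation pdom := (pdom rd).
Local Notation dlin := (@dlin R d n2 omega Omega).
Local Notation eigval := (@eigval R d n2 omega Omega).
Variables (f : X -> C) (Kf tau : R) (g0 : R -> X -> C).
Hypothesis fK : nle tau f Kf.
Hypothesis f_freq : forall x, f x != 0 -> forall c, xfreq c x = 0.
Hypothesis f_deg : forall x, f x != 0 -> (2 < xdeg x)%N.
Variable gam : R.
Hypothesis gam0 : 0 < gam.
Hypothesis hgam : forall x, bad x -> gam <= `|eigval x|.
Local Notation state := (@state R d n2 omega Omega rd f g0).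

(* Orders in eps of the items, once the first [j] of them have been improved
   from [s] to [s.+1]. *)
Definition level (s j : nat) : nat -> nat := fun i => if (i < j)%N then s.+1 else s.

Lemma dlin_ham t s chi B z : 0 <= t -> 0 < s -> nle (t + s) chi B -> pdom t z ->
  \sum_c dlin c z * tfeval (hamco chi c) z =
  tfeval (fun x => - ('i * (eigval x)%:C) * chi x) z.
Proof.
move=> t0 s0 h hz; apply/esym/hs_sum.
apply: (@eq_hs _ _ (fun x => \sum_c dlin c z * (csign R c * (chi x * dmono (cconj c) x z)))).
  move=> x; rewrite mulrAC -dlin_mono mulr_suml; apply: eq_bigr => c _.
  by ring.
apply: hs_bigsum => c _; apply: hs_mull.
rewrite (tfeval_scale rd_gt0 _ t0 (nle_dco rd_gt0 _ t0 s0 h) hz).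
by apply: hs_mull; exact: (hs_dmono rd_gt0 _ t0 s0 h hz).
Qed.

Lemma eigval_neq0 x : bad x -> 'i * (eigval x)%:C != 0.
Proof.
move=> /hgam h; apply/eqP => e; have := cmodM 'i (eigval x)%:C.
rewrite e cmod0 cmod_i mul1r cmod_real => e0; move: h.
by rewrite -e0 leNgt gam0.
Qed.

(** Shows that removing bad monomials of degree 2 does not touch the averages, as those monomials
    carry the fast angle. *)
Lemma bad_fast (x : X) : bad x -> (fast x != 0) || (2 < xdeg x)%N || (xdeg x == 1%N).
Proof.
rewrite /bad /xdeg; case: (fast x != 0) => //=; rewrite orbF.
by move=> /andP[/eqP -> l1]; case: (tf_l x) l1 => [|[|]].
Qed.

Let n_coord : R := #|{: coordinate}|%:R.

(** [f] has no angles and degree at least 3. In each term the two conjugate derivatives lower the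
    degree by 2 in all: 2 + 0 for an action and its angle, 1 + 1 for xi and eta. There remains 3 + l
    - 2. *)
Lemma ham_deg t s l chi B : 0 <= t -> 0 < s -> t + s <= tau ->
  nle (t + s) chi B -> (forall x, (xdeg x < l)%N -> chi x = 0) ->
  ex l.+1 t (fun z => \sum_c tfeval (dco c f) z * tfeval (hamco chi c) z)
    (n_coord * (Kf / s * (B / s))).
Proof.
move=> t0 s0 ts hB hl.
have ts0 : 0 <= t + s by rewrite addr_ge0// ltW.
have fts : nle (t + s) f Kf by apply: nle_le fK.
have f3 x : (xdeg x < 3)%N -> f x = 0.
  by move=> x3; apply/eqP/negPn/negP => /f_deg; rewrite ltnNge -ltnS x3.
rewrite /n_coord mulr_natl -sumr_const.
have h c : ex l.+1 t (fun z => tfeval (dco c f) z * tfeval (hamco chi c) z)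
    (Kf / s * (B / s)).
  have df := dco_deg (c := c) f3.
  have dh x : (xdeg x < l - (if is_angle (cconj c) then 0 else cdeg (cconj c)))%N ->
      hamco chi c x = 0.
    by move=> xl; rewrite /hamco (dco_deg hl xl) mulr0.
  have nf := nle_dco rd_gt0 c t0 s0 fts; have nh := nle_hamco rd_gt0 c t0 s0 hB.
  have e1 := ex_tfeval rd_gt0 t0 nf df; have e2 := ex_tfeval rd_gt0 t0 nh dh.
  case ca: (is_angle c) e1 e2 => e1 e2.
    apply: (@eq_ex _ _ _ _ _ _ (fun=> 0)); last first.
      by apply: ex_leM (ex_zero rd l.+1 t0) => //; rewrite mulr_ge0 ?(ex_ge0 e1) ?(ex_ge0 e2).
    move=> z hz; rewrite (_ : tfeval _ z = 0) ?mul0r//.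
    apply: hs_sum; apply: hs0 => x; rewrite /dco ca.
    have [->|/f_freq ->] := eqVneq (f x) 0; first by rewrite mulr0 mul0r.
    by rewrite mulr0z mulr0 !mul0r.
  apply: (ex_le rd_gt0 _ t0 (lexx t) (lexx _) (ex_mul rd_gt0 t0 e1 e2)).
  by case: (c) ca => [[i|i]|[i|i]] //= _; lia.
exact: (ex_sum (index_enum _) (P := xpredT) t0 (fun c _ => h c)).
Qed.

Lemma le_add4 (a b c e : R) : 0 <= a -> 0 <= b -> 0 <= c -> 0 <= e ->
  [/\ a <= a + b + c + e, b <= a + b + c + e, c <= a + b + c + e & e <= a + b + c + e].
Proof. by move=> *; split; lra. Qed.

(** Dividing [proj l g] by the eigenvalues solves the homological equation with loss [gam^-1]. The
    bracket with [f] lands strictly above degree [l], so it can only disturb items that are still to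
    be treated. *)
Lemma chi_step s j t T : (0 < s)%N -> (j < 6)%N -> j != 2%N -> 0 < t -> t < T ->
  T <= tau -> state (level s j) T -> state (level s j.+1) t.
Proof.
move=> s0 j6 j2 t0 tT Ttau hst; have t0' := ltW t0.
(* [midpoint] consumes four losses of radius. *)
pose dl := (T - t) / 4.
have dl0 : 0 < dl by rewrite divr_gt0// subr_gt0.
have TE : t + dl + dl + dl + dl = T by rewrite /dl; field.
have dl0' := ltW dl0.
have tdT : t + dl <= T by rewrite -TE -!addrA lerD2l lerDl !addr_ge0.
have T0 : 0 <= T by exact: le_trans (ltW tT).
have tau0 : 0 <= tau by exact: le_trans Ttau.
have [Kd Kd0 hKd] := ex_dlin omega Omega rd_gt0 tau0.
have Kf0 : 0 <= Kf by exact: absb_ge0 fK.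
have nc0 : 0 <= n_coord by exact: ler0n.
apply: (state_step rd_gt0 fK t0 dl0 tdT Ttau s0 _ hst) => [i|K K0].
  by rewrite /level; case: ifP.
pose l := ldeg j.
pose Kb := K / gam.
have Kb0 : 0 <= Kb by rewrite divr_ge0// ltW.
pose Kw := 2 * Kb / dl; have Kw0 : 0 <= Kw by rewrite divr_ge0// mulr_ge0.
pose Kv := K + n_coord * (Kf / dl * (Kb / dl)).
have Kv0 : 0 <= Kv.
  by apply: addr_ge0 => //; do 2![apply: mulr_ge0 => //]; exact: divr_ge0.
pose er := Kb ^+ 2 / dl ^+ 3.
have er0 : 0 <= er by apply: divr_ge0; exact: exprn_ge0.
pose Kr := n_coord * (Kd * er) + n_coord * (Kf / dl * er).
have Kr0 : 0 <= Kr.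
  by apply: addr_ge0; apply: mulr_ge0 => //; apply: mulr_ge0 => //; exact: divr_ge0.
pose ct := t^-1 + 1; have ct0 : 0 <= ct by apply: addr_ge0 => //; rewrite invr_ge0.
pose Ki := K + ct * Kv; have Ki0 : 0 <= Ki by apply: addr_ge0 => //; exact: mulr_ge0.
pose K' := Kw + Kv + Kr + Ki.
have [KwK KvK KrK KiK] : [/\ Kw <= K', Kv <= K', Kr <= K' & Ki <= K'].
  exact: le_add4.
have K'0 : 0 <= K' by exact: le_trans KwK.
clearbody K'.
(* Ensures the smallness [B <= dl ^+ 2] asked by [midpoint]. *)
pose e' := Num.min 1 (dl ^+ 2 / (Kb + 1)).
exists K', e'; split=> //.
  by rewrite lt_min ltr01 divr_gt0 ?exprn_gt0// ltr_wpDl.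
move=> qs eps g; rewrite lt_min => /andP[e1 edl].
set e := `|eps| in e1 edl *; move=> gK gI.
have e0 : 0 <= e by exact: normr_ge0.
have pw a b : (b <= a)%N -> e ^+ a <= e ^+ b by move=> h; rewrite ler_wiXn2l// ltW.
have es0 : 0 <= e ^+ s by exact: exprn_ge0.
have ess0 : 0 <= e ^+ s.+1 by exact: exprn_ge0.
have ese : e ^+ s <= e by rewrite -[leRHS]expr1; exact: pw.
have gj : nle T (proj l g) (K * e ^+ s).
  by have := gI j j6; rewrite /item (negbTE j2) /level ltnn.
pose chi x := ('i * (eigval x)%:C)^-1 * proj l g x.
pose B := Kb * e ^+ s.
have chiB : nle T chi B.
  have h := nle_scale (gam^-1)%:C gj.
  rewrite cmod_real ger0_norm ?invr_ge0 ?(ltW gam0)// in h.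
  apply: (nle_le rd_gt0 T0 (lexx T) _ _ h); first by rewrite /B /Kb mulrA (mulrC gam^-1).
  move=> x; rewrite /chi /proj; case: ifP => [/andP[bx _]|_]; last by rewrite !mulr0.
  rewrite [leLHS]cmodM [leRHS]cmodM ler_wpM2r ?cmod_ge0// cmodV cmodM cmod_i mul1r.
  rewrite !cmod_real [leRHS]ger0_norm ?invr_ge0 ?(ltW gam0)//.
  by rewrite lef_pV2 ?posrE ?hgam// (lt_le_trans gam0)// hgam.
have B0 : 0 <= B by exact: mulr_ge0.
have Bdl : B <= dl ^+ 2.
  apply: (@le_trans _ _ ((Kb + 1) * e)).
    by apply: ler_pM => //; rewrite lerDl.
  by move: edl; rewrite ltr_pdivlMr ?ltr_wpDl// mulrC => /ltW.
have chiB' : nle (t + dl + dl + dl + dl) chi B by rewrite TE.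
have [w [wB wS wX]] := midpoint rd_gt0 t0' dl0 B0 Bdl chiB'.
have chitd : nle (t + dl) chi B by apply: nle_le chiB => //; exact: addr_ge0.
have chil x : (xdeg x < l)%N -> chi x = 0.
  by move=> xl; rewrite /chi /proj (ltn_eqF xl) andbF mulr0.
have hT := ham_deg t0' dl0 (le_trans tdT Ttau) chitd chil.
have [Tc [TcK Tcd TcE]] := exP rd_gt0 t0' hT.
(* First order effect of the map: the linear part yields the cancelling term, and [f] yields
   [Tc]. *)
pose v x := - proj l g x + Tc x.
have tpg : nle t (proj l g) (K * e ^+ s) by apply: nle_le gj => //; exact: ltW.
have tpgN : nle t (fun x => - proj l g x) (K * e ^+ s).
  by apply: nle_le tpg => // x; rewrite cmodN.
have vK : nle t v (Kv * e ^+ s).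
  apply: nle_le (nle_add tpgN TcK) => //.
  by rewrite /Kv /B le_eqVlt; apply/orP; left; apply/eqP; ring.
have tg : nle t g (K * e) by apply: nle_le gK => //; exact: ltW.
have B2 : B ^+ 2 / dl ^+ 3 <= er * e ^+ s.+1.
  rewrite /B /er exprMn -exprM mulrAC ler_wpM2l// pw//.
  by move: s0; clear; lia.
(* [ldeg 3] is 2: in the steps after the translation [v] has no slow monomial of degree at most 2,
   so the averages already made small are unchanged. *)
have vfast x : v x != 0 -> (ldeg 3 <= l)%N -> (fast x != 0) || (2 < xdeg x)%N.
  move=> vx l2; have [h2|h2] := ltnP 2 (xdeg x); first by rewrite orbT.
  rewrite orbF; move: vx; rewrite /v Tcd ?addr0; last first.
    by move: h2 l2; rewrite /ldeg /=; clear; lia.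
  rewrite oppr_eq0 /proj; case: ifP => [/andP[bx /eqP xl] _|_]; last by rewrite eqxx.
  have l1 : (l == 1%N) = false by move: l2; case: (l) => [|[|]].
  by have := bad_fast bx; rewrite ltnNge h2 orbF xl l1 orbF.
exists w, v; split.
- have tt : t <= t + dl by rewrite lerDl.
  apply: (exv_le rd_gt0 t0' tt _ wB).
  rewrite /B (_ : 2 * (Kb * e ^+ s) / dl = Kw * e ^+ s); last by rewrite /Kw; ring.
  by rewrite ler_wpM2r.
- exact: wS.
- by apply: (nle_le rd_gt0 t0' (lexx t) _ (fun=> lexx _) vK); rewrite ler_wpM2r.
(* Deviation of the midpoint map from the Hamiltonian field: quadratic in [chi], hence of order at
   least [s.+1]. *)
- pose r z := w z - mkphase (fun c => tfeval (hamco chi c) z).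
  have rB : exv t r (B ^+ 2 / dl ^+ 3).
    by move=> c; apply: eq_ex (wX c) => z _; rewrite /r coordB coord_mkphase.
  have hd c : ex 0 t (dlin c) Kd.
    by apply: hKd => //; exact: le_trans (ltW tT) Ttau.
  have ftd : nle (t + dl) f Kf.
    by apply: nle_le fK => //; [exact: addr_ge0|exact: le_trans Ttau].
  have := ex_add (ex_dlin_sum rd_gt0 t0' hd rB) (ex_gradient rd_gt0 t0' dl0 ftd rB).
  move=> h; apply: (ex_leM rd_gt0 t0' _ (eq_ex _ h)).
    have i1 : n_coord * (Kd * (B ^+ 2 / dl ^+ 3)) <= n_coord * (Kd * (er * e ^+ s.+1)).
      by do 2![apply: ler_wpM2l => //].
    have i2 : n_coord * (Kf / dl * (B ^+ 2 / dl ^+ 3)) <= n_coord * (Kf / dl * (er * e ^+ s.+1)).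
      by do 2![apply: ler_wpM2l => //]; exact: divr_ge0.
    apply: le_trans (lerD i1 i2) _.
    rewrite (_ : _ + _ = Kr * e ^+ s.+1); first by rewrite ler_wpM2r.
    by rewrite /Kr; ring.
  move=> z hz.
  have -> : tfeval v z = - tfeval (proj l g) z + tfeval Tc z.
    rewrite (tfeval_add rd_gt0 t0' tpgN TcK hz); congr (_ + _).
    have := tfeval_scale rd_gt0 (-1) t0' tpg hz; rewrite mulN1r => <-.
    by congr (tfeval _ z); apply/funext => x; rewrite mulN1r.
  have dh : \sum_c dlin c z * tfeval (hamco chi c) z = - tfeval (proj l g) z.
    rewrite (dlin_ham t0' dl0 chitd hz).
    have := tfeval_scale rd_gt0 (-1) t0' tpg hz; rewrite mulN1r => <-.
    congr (tfeval _ z); apply/funext => x; rewrite /chi /proj.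
    case: ifP => [/andP[bx _]|_]; last by rewrite !mulr0.
    by rewrite mulNr mulrA mulfV ?mulN1r ?mul1r// eigval_neq0.
  rewrite -TcE// -dh opprD addrACA -!sumrB.
  by congr (_ + _); apply: eq_bigr => c _; rewrite /r coordB coord_mkphase mulrBr.
- move=> i i6; rewrite /level ltnS; have gi := gI i i6; rewrite /level in gi.
  have tgi := item_le rd_gt0 t0' (ltW tT) (lexx _) gi.
  (* Items before [j] are untouched by [v], items after it need only keep order [s], and item [j] is
     cancelled exactly at first order. *)
  case: (ltngtP i j) => ij.
  + rewrite ij in tgi.
    suff : item rd qs t i (fun x => g x + v x) (K * e ^+ s.+1).
      apply: item_le => //; rewrite ler_wpM2r// (le_trans _ KiK)// lerDl.
      exact: mulr_ge0.
    move: tgi; rewrite /item; case: eqP => [i2|/eqP i2].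
      move=> tgi k; rewrite (av_add rd_gt0 qs k t0 tg vK) [X in _ + X]av0 ?addr0//.
      move=> x vx; apply: vfast => //; rewrite /l /ldeg.
      by move: ij j2; rewrite i2; clear; case: j => [|[|[|[]]]].
    rewrite projD (_ : proj (ldeg i) v = fun=> 0).
      by under eq_fun do rewrite addr0.
    have li : (ldeg i < l)%N.
      by move: ij i2 j2; rewrite /l /ldeg; clear; case: i => [|[|[|]]]; case: j => [|[|[|]]] //=; lia.
    apply/funext => x; rewrite {1}/proj; case: ifP => // /andP[_ /eqP xl].
    by rewrite /v /proj xl (ltn_eqF li) andbF oppr0 add0r Tcd// xl ltnS ltnW.
  + rewrite ltnNge (ltnW ij) /= in tgi.
    have iv := item_nle rd_gt0 qs i t0 vK.
    have := item_add rd_gt0 t0 tg vK tgi iv; apply: item_le => //.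
    by rewrite -/ct mulrA -mulrDl ler_wpM2r.
  + rewrite ij /item (negbTE j2).
    rewrite projD (_ : (fun x => _) = fun=> 0).
      by apply: (nle_le rd_gt0 t0' (lexx t) _ (fun=> lexx _) (nle0 rd t)); exact: mulr_ge0.
    apply/funext => x; rewrite {1 2}/proj; case: ifP => [/andP[bx /eqP xl]|]; rewrite ?addr0//.
    by rewrite /v /proj bx xl eqxx Tcd ?addr0 ?subrr// xl.
Qed.

End Stages.

(** * Translation of the actions and iteration of the rounds *)

Section ZetaStage.
Variables (R : realType) (d n2 : nat).
Local Notation C := R[i].
Local Notation Z := (phase R d.+1 n2).
Local Notation X := (tfindex d.+1 n2).
Local Notation coordinate := (coordinate d.+1 n2).
Local Notation cp i := (inl (inl i) : coordinate).
Variables (omega : R) (Omega : 'I_n2 -> R).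
Variable rd : coordinate -> R.
Hypothesis rd_gt0 : forall c, 0 < rd c.
Local Notation nle := (nle rd).
Local Notation ex := (ex rd).
Local Notation exv := (exv rd).
Local Notation pdom := (pdom rd).
Local Notation dlin := (@dlin R d n2 omega Omega).
Local Notation x0 := (x0 d.+1 n2).
Variables (f : X -> C) (Kf tau : R) (g0 : R -> X -> C).
Hypothesis fK : nle tau f Kf.
Hypothesis f_freq : forall x, f x != 0 -> forall c, xfreq c x = 0.
Hypothesis f_deg : forall x, f x != 0 -> (2 < xdeg x)%N.
Hypothesis f_unc : forall x, f x != 0 -> tf_l x = 0%N \/ tf_m x = 0%N.

(** The Hessian at the origin read off the coefficients: for a series without angles, only the
    constant coefficient of the second derivative counts there. *)
Definition hess (i j : 'I_d.+1) : C := dco (cp i) (dco (cp j) f) x0.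

Variable Ci : 'I_d.+1 -> 'I_d.+1 -> C.
Hypothesis hCi : forall a i, \sum_j hess i j * (\sum_k Ci j k * a k) = a i.

Local Notation state := (@state R d n2 omega Omega rd f g0).

Lemma sympl_translation t (w : Z) : sympl rd t (fun z => z + w).
Proof.
move=> z _; have [df jf] : differentiable (fun z : Z => z + w) z /\
    jacobian (fun z : Z => z + w) z = 1%:M.
  apply: (quadratic_differential (d := 1) (K := 0)) => // h r _ _ k.
  rewrite mulmx1 mul0r (_ : (z + h + w - (z + w) - h) 0 k = 0) ?cmod0//.
  by rewrite !mxE; ring.
by split=> //; rewrite jf mul1mx trmx1 mulmx1.
Qed.

Lemma nle_single t y (v : C) : 0 <= t ->
  nle t (fun x => if x == y then v else 0) (cmod v * weight rd t y).
Proof.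
move=> t0; have w0 : 0 <= weight rd t y by exact: weight_ge0.
move=> A; apply: (@le_trans _ _ (\sum_(x <- [fset y]%fset) cmod v * weight rd t y)); last first.
  by rewrite big_seq_fset1.
rewrite (big_fsetID _ [pred x | x == y]) /= [X in _ + X]big1_fset ?addr0; last first.
  by move=> x; rewrite !inE /= => /andP[_ /negbTE ->]; rewrite mul0r cmod0.
rewrite big_seq (eq_bigr (fun=> cmod v * weight rd t y)); last first.
  by move=> x; rewrite !inE /= => /andP[_ /eqP ->]; rewrite eqxx cmodM cmod_real ger0_norm.
rewrite -big_seq; apply: ler_sum_fsub; last by move=> _; rewrite mulr_ge0 ?cmod_ge0.
by apply/fsubsetP => x; rewrite !inE /= => /andP[].
Qed.

Lemma nle_sum (I : Type) (s : seq I) t (a : I -> X -> C) (M : I -> R) :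
  (forall i, nle t (a i) (M i)) ->
  nle t (fun x => \sum_(i <- s) a i x) (\sum_(i <- s) M i).
Proof.
move=> h; elim: s => [|i s ih].
  rewrite big_nil (_ : (fun x => _) = fun=> 0); first exact: nle0.
  by apply/funext => x; rewrite big_nil.
rewrite big_cons (_ : (fun x => _) = fun x => a i x + \sum_(j <- s) a j x).
  exact: nle_add.
by apply/funext => x; rewrite big_cons.
Qed.

Lemma tfeval_sum (I : Type) (s : seq I) t (a : I -> X -> C) (M : I -> R) z :
  0 <= t -> (forall i, nle t (a i) (M i)) -> pdom t z ->
  tfeval (fun x => \sum_(i <- s) a i x) z = \sum_(i <- s) tfeval (a i) z.
Proof.
move=> t0 h hz; apply: hs_sum.
apply: eq_hs (hs_bigsum (P := xpredT) s (fun i _ => nle_hs rd_gt0 t0 (h i) hz)) => x.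
by rewrite mulr_suml.
Qed.

Lemma tfeval_at_x0 (a : X -> C) z :
  (forall x, x != x0 -> a x * tfmono x z = 0) -> tfeval a z = a x0.
Proof.
move=> h; apply: hs_sum.
have := @hs_fin _ _ (fun x => a x * tfmono x z) [fset x0]%fset.
rewrite big_seq_fset1 tfmono0 mulr1; apply => x; rewrite inE.
exact: h.
Qed.

Lemma tf_l_add (x y : X) : tf_l (xadd x y) = (tf_l x + tf_l y)%N.
Proof.
rewrite /tf_l /mlen -big_split; apply: eq_bigr => i _.
exact: (xexp_add (cp i)).
Qed.

Lemma tf_m_add (x y : X) : tf_m (xadd x y) = (tf_m x + tf_m y)%N.
Proof.
rewrite /tf_m /mlen -!big_split; apply: eq_bigr => j _ /=.
rewrite addnACA; congr (_ + _)%N.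
  exact: (xexp_add (inr (inl j))).
exact: (xexp_add (inr (inr j))).
Qed.

Lemma tf_l_unit i : tf_l (xunit (cp i)) = 1%N.
Proof.
have h j : ix_i (xunit (cp i)) j = (j == i).
  exact: (xexp_unit (cp i) (cp j)).
rewrite /tf_l /mlen (bigD1 i)//= big1 => [|j hj].
  by rewrite h eqxx.
by rewrite h (negbTE hj).
Qed.

Lemma tf_m_unit i : tf_m (xunit (cp i)) = 0%N.
Proof.
rewrite /tf_m /mlen big1// => j _.
exact: (xexp_unit (cp i) (inr (inl j))).
Qed.

(** [f] does not couple actions with xi, eta, so its derivative in an action is a function of the
    actions alone. *)
Lemma dco_f_neq0 i x : dco (cp i) f x != 0 ->
  (forall c, xfreq c x = 0) /\ tf_m x = 0%N.
Proof.
rewrite /dco /= mulf_eq0 negb_or => /andP[_ h]; split.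
  by move=> c; have := f_freq h c; rewrite xfreq_add xfreq_unit addr0.
have := f_unc h; rewrite tf_l_add tf_l_unit tf_m_add tf_m_unit addn0.
by rewrite addn1 => -[].
Qed.

Lemma eq_x0 (x : X) : xdeg x = 0%N -> (forall c, xfreq c x = 0) -> x = x0.
Proof.
move=> dx fx; apply: index_ext => c; last first.
  by rewrite fx /x0 xfreq_mk; case: ifP.
rewrite /x0 xexp_mk; case ca: (is_angle c); first by rewrite xexp_angle.
move/eqP: dx; rewrite xdegE sum_nat_eq0 => /forallP/(_ c) /=.
by rewrite muln_eq0 => /orP[|/eqP//]; case: c ca => [[]|].
Qed.

(** Translating the actions by zeta adds to the coefficients of p, through [f], the Hessian applied
    to zeta; zeta is chosen to oppose the averages. All that is added depends on the actions only,
    so no bad monomial appears and the other items keep their order. *)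
Lemma zeta_step s t T : (0 < s)%N -> 0 < t -> t < T -> T <= tau ->
  state (level s 2) T -> state (level s 3) t.
Proof.
move=> s0 t0 tT Ttau hst; have t0' := ltW t0.
pose dl := T - t; have dl0 : 0 < dl by rewrite subr_gt0.
have TE : t + dl = T by rewrite /dl addrC subrK.
have tdT : t + dl <= T by rewrite TE.
have T0 : 0 <= T by exact: le_trans (ltW tT).
have Kf0 : 0 <= Kf by exact: absb_ge0 fK.
apply: (state_step rd_gt0 fK t0 dl0 tdT Ttau s0 _ hst) => [i|K K0].
  by rewrite /level; case: ifP.
pose KC := \sum_j \sum_k cmod (Ci j k).
have KC0 : 0 <= KC by do 2![apply: sumr_ge0 => ? _]; exact: cmod_ge0.
pose Kz := KC * K; have Kz0 : 0 <= Kz by exact: mulr_ge0.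
pose Kv := \sum_(i : 'I_d.+1) Kz * (Kf / dl) + `|omega| * Kz.
have Kv0 : 0 <= Kv.
  apply: addr_ge0; last exact: mulr_ge0.
  by apply: sumr_ge0 => i _; apply: mulr_ge0 => //; apply: divr_ge0 => //; exact: ltW.
pose ct := t^-1 + 1; have ct0 : 0 <= ct by apply: addr_ge0 => //; rewrite invr_ge0.
pose Ki := K + ct * Kv; have Ki0 : 0 <= Ki by apply: addr_ge0 => //; exact: mulr_ge0.
pose K' := Kz + Kv + 0 + Ki.
have [KzK KvK _ KiK] : [/\ Kz <= K', Kv <= K', 0 <= K' & Ki <= K'].
  exact: le_add4.
have K'0 : 0 <= K' by exact: le_trans KzK.
clearbody K'.
exists K', 1; split=> // qs eps g e1; set e := `|eps| in e1 *; move=> gK gI.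
have e0 : 0 <= e by exact: normr_ge0.
have pw a b : (b <= a)%N -> e ^+ a <= e ^+ b by move=> h; rewrite ler_wiXn2l// ltW.
have es0 : 0 <= e ^+ s by exact: exprn_ge0.
have ess0 : 0 <= e ^+ s.+1 by exact: exprn_ge0.
have aK i : cmod (av qs i g) <= K * e ^+ s by exact: (gI 2%N isT).
pose zeta j := - \sum_k Ci j k * av qs k g.
have zK j : cmod (zeta j) <= Kz * e ^+ s.
  have jKC : \sum_k cmod (Ci j k) <= KC.
    rewrite /KC [leRHS](bigD1 j)//= lerDl.
    by do 2![apply: sumr_ge0 => ? _]; exact: cmod_ge0.
  rewrite /zeta cmodN; apply: le_trans (cmod_sum _ _ _) _.
  apply: (@le_trans _ _ ((\sum_k cmod (Ci j k)) * (K * e ^+ s))).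
    rewrite mulr_suml; apply: ler_sum => k _; rewrite cmodM.
    by rewrite ler_wpM2l ?cmod_ge0.
  by rewrite /Kz -mulrA ler_wpM2r//; exact: mulr_ge0.
pose w : Z := mkphase (fun c => if c is inl (inl j) then zeta j else 0).
have wK c : cmod (coord c w) <= Kz * e ^+ s.
  rewrite coord_mkphase; have h0 : cmod (0 : C) <= Kz * e ^+ s.
    by rewrite cmod0; exact: mulr_ge0.
  by case: c => [[j|j]|c].
have fdl : nle (t + dl) f Kf by apply: nle_le fK => //; rewrite TE.
(* [v1] is the first order change of [f]; [v2] below is the constant that the term omega p_1
   produces. *)
pose v1 x := \sum_j zeta j * dco (cp j) f x.
pose v2 x : C := if x == x0 then omega%:C * zeta ord0 else 0.
pose v x := v1 x + v2 x.
have v1K : nle t v1 (\sum_(i : 'I_d.+1) Kz * e ^+ s * (Kf / dl)).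
  apply: nle_sum => j.
  have h := nle_scale (zeta j) (nle_dco rd_gt0 (cp j) t0' dl0 fdl).
  apply: (nle_le rd_gt0 t0' (lexx t) _ (fun=> lexx _) h).
  by rewrite ler_wpM2r// divr_ge0// ltW.
have v2K : nle t v2 (`|omega| * (Kz * e ^+ s)).
  apply: (nle_le rd_gt0 t0' (lexx t) _ (fun=> lexx _) (nle_single _ _ t0')).
  by rewrite weight0 mulr1 cmodM cmod_real ler_wpM2l.
have vK : nle t v (Kv * e ^+ s).
  apply: (nle_le rd_gt0 t0' (lexx t) _ (fun=> lexx _) (nle_add v1K v2K)).
  rewrite /Kv [leRHS]mulrDl; apply: lerD; last by rewrite mulrA.
  rewrite mulr_suml; apply: ler_sum => i _.
  by rewrite le_eqVlt; apply/orP; left; apply/eqP; ring.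
have tg : nle t g (K * e) by apply: nle_le gK => //; exact: ltW.
have v_supp x : v x != 0 -> (forall c, xfreq c x = 0) /\ tf_m x = 0%N.
  rewrite /v /v2; case: (eqVneq x x0) => [->|_].
    move=> _; split; first by move=> c; rewrite /x0 xfreq_mk; case: ifP.
    by have := xdeg0 d.+1 n2; rewrite /xdeg => /eqP; rewrite addn_eq0 => /andP[_ /eqP].
  rewrite addr0 => h; have [j hj] : exists j, dco (cp j) f x != 0.
    apply: contrapT => hn; move: h; rewrite /v1 big1 ?eqxx// => j _.
    apply/eqP; rewrite mulf_eq0; apply/orP; right; apply/negPn/negP => hj.
    by apply: hn; exists j.
  exact: dco_f_neq0 hj.
have v_proj l : proj l v = fun=> 0.
  apply/funext => x; rewrite /proj; case: ifP => // /andP[bx _].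
  apply/eqP/negPn/negP => /v_supp[h1 h2]; move: bx.
  by rewrite /bad /fast h1 h2 eqxx.
have vE z : pdom t z -> tfeval v z = \sum_c dlin c z * coord c w +
    \sum_c tfeval (dco c f) z * coord c w.
  move=> hz; rewrite /v (tfeval_add rd_gt0 t0' v1K v2K hz).
  rewrite [LHS]addrC; congr (_ + _).
    rewrite (sum_dlin omega Omega (fun c => coord c w) z) !coord_mkphase.
    rewrite big1 ?addr0; last by move=> j _; rewrite !coord_mkphase !mulr0 addr0 mulr0.
    rewrite tfeval_at_x0 /v2 ?eqxx// => x /negbTE ->.
    by rewrite mul0r.
  have hj j : nle t (fun x => zeta j * dco (cp j) f x) (cmod (zeta j) * (Kf / dl)).
    exact: (nle_scale (zeta j) (nle_dco rd_gt0 (cp j) t0' dl0 fdl)).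
  rewrite /v1 (tfeval_sum _ t0' hj hz) sum_coordinate.
  rewrite [X in _ = _ + X + _]big1; last by move=> j _; rewrite coord_mkphase mulr0.
  rewrite [X in _ = _ + (X + _)]big1; last by move=> j _; rewrite coord_mkphase mulr0.
  rewrite [X in _ = _ + (_ + X)]big1; last by move=> j _; rewrite coord_mkphase mulr0.
  rewrite !addr0; apply: eq_bigr => j _.
  rewrite (tfeval_scale rd_gt0 _ t0' (nle_dco rd_gt0 (cp j) t0' dl0 fdl) hz).
  by rewrite coord_mkphase mulrC.
(* Since [v] has no angles, its derivative at [zstar] is one coefficient, the Hessian applied to
   [zeta]; [hCi] evaluates it. *)
have v_av i : av qs i v = - av qs i g.
  rewrite -(hCi (fun k => - av qs k g) i) /av tfeval_at_x0; last first.
    move=> x xx0; have [xd|/tfmono_zstar ->] := posnP (xdeg x); last by rewrite mulr0.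
    rewrite /dco /= (_ : slowpart v _ = 0) ?mulr0 ?mul0r//.
    rewrite /slowpart; case: ifP => // _; apply/eqP/negPn/negP => /v_supp[h1 _].
    case/eqP: xx0; apply: eq_x0 => // c; have := h1 c.
    by rewrite xfreq_add xfreq_unit addr0.
  have x0i : xadd x0 (xunit (cp i)) != x0.
    apply/eqP => /(congr1 (@xdeg _ _)); rewrite xdeg_add xdeg_unit//.
    by rewrite xdeg0.
  rewrite /dco /= /slowpart /fast xfreq_add xfreq_unit addr0.
  rewrite (_ : xfreq _ x0 = 0) ?eqxx; last by rewrite /x0 xfreq_mk.
  rewrite /v /v2 (negbTE x0i) addr0 /v1 mulr_sumr; apply: eq_bigr => j _.
  rewrite mulrCA mulrC; congr (_ * _).
  by rewrite /zeta -sumrN; apply: eq_bigr => k _; rewrite mulrN.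
exists (fun=> w), v; split.
- by apply: (exv_le rd_gt0 t0' (lexx t) _ (exv_cst rd_gt0 t0' wK)); rewrite ler_wpM2r.
- exact: sympl_translation.
- by apply: (nle_le rd_gt0 t0' (lexx t) _ (fun=> lexx _) vK); rewrite ler_wpM2r.
(* For a constant displacement [v] is the exact first order effect, so the error is zero. *)
- apply: (@eq_ex _ _ _ _ _ _ (fun=> 0)); first by move=> z hz; rewrite vE// subrr.
  by apply: (ex_leM rd_gt0 t0' _ (ex_zero rd 0 t0')); exact: mulr_ge0.
- move=> i i6; have gi := gI i i6.
  have tgi := item_le rd_gt0 t0' (ltW tT) (lexx _) gi.
  case: (eqVneq i 2%N) => [i2|i2].
    rewrite i2 /item /= => k; rewrite (av_add rd_gt0 qs k t0 tg vK) v_av subrr cmod0.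
    by apply: mulr_ge0.
  move: tgi; rewrite /item (negbTE i2) projD v_proj.
  under eq_fun do rewrite addr0.
  have -> : level s 3 i = level s 2 i.
    by move: i2; rewrite /level; case: i {i6 gi} => [|[|[|]]].
  apply: (nle_le rd_gt0 t0' (lexx t)) => //; rewrite ler_wpM2r ?exprn_ge0//.
  by rewrite (le_trans _ KiK)// lerDl mulr_ge0.
Qed.

Variable gam : R.
Hypothesis gam0 : 0 < gam.
Hypothesis hgam : forall x, bad x -> gam <= `|@eigval R d n2 omega Omega x|.

Lemma eq_state n n' t : (forall j, (j < 6)%N -> n j = n' j) -> state n t -> state n' t.
Proof.
move=> nn [K [e1 [h1 h2 h3]]]; exists K, e1; split=> // qs eps he.
have [phi [g [g1 g2 g3 g4 g5]]] := h3 qs eps he.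
by exists phi, g; split=> // j j6; rewrite -nn//; exact: g5.
Qed.

(** Quantifying over all [t < tau] inside the induction leaves room for the radius losses of any
    number of steps. *)
Lemma normalization r : (0 < r)%N -> (forall t, 0 < t -> t < tau -> state (level 1 0) t) ->
  forall t, 0 < t -> t < tau -> state (level r 0) t.
Proof.
move=> r0 h1.
have step s : (0 < s)%N -> (forall t, 0 < t -> t < tau -> state (level s 0) t) ->
    forall j, (j <= 6)%N -> forall t, 0 < t -> t < tau -> state (level s j) t.
  move=> s0 h; elim=> [_|j ih j6] t t0 tt; first exact: h.
  (* Half of the remaining gap is spent on this step, the other half is left for the earlier
     ones. *)
  pose T := (t + tau) / 2.
  have tT : t < T by rewrite /T; lra.
  have TT : T < tau by rewrite /T; lra.
  have T0 : 0 < T by exact: lt_trans tT.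
  have hT := ih (ltnW j6) T T0 TT.
  have [j2|j2] := eqVneq j 2%N.
    by rewrite j2 in hT *; exact: (zeta_step s0 t0 tT (ltW TT) hT).
  exact: (chi_step rd_gt0 fK f_freq f_deg gam0 hgam s0 j6 j2 t0 tT (ltW TT) hT).
case: r r0 => // r _; elim: r => [|r ih] //.
move=> t t0 tt; have := step r.+1 isT ih 6%N isT t t0 tt.
(* The two order functions agree only on the six genuine items, whence [eq_state]. *)
by apply: eq_state => j j6; rewrite /level j6.
Qed.

End ZetaStage.

(** * Constants provided by the hypotheses *)

Section FullNorm.
Variables (R : realType) (n1 n2 : nat).
Local Notation C := R[i].
Local Notation Z := (phase R n1 n2).
Local Notation X := (tfindex n1 n2).
Local Notation coordinate := (coordinate n1 n2).

Definition radii (r0 r1 r2 : R) (c : coordinate) : R :=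
  match c with inl (inl _) => r0 | inl (inr _) => r1 | inr _ => r2 end.

Lemma prod_cweight r0 r1 r2 (x : X) : \prod_c cweight c x (radii r0 r1 r2 c) =
  r0 ^+ tf_l x * r2 ^+ tf_m x * expR ((klen (ix_k x))%:R * r1).
Proof.
have -> : expR ((klen (ix_k x))%:R * r1) =
    \prod_i cweight (inl (inr i)) x (radii r0 r1 r2 (inl (inr i))).
  by rewrite /klen natr_sum mulr_suml expR_sum.
rewrite prod_coordinate /tf_l /tf_m /mlen exprD -!prodrXr.
by rewrite mulrAC.
Qed.

(** Both sides bound the same nonnegative finite sums, of which [\esum] is the supremum. *)
Lemma tfnormP r0 r1 r2 (a : X -> C) M : 0 <= r0 -> 0 <= r2 ->
  (tfnorm r0 r1 r2 a <= M%:E)%E <->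
  absb (fun x => a x * (\prod_c cweight c x (radii r0 r1 r2 c))%:C) M.
Proof.
move=> r00 r20; pose w x := cmod (a x) * r0 ^+ tf_l x * r2 ^+ tf_m x *
  expR ((klen (ix_k x))%:R * r1).
have w0 x : 0 <= w x.
  rewrite /w; apply: mulr_ge0; last exact: expR_ge0.
  by do 2!(apply: mulr_ge0; last exact: exprn_ge0); exact: cmod_ge0.
have wE x : cmod (a x * (\prod_c cweight c x (radii r0 r1 r2 c))%:C) = w x.
  rewrite cmodM cmod_real prod_cweight ger0_norm /w ?mulrA//.
  by apply: mulr_ge0; [apply: mulr_ge0; exact: exprn_ge0|exact: expR_ge0].
split=> h.
  move=> A; under eq_bigr do rewrite wE.
  rewrite -lee_fin; apply: le_trans h; apply: esum_ge; exists [set` A].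
    by split => //; exact: finite_fset.
  by rewrite -fsbig_seq ?fset_uniq// sumEFin.
apply: ge_ereal_sup => _ [F [finF _] <-].
rewrite fsbig_finite// sumEFin lee_fin.
by have := h (fset_set F); under eq_bigr do rewrite wE.
Qed.

Lemma dom_csize r0 r1 r2 (z : Z) c : dom r0 r1 r2 z ->
  csize c (coord c z) < radii r0 r1 r2 c.
Proof.
move=> [h1 h2 h3]; case: c => [[j|j]|[j|j]]; rewrite /csize /=.
- by rewrite -coord_act.
- by rewrite -coord_ang.
- by apply: le_lt_trans (h3 j); rewrite coord_cxi lerDl cmod_ge0.
- by apply: le_lt_trans (h3 j); rewrite coord_ceta lerDr cmod_ge0.
Qed.

Variable rd : coordinate -> R.
Hypothesis rd_gt0 : forall c, 0 < rd c.
Local Notation nle := (nle rd).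
Local Notation pdom := (pdom rd).

Lemma nle_radii t r0 r1 r2 (a : X -> C) M : 0 <= t ->
  (forall c, rd c + t <= radii r0 r1 r2 c) ->
  absb (fun x => a x * (\prod_c cweight c x (radii r0 r1 r2 c))%:C) M -> nle t a M.
Proof.
move=> t0 h; apply: absb_le => // x.
rewrite 2!cmodM ler_wpM2l ?cmod_ge0// 2!cmod_real.
have g0 c : 0 < rd c + t by exact: rdD_gt0.
have h1 : 0 <= weight rd t x by exact: weight_ge0.
have h2 : weight rd t x <= \prod_c cweight c x (radii r0 r1 r2 c).
  apply: ler_prod => c _; rewrite ltW ?cweight_gt0//=.
  by apply: cweight_le => //; exact: ltW.
by rewrite 2?ger0_norm//; exact: le_trans h2.
Qed.

Lemma coord_e_act c i : coord c (e_act R n2 i : Z) = (c == inl (inl i))%:R.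
Proof.
rewrite /coord /e_act mxE eqxx /=; congr (nat_of_bool _)%:R.
exact: (inj_eq (@cidx_inj n1 n2) c (inl (inl i))).
Qed.

(** The Hessian of (H1) is made of directional derivatives; the quadratic Taylor bound along one
    action identifies them with derivatives of the coefficients. *)
Lemma derive_tfeval t s a M (F : Z -> C) i z : 0 <= t -> 0 < s -> nle (t + s) a M ->
  (forall y, pdom (t + s) y -> F y = tfeval a y) -> pdom t z ->
  'D_(e_act R n2 i) F z = tfeval (dco (inl (inl i)) a) z.
Proof.
move=> t0 s0 aM FE hz.
have M0 : 0 <= M by exact: absb_ge0 aM.
have zs : pdom (t + s) z by apply: pdom_le hz; rewrite lerDl ltW.
have K0 : 0 <= M / s ^+ 2 by apply: divr_ge0 => //; rewrite exprn_ge0// ltW.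
pose K := M / s ^+ 2.
have K1 : 0 < K + 1 by rewrite ltr_wpDl.
set D := tfeval _ z.
apply: cvg_lim => //; apply/cvgrPdist_le => e' e'0.
have [e e0 ->] : exists2 e : R, 0 < e & e' = e%:C.
  exists (complex.Re e'); last by rewrite RRe_real// gtr0_real.
  by rewrite -ltcR RRe_real// gtr0_real.
pose r0 := Num.min s (e / (K + 1)).
have r00 : 0 < r0 by rewrite lt_min s0 divr_gt0.
apply/nbhs_ballP; exists r0%:C; first by rewrite /= ltcR.
move=> h; rewrite -ball_normE /ball_ /= sub0r normrN => hr0' hn0.
have {hr0'}hr0 : cmod h < r0 by rewrite -ltcR; exact: hr0'.
have hs' : cmod h <= s by rewrite ltW// (lt_le_trans hr0)// ge_min lexx.
have he : cmod h * (K + 1) <= e.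
  by rewrite -ler_pdivlMr// ltW// (lt_le_trans hr0)// ge_min lexx orbT.
have h0 : 0 < cmod h.
  by rewrite lt_neqAle cmod_ge0 andbT eq_sym; apply/eqP => /cmod_eq0; exact/eqP.
have cv c : coord c (h *: e_act R n2 i : Z) = h * (c == inl (inl i))%:R.
  by rewrite coordZ coord_e_act.
have hv c : cmod (coord c (h *: e_act R n2 i : Z)) <= cmod h.
  rewrite cv cmodM ler_piMr ?cmod_ge0//.
  by case: (c == _); rewrite ?cmod1 ?cmod0.
have hr : 0 <= cmod h <= s by rewrite cmod_ge0.
have := tfeval_quadratic rd_gt0 t0 s0 aM hz hr hv.
rewrite (bigD1 (inl (inl i)))//= big1 ?addr0; last first.
  by move=> c /negbTE ci; rewrite cv ci mulr0 mulr0.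
rewrite cv eqxx mulr1 -/D -!FE//; last first.
  by apply: (pdom_le _ (pdomD hv hz)); rewrite lerD2l.
move=> q; set y := (X in `|X|); suff : cmod y <= e by rewrite -lecR.
rewrite /y.
rewrite (_ : D - _ = - (h^-1 * (F (z + h *: e_act R n2 i) - F z - D * h))); last first.
  rewrite -[_ *: (_ - _)]/(h^-1 * (F (h *: e_act R n2 i + z) - F z)).
  rewrite [_ *: _ + z]addrC; have hh : h != 0 by [].
  by field.
rewrite cmodN cmodM cmodV; apply: le_trans he.
rewrite mulrC ler_pdivrMr//; apply: (le_trans q).
by rewrite -/K expr2 [leRHS]mulrAC mulrC ler_wpM2l ?mulr_ge0 ?cmod_ge0// lerDl.
Qed.

End FullNorm.

(** * Inverting the Hessian of (H1) *)

Section HessianInverse.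
Variables (R : realType) (d n2 : nat).
Local Notation C := R[i].
Local Notation Z := (phase R d.+1 n2).
Local Notation X := (tfindex d.+1 n2).
Local Notation coordinate := (coordinate d.+1 n2).
Local Notation cp i := (inl (inl i) : coordinate).
Local Notation x0 := (x0 d.+1 n2).
Variable rd : coordinate -> R.
Hypothesis rd_gt0 : forall c, 0 < rd c.
Variables (s M : R) (a : X -> C).
Hypothesis s0 : 0 < s.
Hypothesis aM : nle rd s a M.
Hypothesis a_freq : forall x, a x != 0 -> forall c, xfreq c x = 0.
Hypothesis a_real : forall x, tf_m x = 0%N -> exists r : R, a x = r%:C.

Lemma zstar0 : zstar n2 (0 : 'rV[R]_d) = 0.
Proof.
apply: coord_inj => c; rewrite coord_mkphase coord0.
by case: c => [[i|i]|] //; case: unlift => // j; rewrite mxE.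
Qed.

Lemma act_hessianE i j : act_hessian (tfeval a) i j = hess a i j.
Proof.
have z0 t : 0 <= t -> pdom rd t (0 : Z) by rewrite -zstar0; exact: (pdom_zstar rd_gt0).
have h2 : 0 < s / 2 by rewrite divr_gt0.
have ss : s / 2 + s / 2 = s by rewrite -splitr.
have aM' : nle rd (s / 2 + s / 2) a M by rewrite ss.
have dM : nle rd (0 + s / 2) (dco (cp j) a) (M / (s / 2)).
  by rewrite add0r; apply: (nle_dco rd_gt0 _ (ltW h2) h2 aM').
have FE (y : Z) : pdom rd (0 + s / 2) y ->
    'D_(e_act R n2 j) (tfeval a) y = tfeval (dco (cp j) a) y.
  by rewrite add0r => hy; exact: (derive_tfeval rd_gt0 j (ltW h2) h2 aM').
rewrite /act_hessian (derive_tfeval rd_gt0 i (lexx 0) h2 dM FE (z0 0 (lexx 0))).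
rewrite tfeval_at_x0// => x xx0; have [xd|xd] := posnP (xdeg x); last first.
  by rewrite -[X in tfmono x X]zstar0 tfmono_zstar// mulr0.
suff -> : dco (cp i) (dco (cp j) a) x = 0 by rewrite mul0r.
apply/eqP/negPn/negP; rewrite /dco /= !mulf_eq0 !negb_or => /and3P[_ _ /a_freq h0].
case/eqP: xx0; apply: eq_x0 => // c; have := h0 c.
by rewrite !xfreq_add !xfreq_unit !addr0.
Qed.

(** (H1) tests real vectors only, so the inverse is sought among real matrices. *)
Lemma hess_real i j : exists r : R, hess a i j = r%:C.
Proof.
have [|r hr] := a_real (x := xadd (xadd x0 (xunit (cp i))) (xunit (cp j))).
  rewrite !tf_m_add !tf_m_unit !addn0.
  by have := xdeg0 d.+1 n2; rewrite /xdeg => /eqP; rewrite addn_eq0 => /andP[_ /eqP].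
rewrite /hess /dco /= hr.
by eexists; rewrite -!real_complex_nat -!real_complexM.
Qed.

(** (H1) makes the real matrix injective, hence invertible; its inverse is then read in the complex
    numbers. *)
Lemma hess_inverse m : 0 < m ->
  (forall v : 'I_d.+1 -> R, m * \sum_i `|v i| <=
     \sum_i cmod (\sum_j act_hessian (tfeval a) i j * (v j)%:C)) ->
  exists Ci : 'I_d.+1 -> 'I_d.+1 -> C,
    forall b i, \sum_j hess a i j * (\sum_k Ci j k * b k) = b i.
Proof.
move=> m0 hm.
have [A hA] : exists A : 'I_d.+1 -> 'I_d.+1 -> R, forall i j, hess a i j = (A i j)%:C.
  have /boolp.choice[A hA] : forall p : 'I_d.+1 * 'I_d.+1, exists r : R, hess a p.1 p.2 = r%:C.
    by move=> p; exact: hess_real.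
  by exists (fun i j => A (i, j)) => i j; exact: (hA (i, j)).
pose B : 'M[R]_d.+1 := \matrix_(i, j) A i j.
have uB : B \in unitmx.
  (* Passing to the transpose turns a row vector in the kernel into the column to which (H1)
     applies. *)
  rewrite -unitmx_tr -row_free_unit; apply: inj_row_free => v vB.
  have := hm (v 0); rewrite [leRHS]big1 => [|i _]; last first.
    have : (v *m B^T) 0 i = 0 by rewrite vB mxE.
    rewrite mxE => h0; rewrite -[RHS](@cmod0 R); congr cmod.
    rewrite -[RHS]/((0 : R)%:C) -h0 rmorph_sum; apply: eq_bigr => j _.
    by rewrite act_hessianE hA !mxE -real_complexM mulrC.
  rewrite pmulr_rle0// => h0; apply/rowP => i; rewrite mxE.
  apply/eqP; rewrite -normr_eq0 eq_le normr_ge0 andbT (le_trans _ h0)//.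
  by rewrite (bigD1 i)//= lerDl sumr_ge0.
exists (fun j k => (invmx B j k)%:C) => b i.
under eq_bigr do rewrite mulr_sumr.
rewrite exchange_big /= (bigD1 i)//= [X in _ + X]big1 => [|k ki].
  under eq_bigr do rewrite mulrA hA -real_complexM.
  rewrite -mulr_suml -rmorph_sum addr0 (_ : \sum_j _ = 1) ?mul1r//.
  transitivity ((B *m invmx B) i i); last by rewrite mulmxV// mxE eqxx.
  by rewrite mxE; apply: eq_bigr => j _; rewrite mxE.
under eq_bigr do rewrite mulrA hA -real_complexM.
rewrite -mulr_suml -rmorph_sum (_ : \sum_j _ = 0) ?mul0r//.
transitivity ((B *m invmx B) i k); last by rewrite mulmxV// mxE eq_sym (negbTE ki).
by rewrite mxE; apply: eq_bigr => j _; rewrite mxE.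
Qed.

End HessianInverse.

(** * Lower bounds for the divisors *)

Section SmallDivisors.
Variable R : realType.

(** After division by omega the values are n + t with [t] the fractional part of v / omega, a
    discrete set. *)
Lemma lattice_gap (omega v : R) : omega != 0 ->
  exists2 g : R, 0 < g & forall k : int,
    k%:~R * omega + v != 0 -> g <= `|k%:~R * omega + v|.
Proof.
move=> w0; have aw : 0 < `|omega| by rewrite normr_gt0.
pose m := Num.floor (v / omega); pose t := v / omega - m%:~R.
have t0 : 0 <= t by rewrite subr_ge0 floor_le.
have t1 : t < 1.
  by have /andP[_] := floor_itv (v / omega); rewrite intrD ltrBlDl.
have kE (k : int) : k%:~R * omega + v = ((k + m)%:~R + t) * omega.
  by rewrite intrD /t; field.
(* If t = 0 the value 0 is excluded and the nearest ones are at distance 1; otherwise the nearest to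
   0 are t and t - 1. *)
pose g := if t == 0 then 1 else Num.min t (1 - t).
have g0 : 0 < g.
  by rewrite /g; case: (eqVneq t 0) => // tn; rewrite lt_min lt_neqAle eq_sym tn t0 subr_gt0.
exists (g * `|omega|); first exact: mulr_gt0.
move=> k; rewrite kE mulf_eq0 negb_or normrM ler_pM2r// => /andP[h _].
move: (k + m) h => n h.
have [n0|n0] := lerP 1 n.
  have : 1 <= n%:~R :> R by rewrite -[1]/(1%:~R) ler_int.
  move=> h1; rewrite ger0_norm; last lra.
  rewrite /g; case: eqP => _; first lra.
  by rewrite ge_min; apply/orP; left; lra.
have [n1|n1] := lerP n (-1).
  have : n%:~R <= -1 :> R by rewrite -[-1]/((-1)%:~R) ler_int.
  move=> h1; rewrite ltr0_norm; last lra.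
  rewrite /g; case: eqP => tt; first by rewrite tt; lra.
  by rewrite ge_min; apply/orP; right; lra.
have -> : n = 0 by lia.
rewrite add0r ger0_norm// /g; case: eqP => tt; last by rewrite ge_min lexx.
by move: h; rewrite tt (_ : n = 0) ?addr0 ?eqxx//; lia.
Qed.

Lemma lattice_gap_fin (I : finType) (omega : R) (v : I -> R) : omega != 0 ->
  exists2 g : R, 0 < g & forall (k : int) i,
    k%:~R * omega + v i != 0 -> g <= `|k%:~R * omega + v i|.
Proof.
move=> w0; have /boolp.choice[g hg] : forall i, exists g : R, 0 < g /\ forall k : int,
    k%:~R * omega + v i != 0 -> g <= `|k%:~R * omega + v i|.
  by move=> i; have [g g0 h] := lattice_gap (v i) w0; exists g.
exists (\big[Order.min/1]_i g i).
  elim/big_ind: _ => // [x y x0 y0|i _]; first by rewrite lt_min x0.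
  by have [] := hg i.
move=> k i h; have [_ /(_ k h)] := hg i; apply: le_trans.
exact: bigmin_le.
Qed.

(** Peels one factor off a monomial; at most two uses write the contribution of xi and eta as a sum
    of single signed frequencies. *)
Lemma weighted_pop (I : finType) (n : I -> nat) (w : I -> R) : (0 < \sum_i n i)%N ->
  exists c (n' : I -> nat), (\sum_i n i = (\sum_i n' i).+1)%N /\
    \sum_i w i * (n i)%:R = w c + \sum_i w i * (n' i)%:R.
Proof.
move=> h; have [c nc] : exists c, (0 < n c)%N.
  apply: contrapT => hn; move: h; rewrite big1// => i _.
  by apply/eqP; rewrite -leqn0 leqNgt; apply/negP => ni; apply: hn; exists i.
exists c, (fun i => n i - (i == c))%N.
have hi i : i != c -> (n i - (i == c))%N = n i by move=> /negbTE ->; rewrite subn0.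
split.
  rewrite (bigD1 c)//= [in RHS](bigD1 c)//= eqxx -addSn subn1 prednK//.
  by congr (_ + _)%N; apply: eq_bigr => i /hi.
rewrite (bigD1 c)//= [in RHS](bigD1 c)//= eqxx addrA; congr (_ + _).
  by rewrite subn1 -subn1 natrB//; ring.
by apply: eq_bigr => i /hi ->.
Qed.

(** A bad monomial has at most two factors among xi, eta. Its eigenvalue lies therefore in one of
    finitely many translates of omega Z, each with a gap around 0, and (H3) excludes the value 0. *)
Lemma eigval_gap (d d2 : nat) (omega : R) (Omega : 'I_d2.+1 -> R) :
  (forall (k1 : int) (b : bool) (j : 'I_d2.+1),
     k1%:~R * omega + (-1) ^+ b * Omega j != 0) ->
  (forall (k1 : int) (b b' : bool) (l k : 'I_d2.+1), k1 != 0 ->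
     k1%:~R * omega + (-1) ^+ b * Omega l + (-1) ^+ b' * Omega k != 0) ->
  exists2 g : R, 0 < g & forall x : tfindex d.+1 d2.+1, bad x ->
    g <= `|eigval omega Omega x|.
Proof.
move=> h1 h2; have w0 : omega != 0.
  (* Equal indices with opposite signs leave omega itself. *)
  have := h2 1 false true ord0 ord0 isT.
  by rewrite expr0 expr1 mul1r mulN1r -addrA subrr addr0 mul1r.
pose I := ('I_d2.+1 + 'I_d2.+1)%type.
pose w (c : I) := match c with inl j => Omega j | inr j => - Omega j end.
have wE c : exists (b : bool) j, w c = (-1) ^+ b * Omega j.
  by case: c => j; [exists false, j|exists true, j]; rewrite /w ?expr1 ?expr0 ?mul1r ?mulN1r.
(* [None] stands for a missing factor, so that pairs cover monomials with zero, one or two of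
   them. *)
pose ow (o : option I) := if o is Some c then w c else 0.
have [g g0 hg] := lattice_gap_fin (fun p : option I * option I => ow p.1 + ow p.2) w0.
exists g => // x bx.
pose n (c : I) := match c with inl j => ix_m1 x j | inr j => ix_m2 x j end.
have nm : (\sum_c n c = tf_m x)%N by rewrite big_sumType.
have -> : eigval omega Omega x = (fast x)%:~R * omega + \sum_c w c * (n c)%:R.
  rewrite /eigval mulrC; congr (_ + _); rewrite big_sumType /= -big_split /=.
  by apply: eq_bigr => j _; rewrite mulrBr mulNr.
have n0 (n' : I -> nat) : (\sum_c n' c)%N = 0%N -> \sum_c w c * (n' c)%:R = 0.
  move/eqP; rewrite sum_nat_eq0 => /forallP h.
  by apply: big1 => c _; have /eqP -> := h c; rewrite mulr0.
move: bx; rewrite /bad -nm => /orP[/andP[/eqP m1 _]|/andP[fx]].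
  have [|c [n' [e1 e2]]] := weighted_pop (n := n) w; first by rewrite m1.
  rewrite e2 n0; last by move: e1; rewrite m1 => -[].
  have := hg (fast x) (Some c, None); rewrite /= addr0; apply.
  by have [b [j ->]] := wE c; exact: h1.
rewrite !inE !xpair_eqE; case: (posnP (\sum_c n c)) => [m0 _|mpos h].
  rewrite n0//; have := hg (fast x) (None, None); rewrite /= !addr0; apply.
  by rewrite mulf_neq0// intr_eq0.
have m2 : (\sum_c n c)%N = 2%N.
  by move: h mpos; case: (\sum_c n c)%N => [|[|[|]]]; rewrite ?andbF.
have [|c [n' [e1 e2]]] := weighted_pop (n := n) w; first by rewrite m2.
have m2' : (\sum_c n' c)%N = 1%N by move: e1; rewrite m2 => -[].
have [|c' [n2 [e3 e4]]] := weighted_pop (n := n') w; first by rewrite m2'.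
rewrite e2 e4 n0; last by move: e3; rewrite m2' => -[].
have := hg (fast x) (Some c, Some c'); rewrite /= addr0; apply.
have [b [j ->]] := wE c; have [b' [j' ->]] := wE c'; rewrite addrA.
exact: h2.
Qed.

End SmallDivisors.

(** * The given Hamiltonian as a starting state *)

Section InitialState.
Variable R : realType.
Local Notation C := R[i].

Lemma geometric_fset (A : {fset nat}) : \sum_(n <- A) 2^-1 ^+ n <= 2 :> R.
Proof.
have [N hN] := fset_nat_sub A.
have h n : 0 <= 2^-1 ^+ n :> R by rewrite exprn_ge0.
apply: le_trans (ler_sum_fsub (hN _ (leqnn N)) h) _; rewrite big_fset_iota.
have -> : \sum_(0 <= n < N) 2^-1 ^+ n = 2 - 2 * 2^-1 ^+ N :> R.
  elim: N {hN} => [|N ih]; first by rewrite big_geq// expr0; ring.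
  by rewrite big_nat_recr//= ih exprS; field.
by rewrite gerBl mulr_ge0.
Qed.

Section Degrees.
Variables (n1 n2 : nat) (rd : coordinate n1 n2 -> R).
Hypothesis rd_gt0 : forall c, 0 < rd c.
Local Notation Z := (phase R n1 n2).
Local Notation X := (tfindex n1 n2).

Definition degc (ell : nat) (a : X -> C) : X -> C :=
  fun x => if xdeg x == ell then a x else 0.

Lemma nle_degc t ell a M : 0 <= t -> nle rd t a M -> nle rd t (degc ell a) M.
Proof.
move=> t0; apply: nle_le => // x.
by rewrite /degc; case: ifP => // _; rewrite cmod0 cmod_ge0.
Qed.

Lemma hs_degc t a M z : 0 <= t -> nle rd t a M -> pdom rd t z ->
  hs (fun ell => tfeval (degc ell a) z) (tfeval a z).
Proof.
move=> t0 aM hz; apply: (hs_group (p := @xdeg n1 n2) _ (nle_hs rd_gt0 t0 aM hz)) => ell.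
apply: eq_hs (nle_hs rd_gt0 t0 (nle_degc ell t0 aM) hz) => x.
by rewrite /degc; case: ifP => // _; rewrite mul0r.
Qed.

End Degrees.

Variables (d d2 : nat) (omega : R) (Omega : 'I_d2.+1 -> R).
Local Notation Z := (phase R d.+1 d2.+1).
Local Notation X := (tfindex d.+1 d2.+1).
Local Notation coordinate := (coordinate d.+1 d2.+1).
Variables (rho sigma rad : R).
Hypotheses (hrho : 0 < rho) (hsigma : 0 < sigma) (hrad : 0 < rad).
Variables (eps0 : R) (heps0 : 0 < eps0).
Variables (H0 : R -> Z -> C) (F : R -> nat -> nat -> tfseries R d.+1 d2.+1).
Hypothesis hf0 : unperturbed eps0 F.
Hypothesis hfP : forall eps ell s, `|eps| < eps0 -> present0 ell s -> inP ell (F eps ell s).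
Hypothesis hH0 : forall eps, `|eps| < eps0 ->
  expansion omega Omega present0 (F eps) (dom rho sigma rad) (H0 eps).
Variable E : R.
Hypothesis E0 : 0 < E.
Hypothesis hE : forall eps ell s, `|eps| < eps0 -> present0 ell s ->
  (tfnorm rho sigma rad (F eps ell s) <= (E / 2 ^+ ell * `|eps| ^+ s)%:E)%E.

Let rd : coordinate -> R := radii (2^-1 * rho) (2^-1 * sigma) (2^-1 * rad).
Variable tau : R.
Hypothesis tau0 : 0 < tau.
Hypothesis htau : forall c, rd c + tau <= radii rho sigma rad c.
Local Notation nle := (nle rd).
Local Notation pdom := (pdom rd).
Let tau0' := ltW tau0.

Lemma radii_gt0 (r0 r1 r2 : R) : 0 < r0 -> 0 < r1 -> 0 < r2 ->
  forall c : coordinate, 0 < radii r0 r1 r2 c.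
Proof. by move=> ? ? ? [[]|]. Qed.

Let rd_gt0 : forall c, 0 < rd c.
Proof. by apply: radii_gt0; rewrite mulr_gt0. Qed.

Let zero_lt : `|0 : R| < eps0. Proof. by rewrite normr0. Qed.

Lemma nleF eps ell s : `|eps| < eps0 -> present0 ell s ->
  nle tau (F eps ell s) (E / 2 ^+ ell * `|eps| ^+ s).
Proof.
move=> he hp; apply: (nle_radii rd_gt0 tau0' htau).
by apply/tfnormP; [exact: ltW|exact: ltW|exact: hE].
Qed.

(** The terms of order 0 gathered into one series: each coefficient comes from the only class P_ell
    containing its monomial, and eps = 0 represents every eps. *)
Definition unpert (x : X) : C := if (2 < xdeg x)%N then F 0 (xdeg x) 0%N x else 0.

Let Ell ell : E / 2 ^+ ell = E * 2^-1 ^+ ell. Proof. by rewrite exprVn. Qed.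

Let sum_E (A : {fset nat}) : \sum_(ell <- A) E / 2 ^+ ell <= 2 * E.
Proof.
rewrite (eq_bigr _ (fun ell _ => Ell ell)).
by rewrite -mulr_sumr mulrC ler_pM2r// geometric_fset.
Qed.

(** The pairs [(xdeg x, x)] select a subfamily of the double family over degrees and monomials,
    where (H2) sums to [2 * E]. *)
Lemma unpertK : nle tau unpert (2 * E).
Proof.
pose u (ell : nat) (x : X) : C :=
  (if (2 < ell)%N then F 0 ell 0%N x else 0) * (weight rd tau x)%:C.
have h := absb_pair (u := u) (M := fun ell => E / 2 ^+ ell) _ sum_E.
have inj : injective (fun x : X => (xdeg x, x)) by move=> x y [].
apply: (absb_comp inj (h _)) => ell; rewrite /u; case hl: (2 < ell)%N.
  by have := nleF (s := 0%N) zero_lt hl; rewrite expr0 mulr1.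
apply: (absb_le (w := fun=> 0) (M := 0)) => [x||A]; first by rewrite mul0r.
  by rewrite divr_ge0 ?exprn_ge0// ltW.
by rewrite big1// => x _; rewrite cmod0.
Qed.

Lemma unpertE eps ell : `|eps| < eps0 -> (2 < ell)%N -> F eps ell 0%N = F 0 ell 0%N.
Proof.
move=> he hl; have [h [g hg]] := hf0; apply/funext => x.
by rewrite !hg.
Qed.

Lemma degc_unpert ell : degc ell unpert = if (2 < ell)%N then F 0 ell 0%N else fun=> 0.
Proof.
apply/funext => x; rewrite /degc /unpert; case: eqP => [->|xl]; first by case: ifP.
case: ifP => // hl; apply/eqP; rewrite eq_sym; apply/negPn/negP => hx.
by apply: xl; exact: (hfP zero_lt (s := 0%N) hl hx).
Qed.

Lemma unpert_neq0 x : unpert x != 0 ->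
  [/\ (2 < xdeg x)%N, forall c, xfreq c x = 0 & tf_l x = 0%N \/ tf_m x = 0%N].
Proof.
rewrite /unpert; case: ifP => [hl|]; last by rewrite eqxx.
have [h [g hg]] := hf0; rewrite hg//.
case: ifP => [/andP[_ /eqP kx]|]; last by rewrite eqxx.
move=> hx; split=> //.
  by case=> [[i|i]|c] //; rewrite /= kx ffunE.
move: hx; case: (eqVneq (tf_m x) 0%N) => [|_]; first by right.
by case: (eqVneq (tf_l x) 0%N) => [|_]; [left|rewrite eqxx].
Qed.

(** The constant is [2 * E] from the degrees times 2 from the geometric series in the orders, which
    converges since |eps| is at most 1/2. *)
Lemma perturbation eps : `|eps| < eps0 -> `|eps| <= 2^-1 -> exists g : X -> C,
  nle tau g (4 * E * `|eps|) /\ forall z, pdom tau z ->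
    hs (fun k : nat * nat => if k.2 is s.+1 then tfeval (F eps k.1 k.2) z else 0)
       (tfeval g z).
Proof.
move=> he he2; set e := `|eps| in he he2 *.
have e0 : 0 <= e by exact: normr_ge0.
(* One factor |eps| is kept and the others are bounded by 1/2; order 0 belongs to [unpert]. *)
pose v (s : nat) := if s is s'.+1 then e * 2^-1 ^+ s' else 0.
have v0 s : 0 <= v s by case: s => //= s; rewrite mulr_ge0// exprn_ge0.
have El0 ell : 0 <= E / 2 ^+ ell by rewrite divr_ge0 ?exprn_ge0// ltW.
pose M (k : nat * nat) := E / 2 ^+ k.1 * v k.2.
pose G (k : nat * nat) (z : Z) : C := if k.2 is s.+1 then tfeval (F eps k.1 k.2) z else 0.
have GM k : ex rd 0 tau (G k) (M k).
  case: k => ell [|s]; rewrite /G /M /=; first by rewrite mulr0; exact: ex_zero.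
  have h := nleF (ell := ell) (s := s.+1) he isT.
  apply: (ex_leM rd_gt0 tau0' _ (ex_tfeval rd_gt0 tau0' h _)) => //.
  by rewrite -/e exprS ler_wpM2l// ler_wpM2l// lerXn2r ?nnegrE.
have Mab : absb (fun k => (M k)%:C) (4 * E * e).
  have a1 : absb (fun ell : nat => (E / 2 ^+ ell)%:C) (2 * E).
    by move=> A; under eq_bigr do rewrite cmod_real ger0_norm//; exact: sum_E.
  have a2 : absb (fun s : nat => (v s)%:C) (2 * e).
    apply: absb_nat => -[|n]; first by rewrite big_geq// mulr_ge0.
    rewrite big_nat_recl// (cmod_real (v 0%N)) ger0_norm// add0r.
    rewrite (eq_bigr (fun s => e * 2^-1 ^+ s)) => [|s _]; last by rewrite cmod_real ger0_norm.
    by rewrite -mulr_sumr mulrC ler_wpM2r// -big_fset_iota geometric_fset.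
  have := absb_mul a1 a2; apply: absb_le => [k|]; first by rewrite /M real_complexM.
  by rewrite le_eqVlt; apply/orP; left; apply/eqP; ring.
have Mle (A : {fset nat * nat}) : \sum_(k <- A) M k <= 4 * E * e.
  apply: le_trans (Mab A); apply: ler_sum => k _.
  by rewrite cmod_real ler_norm.
have hG z : pdom tau z -> hs (fun k => G k z) (sum (fun k => G k z)).
  move=> hz; apply: (absb_sum (M := 4 * E * e)); apply: absb_le Mab => // k.
  by rewrite cmod_real (le_trans _ (ler_norm _))//; exact: (ex_cmod_le rd_gt0 tau0' (GM k)).
have := ex_series rd_gt0 tau0' GM Mle hG.
move=> /(exP rd_gt0 tau0')[g [g1 _ g2]]; exists g; split=> // z hz.
by rewrite -g2//; exact: hG.
Qed.

Lemma perturbationE eps g z : `|eps| < eps0 -> dom rho sigma rad z -> pdom tau z ->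
  hs (fun k : nat * nat => if k.2 is s.+1 then tfeval (F eps k.1 k.2) z else 0)
       (tfeval g z) ->
  H0 eps z = lin_part omega Omega z + tfeval unpert z + tfeval g z.
Proof.
move=> he hz hz' hg; have /has_sumP h := hH0 he hz.
suff h' : hs (fun x : nat * nat => if present0 x.1 x.2 then tfeval (F eps x.1 x.2) z else 0)
    (tfeval unpert z + tfeval g z).
  by rewrite -addrA -(hs_uniq h h') addrC subrK.
have inj : injective (fun ell : nat => (ell, 0%N)) by move=> x y [].
pose u0 (k : nat * nat) := if k.2 is 0%N then tfeval (degc k.1 unpert) z else 0.
have h0 : hs u0 (tfeval unpert z).
  apply: (hs_image inj _ _ (hs_degc rd_gt0 tau0' unpertK hz')) => // -[ell [|s]] hk //.
  by case: (hk ell).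
apply: eq_hs (hs_add h0 hg) => -[ell [|s]]; rewrite /u0 /= ?add0r// addr0 degc_unpert.
case: ifP => hl; last by apply: hs_sum; apply: hs0 => x; rewrite mul0r.
by rewrite (unpertE he hl).
Qed.

(** The identity map: every item has order 1 because all of [g0] does. *)
Lemma initial_state (g0 : R -> X -> C) e1 : 0 < e1 ->
  (forall eps, `|eps| < e1 -> nle tau (g0 eps) (4 * E * `|eps|)) ->
  forall t, 0 < t -> t < tau ->
  state omega Omega rd unpert g0 (level 1 0) t.
Proof.
move=> e10 hg t t0 tt; have t0' := ltW t0.
have c0 : 0 <= t^-1 + 1 by rewrite addr_ge0// invr_ge0.
have K0 : 0 <= 4 * E by rewrite mulr_ge0// ltW.
exists (4 * E + (t^-1 + 1) * (4 * E)), e1; split=> //.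
  by rewrite addr_ge0// mulr_ge0.
move=> qs eps he; set e := `|eps|; have e0 : 0 <= e by exact: normr_ge0.
have tg : nle t (g0 eps) (4 * E * e).
  by apply: (nle_le rd_gt0 t0' (ltW tt) _ (fun=> lexx _) (hg eps he)).
exists (fun=> 0), (g0 eps); split.
- apply: (exv_le rd_gt0 t0' (lexx t) _ (exv_zero rd t0')).
  by rewrite mulr_ge0// addr_ge0// mulr_ge0.
- exact: sympl_translation.
- by move=> z _; rewrite addr0.
- apply: (nle_le rd_gt0 t0' (lexx t) _ (fun=> lexx _) tg).
  by rewrite ler_wpM2r// lerDl mulr_ge0.
- move=> j _; rewrite /level /= expr1.
  apply: (item_le rd_gt0 t0' (lexx t) _ (item_nle rd_gt0 qs j t0 tg)).
  by rewrite mulrA ler_wpM2r// lerDr.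
Qed.

End InitialState.

(** * The final transformation and its Hamiltonian *)

Section NearIdentity.
Variables (R : realType) (d n2 : nat).
Local Notation C := R[i].
Local Notation Z := (phase R d.+1 n2).
Local Notation X := (tfindex d.+1 n2).
Local Notation coordinate := (coordinate d.+1 n2).

(** The last radius grows twice as much, since xi_j and eta_j are bounded through their sum. *)
Lemma domD r0 r1 r2 b (z h : Z) : dom r0 r1 r2 z -> (forall c, cmod (coord c h) <= b) ->
  dom (r0 + b) (r1 + b) (r2 + (b + b)) (z + h).
Proof.
move=> [h1 h2 h3] hb; split=> j.
- rewrite coord_act coordD (le_lt_trans (cmodD _ _))// ltr_leD//.
  by rewrite -coord_act.
- rewrite coord_ang coordD ImD (le_lt_trans (ler_normD _ _))// ltr_leD//.
    by rewrite -coord_ang.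
  exact: le_trans (le_cmod_Im _) (hb _).
rewrite coord_cxi coord_ceta !coordD.
have := h3 j; rewrite coord_cxi coord_ceta.
move: (hb (inr (inl j))) (hb (inr (inr j))).
have := cmodD (coord (inr (inl j)) z) (coord (inr (inl j)) h).
have := cmodD (coord (inr (inr j)) z) (coord (inr (inr j)) h).
lra.
Qed.

Lemma dom_le r0 r1 r2 r0' r1' r2' (z : Z) : r0 <= r0' -> r1 <= r1' -> r2 <= r2' ->
  dom r0 r1 r2 z -> dom r0' r1' r2' z.
Proof. by move=> a b c [h1 h2 h3]; split=> j; [move: (h1 j)|move: (h2 j)|move: (h3 j)] => /lt_le_trans; apply. Qed.

Lemma torus_eqP (z z' : Z) : torus_eq z z' <->
  exists k : 'I_d.+1 -> int, forall c, coord c z' = coord c z +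
    (if c is inl (inr j) then (2 * pi * (k j)%:~R)%:C else 0).
Proof.
split=> [[e1 e2 e3 [k hk]]|[k hk]].
  exists k => -[[i|i]|[i|i]]; rewrite ?addr0 -?coord_act -?coord_ang -?coord_cxi -?coord_ceta.
  - by rewrite e1.
  - exact: hk.
  - by rewrite e2.
  - by rewrite e3.
split; first by apply/rowP => i; rewrite !coord_act hk addr0.
- by apply/rowP => i; rewrite !coord_cxi hk addr0.
- by apply/rowP => i; rewrite !coord_ceta hk addr0.
- by exists k => j; rewrite !coord_ang hk.
Qed.

Variable rd : coordinate -> R.
Hypothesis rd_gt0 : forall c, 0 < rd c.
Variables (t b : R) (phi : Z -> Z).
Hypothesis t0 : 0 < t.
Hypothesis phib : exv rd t phi b.
Hypothesis b0 : 0 <= b.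
Hypothesis bt : 4 * b <= t.
Let bb : b + b <= 4 * b.
Proof. by move: b0 bt; lra. Qed.
Let bt4 : b / t <= 4^-1.
Proof. by rewrite ler_pdivrMr//; move: b0 bt; lra. Qed.
Let bt2 : 2 * b <= t / 2.
Proof. by move: b0 bt; lra. Qed.
Let bt1 : 2 * b <= t.
Proof. by move: b0 bt; lra. Qed.
Let Phi z := z + phi z.

Lemma pdom_torus s (z z' : Z) : torus_eq z z' -> pdom rd s z -> pdom rd s z'.
Proof.
move=> /torus_eqP[k hk] h c; rewrite hk; have := h c.
case: c => [[i|i]|c]; rewrite ?addr0//= /csize /= ImD.
by rewrite (_ : complex.Im _%:C = 0) ?addr0.
Qed.

Lemma near_id_torus z z' : pdom rd t z -> pdom rd t z' -> torus_eq z z' ->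
  torus_eq (Phi z) (Phi z').
Proof.
move=> hz hz' e; apply/torus_eqP; have /torus_eqP[k hk] := e.
exists k => c; rewrite /Phi !coordD hk addrAC; congr (_ + _).
congr (_ + _); have /= h := ex_torus (ltW t0) (phib c) e hz hz'.
by rewrite h.
Qed.

Lemma near_id_coef : exists a : coordinate -> X -> C, forall c, nle rd t (a c) b /\
  forall z, pdom rd t z -> coord c (phi z) = tfeval (a c) z.
Proof.
have /boolp.choice[a ha] : forall c, exists a : X -> C, nle rd t a b /\
    forall z, pdom rd t z -> coord c (phi z) = tfeval a z.
  by move=> c; have [a [h1 _ h2]] := exP rd_gt0 (ltW t0) (phib c); exists a.
by exists a.
Qed.

(** The displacement is Lipschitz with constant [b / t <= 1/4], so the largest coordinate difference
    [r] satisfies r <= r / 4. *)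
Lemma near_id_inj z z' : pdom rd 0 z -> pdom rd 0 z' -> Phi z = Phi z' -> z = z'.
Proof.
move=> hz hz' e; have t0' := ltW t0.
have up y : pdom rd 0 y -> pdom rd t y by exact: pdom_le.
have [a ha] := near_id_coef.
pose h := z - z'; have hE c : coord c h = coord c (phi z') - coord c (phi z).
  rewrite /h coordB; have := congr1 (coord c) e; rewrite /Phi !coordD => e'.
  have -> : coord c z = coord c z' + coord c (phi z') - coord c (phi z) by rewrite -e' addrK.
  by ring.
pose r := \big[Num.max/0]_c cmod (coord c h).
have rc c : cmod (coord c h) <= r by exact: le_bigmax.
have r0 : 0 <= r by exact: le_trans (cmod_ge0 _) (rc (inl (inl ord0))).
have rt : 0 <= r <= t.
  rewrite r0 /=; apply: (@le_trans _ _ (4 * b)) => //.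
  apply/bigmax_leP; split=> [|c _]; first by rewrite mulr_ge0.
  rewrite hE (le_trans (cmodD _ _))// cmodN.
  have h1 := exv_cmod_le rd_gt0 c t0' phib (up _ hz).
  have h2 := exv_cmod_le rd_gt0 c t0' phib (up _ hz').
  exact: (le_trans (lerD h2 h1)).
have rle : r <= b / t * r.
  apply/bigmax_leP; split=> [|c _]; first by rewrite mulr_ge0// divr_ge0.
  rewrite hE cmodB; have [aM aE] := ha c.
  have zE : z' + h = z by rewrite /h addrC subrK.
  have a0 : nle rd (0 + t) (a c) b by rewrite add0r.
  have := tfeval_lipschitz rd_gt0 (lexx 0) t0 a0 hz' rt rc.
  by rewrite zE -!aE//; exact: up.
have r00 : r <= 0.
  have : r <= 4^-1 * r by apply: (le_trans rle); rewrite ler_wpM2r.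
  by lra.
apply: coord_inj => c; apply/eqP; rewrite -subr_eq0 -coordB; apply/eqP/cmod_eq0.
by apply/eqP; rewrite eq_le cmod_ge0 andbT (le_trans (rc c)).
Qed.

(** [picard] solves u = - phi (z + u). *)
Lemma near_id_surj z : pdom rd 0 z -> exists2 w,
  Phi w = z & forall c, cmod (coord c (w - z)) <= 2 * b.
Proof.
move=> hz; have t0' := ltW t0; have [a ha] := near_id_coef.
have t2 : 0 < t / 2 by rewrite divr_gt0.
have aM c : nle rd (0 + t / 2 + t / 2) (fun x => - a c x) b.
  rewrite add0r -splitr; have [h _] := ha c.
  by apply: (nle_le rd_gt0 t0' (lexx t) (lexx b) _ h) => x; rewrite cmodN.
have [u [uB uE]] := picard rd_gt0 (lexx 0) t2 b0 bt2 aM.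
have uz c : cmod (coord c (u z)) <= 2 * b.
  exact: (exv_cmod_le rd_gt0 c (lexx 0) uB hz).
have hw : pdom rd t (z + u z).
  by apply: (pdom_le _ (pdomD uz hz)); rewrite add0r.
exists (z + u z); last by move=> c; rewrite addrC addKr.
apply: coord_inj => c; rewrite /Phi !coordD; have [h hE] := ha c; rewrite hE//.
have -> : coord c (u z) = - tfeval (a c) (z + u z).
  rewrite uE// -mulN1r -(tfeval_scale rd_gt0 _ t0' h hw); congr tfeval.
  by apply/funext => x; rewrite mulN1r.
by rewrite -addrA addNr addr0.
Qed.

(** Injectivity modulo 2 pi: if the images differ by a shift of the angles, [z] is first moved by
    the same shift, which [phi] does not see, and then [near_id_inj] applies. *)
Lemma near_id_canonical r0 r1 r2 : sympl rd t Phi ->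
  (forall z, dom r0 r1 r2 z -> pdom rd 0 z) ->
  analytic_canonical (dom r0 r1 r2) Phi.
Proof.
move=> hS hD; have up y : pdom rd 0 y -> pdom rd t y by apply: pdom_le; exact: ltW.
split.
- by move=> z /hD/up/hS[].
- by move=> z /hD/up/hS[].
- by move=> z z' /hD/up hz /hD/up hz'; exact: near_id_torus.
move=> z z' /hD hz /hD hz' /torus_eqP[k hk].
pose y : Z := mkphase (fun c => coord c z +
  (if c is inl (inr j) then (2 * pi * (k j)%:~R)%:C else 0)).
have zy : torus_eq z y by apply/torus_eqP; exists k => c; rewrite coord_mkphase.
have hy : pdom rd 0 y by exact: pdom_torus hz.
suff -> : z' = y by [].
apply: near_id_inj => //; apply: coord_inj => c; rewrite hk /Phi !coordD addrAC.
rewrite coord_mkphase; congr (_ + _).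
by have /= h := ex_torus (ltW t0) (phib c) zy (up _ hz) (up _ hy); rewrite h.
Qed.

End NearIdentity.

(** * Splitting the final perturbation into terms *)

Section NormalFormTerms.
Variables (R : realType) (d n2 : nat).
Local Notation C := R[i].
Local Notation Z := (phase R d.+1 n2).
Local Notation X := (tfindex d.+1 n2).
Local Notation coordinate := (coordinate d.+1 n2).
Local Notation cp i := (inl (inl i) : coordinate).
Local Notation x0 := (x0 d.+1 n2).

(* Everything in [g] that is not in normal form.  It is of order [r.+1], so in
   [terms] it is stored at [s = r.+1], while the whole rest of [g] sits at
   [s = 1]. *)
Definition remainder (qs : 'rV[R]_d) (g : X -> C) (x : X) : C :=
  (if bad x then g x else 0) +
  \sum_i (if x == xunit (cp i) then av qs i g else 0).

Definition normpart (qs : 'rV[R]_d) (g : X -> C) (x : X) : C := g x - remainder qs g x.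

Definition terms (r : nat) (f : X -> C) (qs : 'rV[R]_d) (g : X -> C) (ell s : nat) : X -> C :=
  degc ell (if s == 0%N then f else if s == 1%N then normpart qs g
            else if s == r.+1 then remainder qs g else fun=> 0).

Lemma xdeg_unit_p i : xdeg (xunit (cp i)) = 2%N.
Proof. by rewrite /xdeg tf_l_unit tf_m_unit. Qed.

Lemma fast_unit i : fast (xunit (cp i)) = 0.
Proof. by rewrite /fast xfreq_unit. Qed.

Lemma bad_xdeg (x : X) : bad x -> (xdeg x < 5)%N.
Proof.
rewrite /bad /xdeg => /orP[/andP[/eqP -> l1]|/andP[_]].
  by case: (tf_l x) l1 => [|[|]].
by rewrite !inE !xpair_eqE => /or4P[] /andP[/eqP -> /eqP ->].
Qed.

Lemma normpart_neq0 qs g x : normpart qs g x != 0 -> bad x = false.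
Proof.
rewrite /normpart /remainder; case bx: (bad x) => //.
rewrite big1 ?addr0 ?subrr ?eqxx// => i _; case: eqP => // xE.
move: bx; rewrite xE /bad fast_unit eqxx /=.
by rewrite tf_m_unit.
Qed.

Section Size.
Variable rd : coordinate -> R.
Hypothesis rd_gt0 : forall c, 0 < rd c.
Variables (t : R) (f g : X -> C) (Kf K e : R) (r : nat) (qs : 'rV[R]_d).
Hypothesis t0 : 0 < t.
Hypothesis fK : nle rd t f Kf.
Hypothesis gK : nle rd t g (K * e).
Hypothesis gI : forall j, (j < 6)%N -> item rd qs t j g (K * e ^+ r.+1).
Hypothesis e0 : 0 <= e.
Hypothesis e1 : e <= 1.
Hypothesis K0 : 0 <= K.
Hypothesis r0 : (0 < r)%N.
Let t0' := ltW t0.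

Definition unit_weight : R := \sum_i weight rd t (xunit (cp i)).

Lemma unit_weight_ge0 : 0 <= unit_weight.
Proof. by apply: sumr_ge0 => i _; exact: weight_ge0. Qed.

Let er0 : 0 <= K * e ^+ r.+1. Proof. by rewrite mulr_ge0// exprn_ge0. Qed.

(** Bad monomials have degree at most 4, which gives five projections; the averages contribute
    through the weights of the p_i. *)
Lemma remainderK : nle rd t (remainder qs g) ((5 + unit_weight) * K * e ^+ r.+1).
Proof.
have hb : nle rd t (fun x => if bad x then g x else 0) (5 * (K * e ^+ r.+1)).
  (* Degree [l] is item [l] below 2 and item [l.+1] from 2 on, undoing [ldeg]; zero pads the other
     degrees. *)
  have h l : nle rd t (if (l < 5)%N then proj l g else fun=> 0) (K * e ^+ r.+1).
    case: ifP => l5; last first.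
      by apply: (nle_le rd_gt0 t0' (lexx t) er0 (fun=> lexx _) (@nle0 _ _ _ rd t)).
    case: (ltnP l 2) => l2.
      have := gI (j := l) (leq_trans l2 (isT : (2 <= 6)%N)); rewrite /item /ldeg l2.
      by case: eqP l2 => [->|].
    have := gI (j := l.+1) l5; rewrite /item /ldeg.
    rewrite eqSS gtn_eqF// ltnS ltnNge -ltnS ltnS.
    by rewrite (ltnW l2).
  have := nle_sum (rd := rd) (iota 0 5) h; rewrite big_const_seq count_predT iter_addr_0 /=.
  rewrite -[X in nle _ _ _ X]mulr_natl.
  apply: (nle_le rd_gt0 t0' (lexx t) (lexx _)) => x; rewrite le_eqVlt; apply/orP; left.
  apply/eqP; congr cmod.
  case bx: (bad x); last first.
    by rewrite big1// => l _; case: ifP => // _; rewrite /proj bx.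
  have x5 : xdeg x \in iota 0 5 by rewrite mem_iota bad_xdeg.
  rewrite (bigD1_seq (xdeg x) x5)/= ?bad_xdeg//.
  rewrite big1 ?addr0 => [|l lx]; first by rewrite /proj bx eqxx.
  by case: ifP => // _; rewrite /proj bx eq_sym (negbTE lx).
have hc : nle rd t (fun x => \sum_i (if x == xunit (cp i) then av qs i g else 0))
    (\sum_i K * e ^+ r.+1 * weight rd t (xunit (cp i))).
  apply: nle_sum => i.
  apply: (nle_le rd_gt0 t0' (lexx t) _ (fun=> lexx _) (nle_single rd_gt0 _ _ t0')).
  by rewrite ler_wpM2r ?weight_ge0//; exact: (gI (j := 2) isT).
apply: (nle_le rd_gt0 t0' (lexx t) _ (fun=> lexx _) (nle_add hb hc)).
by rewrite -mulr_sumr -/unit_weight le_eqVlt; apply/orP; left; apply/eqP; ring.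
Qed.

Let W0 : 0 <= (5 + unit_weight) * K.
Proof. by rewrite mulr_ge0// addr_ge0// unit_weight_ge0. Qed.

Lemma normpartK : nle rd t (normpart qs g) ((6 + unit_weight) * K * e).
Proof.
have h : nle rd t (fun x => - remainder qs g x) ((5 + unit_weight) * K * e).
  apply: (nle_le rd_gt0 t0' (lexx t) _ _ remainderK) => [|x]; last by rewrite cmodN.
  by rewrite ler_wpM2l// exprS ler_piMr// exprn_ile1.
apply: (nle_le rd_gt0 t0' (lexx t) _ (fun=> lexx _) (nle_add gK h)).
by rewrite le_eqVlt; apply/orP; left; apply/eqP; ring.
Qed.

Definition terms_bound : R := Kf + (6 + unit_weight) * K.

Lemma termsK ell s : nle rd t (terms r f qs g ell s) (terms_bound * e ^+ s).
Proof.
have Kf0 : 0 <= Kf by exact: absb_ge0 fK.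
have W6 : 0 <= (6 + unit_weight) * K.
  by rewrite mulr_ge0// addr_ge0// unit_weight_ge0.
have es : 0 <= e ^+ s by exact: exprn_ge0.
apply: nle_degc => //; rewrite /terms_bound.
case: (eqVneq s 0%N) => [->|_].
  by apply: (nle_le rd_gt0 t0' (lexx t) _ (fun=> lexx _) fK); rewrite expr0 mulr1 lerDl.
case: (eqVneq s 1%N) => [->|_].
  apply: (nle_le rd_gt0 t0' (lexx t) _ (fun=> lexx _) normpartK).
  by rewrite expr1 ler_wpM2r// lerDr.
case: (eqVneq s r.+1) es => [->|_] es.
  apply: (nle_le rd_gt0 t0' (lexx t) _ (fun=> lexx _) remainderK).
  rewrite ler_wpM2r// -[leLHS]add0r lerD// ler_wpM2r//.
  by rewrite lerD2r ler_nat.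
apply: (nle_le rd_gt0 t0' (lexx t) _ (fun=> lexx _) (@nle0 _ _ _ rd t)).
by rewrite mulr_ge0// addr_ge0.
Qed.

Hypothesis f_deg : forall x, f x != 0 -> (2 < xdeg x)%N.

(** Orders 0, 1 and r.+1 are each summed over the degrees; the pairs absent from the expansion have
    to be shown to vanish. *)
Lemma terms_hs z : pdom rd t z ->
  hs (fun k : nat * nat => if present_nf r k.1 k.2 then tfeval (terms r f qs g k.1 k.2) z else 0)
    (tfeval f z + tfeval g z).
Proof.
move=> hz; have zero : tfeval (fun=> 0) z = 0 :> C.
  by apply: hs_sum; apply: hs0 => x; rewrite mul0r.
have gE : tfeval g z = tfeval (normpart qs g) z + tfeval (remainder qs g) z.
  rewrite -(tfeval_add rd_gt0 t0' normpartK remainderK hz); congr tfeval.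
  by apply/funext => x; rewrite /normpart subrK.
have one s0 a M : nle rd t a M -> hs (fun k : nat * nat =>
    if k.2 == s0 then tfeval (degc k.1 a) z else 0) (tfeval a z).
  move=> aM; have inj : injective (fun ell : nat => (ell, s0)) by move=> x y [].
  apply: (hs_image inj _ _ (hs_degc rd_gt0 t0' aM hz)) => [ell|[ell s] hk /=].
    by rewrite eqxx.
  by case: eqP => // sE; case: (hk ell); rewrite sE.
rewrite gE; apply: eq_hs (hs_add (one 0%N _ _ fK) (hs_add (one 1%N _ _ normpartK)
  (one r.+1 _ _ remainderK))) => -[ell s] /=.
case: s => [|[|s]].
- rewrite /terms /= !addr0; case: (ltnP 2 ell) => // hl.
  rewrite (_ : degc ell f = fun=> 0) ?zero//.
  apply/funext => x; rewrite /degc; case: eqP => // xl.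
  by apply/eqP/negPn/negP => /f_deg; rewrite xl ltnNge hl.
- rewrite /terms /= eqSS eq_sym (gtn_eqF r0) addr0 add0r r0.
  (* Every monomial of degree 1 is bad, so the normal part has none. *)
  case: (eqVneq ell 1%N) => //= ->; rewrite (_ : degc 1 _ = fun=> 0) ?zero//.
  apply/funext => x; rewrite /degc; case: eqP => // x1.
  apply/eqP/negPn/negP => /normpart_neq0; move: x1; rewrite /bad /xdeg.
  by case: (tf_l x) => [|l]; [rewrite muln0 add0n => ->|rewrite mulnS].
- rewrite /= !add0r /terms /=; have [->|sr] := eqVneq s.+2 r.+1.
    by rewrite ltnn.
  case: ifP => // _; rewrite (_ : degc ell _ = fun=> 0) ?zero//.
  by apply/funext => x; rewrite /degc; case: ifP.
Qed.

End Size.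
End NormalFormTerms.

(** * The normal form conditions *)

Section NormalFormProperties.
Variables (R : realType) (d n2 : nat).
Local Notation C := R[i].
Local Notation Z := (phase R d.+1 n2).
Local Notation X := (tfindex d.+1 n2).
Local Notation coordinate := (coordinate d.+1 n2).
Local Notation cp i := (inl (inl i) : coordinate).
Local Notation x0 := (x0 d.+1 n2).

Lemma tfmono_eq (x : X) (z z' : Z) :
  (forall c, coord c z = coord c z' \/ (xexp c x = 0%N /\ xfreq c x = 0)) ->
  tfmono x z = tfmono x z'.
Proof.
move=> h; rewrite !tfmonoE; apply: eq_bigr => c _; rewrite /cfactor.
case: (h c) => [->//|[-> ->]].
by case: ifP => _; rewrite ?expr0// mulr0 !mul0r.
Qed.

Lemma tfeval_eq (a : X -> C) (z z' : Z) :
  (forall x, a x != 0 -> tfmono x z = tfmono x z') -> tfeval a z = tfeval a z'.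
Proof.
move=> h; rewrite /tfeval; congr sum; apply/funext => x.
by have [->|/h ->] := eqVneq (a x) 0; rewrite ?mul0r.
Qed.

Lemma tf_l_eq0 (x : X) : tf_l x = 0%N -> forall i, xexp (cp i) x = 0%N.
Proof.
by move/eqP; rewrite /tf_l /mlen sum_nat_eq0 => /forallP h i; exact/eqP/(h i).
Qed.

Lemma tf_m_eq0 (x : X) : tf_m x = 0%N -> forall c, xexp (inr c : coordinate) x = 0%N.
Proof.
move/eqP; rewrite /tf_m /mlen addn_eq0 !sum_nat_eq0 => /andP[/forallP h /forallP h'].
by case=> j; apply/eqP; [exact: h|exact: h'].
Qed.

Lemma tfmono_origin (x : X) (z : Z) : origin_xieta z -> (0 < tf_m x)%N -> tfmono x z = 0.
Proof.
move=> [z1 z2] m0; have [c hc] : exists c, xexp (inr c : coordinate) x != 0%N.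
  apply: contrapT => hn; move: m0.
  have h c : xexp (inr c : coordinate) x = 0%N.
    by apply/eqP/negPn/negP => hc; apply: hn; exists c.
  by rewrite /tf_m /mlen !big1// => j _; [exact: (h (inr j))|exact: (h (inl j))].
rewrite tfmonoE (bigD1 (inr c))//= /cfactor /=.
rewrite (_ : coord (inr c) z = 0); last first.
  by case: c {hc} => j; rewrite -?coord_cxi -?coord_ceta ?z1 ?z2 mxE.
by rewrite expr0n (negbTE hc) mul0r.
Qed.

Lemma indep_q1_fast (D : set Z) (a : X -> C) : (forall x, a x != 0 -> fast x = 0) ->
  indep_q1 D (tfeval a).
Proof.
move=> h z z' _ _ e1 e2 e3 e4; apply: tfeval_eq => x /h fx.
apply: tfmono_eq => -[[i|i]|[i|i]].
- by left; rewrite -!coord_act e1.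
- case: (unliftP ord0 i) => [j|] ->; last by right.
  by left; move/rowP: e2 => /(_ j); rewrite !mxE -!coord_ang !mxE.
- by left; rewrite -!coord_cxi e3.
- by left; rewrite -!coord_ceta e4.
Qed.

Lemma indep_q_freq (D : set Z) (a : X -> C) :
  (forall x, a x != 0 -> forall c, xfreq c x = 0) -> indep_q D (tfeval a).
Proof.
move=> h z z' _ _ e1 e2 e3; apply: tfeval_eq => x /h fx.
apply: tfmono_eq => -[[i|i]|[i|i]].
- by left; rewrite -!coord_act e1.
- by right.
- by left; rewrite -!coord_cxi e2.
- by left; rewrite -!coord_ceta e3.
Qed.

Lemma indep_p_exp (D : set Z) (a : X -> C) : (forall x, a x != 0 -> tf_l x = 0%N) ->
  indep_p D (tfeval a).
Proof.
move=> h z z' _ _ e1 e2 e3; apply: tfeval_eq => x /h lx.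
apply: tfmono_eq => -[[i|i]|[i|i]].
- by right; split=> //; exact: tf_l_eq0.
- by left; rewrite -!coord_ang e1.
- by left; rewrite -!coord_cxi e2.
- by left; rewrite -!coord_ceta e3.
Qed.

Lemma tfeval0 (z : Z) : tfeval (fun=> 0) z = 0 :> C.
Proof. by apply: hs_sum; apply: hs0 => x; rewrite mul0r. Qed.

Lemma xadd_unit_eq (y : X) i j : xdeg y = 0%N ->
  (xadd y (xunit (cp i)) == xunit (cp j)) = (y == x0) && (i == j).
Proof.
move=> y0; apply/eqP/andP => [h|[/eqP -> /eqP ->]].
  have ly : tf_l y = 0%N by move/eqP: y0; rewrite /xdeg addn_eq0 muln_eq0 /= => /andP[/eqP].
  have := congr1 (xexp (cp j)) h; rewrite xexp_add (tf_l_eq0 ly) add0n !xexp_unit eqxx /=.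
  case: eqP => // -[->] _; rewrite eqxx; split=> //; apply/eqP/eq_x0 => // c.
  by have := congr1 (xfreq c) h; rewrite xfreq_add !xfreq_unit addr0.
apply: index_ext => c; first by rewrite xexp_add /x0 xexp_mk; case: ifP.
by rewrite xfreq_add /x0 xfreq_mk; case: ifP => _; rewrite add0r.
Qed.

Variable rd : coordinate -> R.
Hypothesis rd_gt0 : forall c, 0 < rd c.
Variables (t : R) (f g : X -> C) (M M' : R) (r : nat) (qs : 'rV[R]_d).
Hypothesis t0 : 0 < t.
Hypothesis gM : nle rd t g M.
Hypothesis nM : nle rd t (normpart qs g) M'.
Let t0' := ltW t0.

(** At xi = eta = 0 only monomials linear in the actions survive. The coefficient of p_i is the slow
    part of that of [g], evaluated at q*, minus the number [av] put into the remainder; these are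
    equal. *)
Lemma normpart_av (z : Z) : pdom rd 0 z -> origin_xieta z ->
  slow z = map_mx (fun t => t%:C) qs -> tfeval (degc 2 (normpart qs g)) z = 0.
Proof.
move=> hz oz sz; set a := degc 2 _.
have aM : nle rd (0 + t) a M' by rewrite add0r; exact: nle_degc.
(* Euler's identity in the actions: on the surviving monomials of degree 2 the exponent [tf_l] is
   1. *)
have -> : tfeval a z = \sum_i coord (cp i) z * tfeval (dco (cp i) a) z.
  apply: hs_sum; have := hs_bigsum (P := xpredT) (index_enum 'I_d.+1)
    (fun i _ => hs_mull (coord (cp i) z) (hs_dmono rd_gt0 (cp i) (lexx 0) t0 aM hz)).
  apply: eq_hs => x; transitivity ((tf_l x)%:R * (a x * tfmono x z)).
    rewrite /tf_l /mlen natr_sum mulr_suml; apply: eq_bigr => i _.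
    by rewrite mulrCA coord_dmono// mulrCA.
  rewrite /a /degc; case: eqP => [|_]; last by rewrite mul0r mulr0.
  case mx: (tf_m x) => [|m]; last by rewrite (tfmono_origin oz) ?mx// !mulr0.
  by rewrite /xdeg mx addn0 mul2n => /(congr1 half); rewrite doubleK => ->; rewrite mul1r.
apply: big1 => i _; rewrite (_ : tfeval (dco (cp i) a) z = 0) ?mulr0//.
apply: hs_sum.
have sM : nle rd (0 + t) (slowpart g) M by rewrite add0r; exact: nle_slowpart.
have h1 := nle_hs rd_gt0 (lexx 0) (nle_dco rd_gt0 (cp i) (lexx 0) t0 sM)
  (pdom_zstar rd_gt0 qs (lexx 0)).
(* The number [av], as a series concentrated at the constant monomial; subtracted from the series
   that defines [av], it gives sum zero. *)
have h2 := @hs_fin _ _ (fun y : X => if y == x0 then av qs i g else 0) [fset x0]%fset.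
rewrite big_seq_fset1 eqxx in h2.
have {}h2 := h2 _; have := hs_add h1 (hs_opp (h2 _)).
rewrite subrr; move=> h3; apply: eq_hs (h3 _) => [y|y]; last first.
  by rewrite inE => /negbTE ->.
have [y0|y0] := posnP (xdeg y); last first.
  rewrite tfmono_zstar// mulr0 add0r.
  rewrite (_ : y == x0 = false); last by apply/eqP => yE; move: y0; rewrite yE xdeg0.
  rewrite oppr0 /dco /= /a /degc xdeg_add xdeg_unit_p -[X in _ == X]add0n eqn_add2r.
  by rewrite gtn_eqF// mulr0 mul0r.
have /eqP := y0; rewrite /xdeg addn_eq0 muln_eq0 /= => /andP[/eqP ly /eqP my].
rewrite /dco (tf_l_eq0 ly) /= !mul1r /a /degc xdeg_add y0 xdeg_unit_p /=.
rewrite /slowpart /normpart /remainder.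
have -> : bad (xadd y (xunit (cp i))) = (fast y != 0).
  rewrite /bad /fast xfreq_add xfreq_unit addr0 tf_l_add tf_m_add ly my.
  by rewrite tf_l_unit tf_m_unit /= andbT.
have -> : fast (xadd y (xunit (cp i))) = fast y by rewrite /fast xfreq_add xfreq_unit addr0.
have -> : \sum_j (if xadd y (xunit (cp i)) == xunit (cp j) then av qs j g else 0) =
    if y == x0 then av qs i g else 0.
  rewrite (bigD1 i)//= big1 => [|j ji].
    by rewrite xadd_unit_eq// eqxx andbT addr0.
  by rewrite xadd_unit_eq// [i == j]eq_sym (negbTE ji) andbF.
have [fy|fy] := eqVneq (fast y) 0; last first.
  rewrite (_ : y == x0 = false) ?addr0 ?subrr ?mulr0 ?mul0r ?oppr0 ?addr0//.
  by apply/eqP => yE; move: fy; rewrite yE /fast /x0 xfreq_mk eqxx.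
rewrite add0r -(_ : tfmono y z = tfmono y (zstar n2 qs)).
  case: eqP => [->|_]; last by rewrite !subr0.
  by rewrite tfmono0 !mulr1.
apply: tfmono_eq => -[[j|j]|c].
- by right; split=> //; exact: tf_l_eq0.
- case: (unliftP ord0 j) => [k|] ->; last by right.
  left; rewrite coord_mkphase liftK; move/rowP: sz => /(_ k).
  by rewrite !mxE -coord_ang !mxE.
- by right; split=> //; exact: tf_m_eq0.
Qed.

(** Orders from 2 to [r] are empty; at order 1 each condition is the absence of one family of bad
    monomials, except the vanishing at q*, which is [normpart_av]. *)
Lemma normal_form_terms (D : set Z) : (forall z, D z -> pdom rd 0 z) ->
  normal_form D r qs (terms r f qs g).
Proof.
move=> hD s /andP[s0 sr].
have [s1|s1] := eqVneq s 1%N; last first.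
  have E ell : terms r f qs g ell s = fun=> 0.
    apply/funext => x; rewrite /terms /degc; case: ifP => // _.
    by rewrite gtn_eqF// (negbTE s1) ltn_eqF.
  have T (z : Z) : tfeval (fun=> 0) z = 0 :> C by exact: tfeval0.
  by rewrite !E; split=> [z z'|z z'|z|z z'|z z'] *; rewrite ?T.
have E ell : terms r f qs g ell s = degc ell (normpart qs g) by rewrite /terms s1.
have H ell x : degc ell (normpart qs g) x != 0 -> xdeg x = ell /\ bad x = false.
  rewrite /degc; case: (eqVneq (xdeg x) ell) => [-> h|_]; last by rewrite eqxx.
  by split=> //; exact: normpart_neq0 h.
have H1 ell x : degc ell (normpart qs g) x != 0 -> (ell \in [:: 0; 2]%N) -> fast x = 0.
  move=> /H[<- bx] hl; apply/eqP; move: bx hl; rewrite /bad !inE /xdeg !xpair_eqE.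
  case: (fast x == 0) => //=.
  by case: (tf_l x) => [|[|l]]; case: (tf_m x) => [|[|[|m]]]; rewrite ?mulnS.
rewrite !E; split.
- by apply: indep_q1_fast => x /H1; apply.
- by apply: indep_q1_fast => x /H1; apply.
- by move=> z /hD hz oz sz; exact: normpart_av.
- apply: indep_p_exp => x /H[x3]; move: x3; rewrite /bad /xdeg.
  by case: (tf_l x) => [|[|l]]; case: (tf_m x) => [|[|[|m]]]; rewrite ?mulnS.
- move=> z z' [_ oz] [_ oz'] e1 e2 e3 e4.
  rewrite /tfeval; congr sum; apply/funext => x.
  have [->|ax] := eqVneq (degc 4 (normpart qs g) x) 0; first by rewrite !mul0r.
  case mx: (tf_m x) => [|m]; last by rewrite (tfmono_origin oz) ?mx// (tfmono_origin oz') ?mx.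
  congr (_ * _); apply: tfmono_eq => -[[i|i]|c].
  + by left; rewrite -!coord_act e1.
  + case: (unliftP ord0 i) => [j|] ->.
      by left; move/rowP: e2 => /(_ j); rewrite !mxE -!coord_ang !mxE.
    right; split=> //; have [x4 bx] := H _ _ ax; apply/eqP; move: bx x4.
    rewrite -/(fast x) /bad !inE /xdeg !xpair_eqE mx.
    by case: (fast x == 0) => //=; case: (tf_l x) => [|[|[|l]]]; rewrite ?mulnS.
  + by right; split=> //; exact: tf_m_eq0.
Qed.

End NormalFormProperties.

Lemma tfnorm_nle (R : realType) (n1 n2 : nat) (r0 r1 r2 M : R) (a : tfseries R n1 n2) :
  0 <= r0 -> 0 <= r2 -> nle (radii r0 r1 r2) 0 a M -> (tfnorm r0 r1 r2 a <= M%:E)%E.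
Proof.
move=> r00 r20 aM; apply/tfnormP => //; apply: absb_le aM => // x.
have -> : \prod_c cweight c x (radii r0 r1 r2 c) = weight (radii r0 r1 r2) 0 x.
  by apply: eq_bigr => c _; rewrite addr0.
by [].
Qed.

(** The factor 16 comes from the fourth inequality: a displacement [2 * b], counted for xi and for
    eta, has to fit into a quarter of the radius. *)
Lemma scaled_radius (R : realFieldType) (x b : R) : 0 <= b -> 16 * b <= x ->
  [/\ 2^-1 * x + b <= 3 / 4 * x, 2^-1 * x + (b + b) <= 3 / 4 * x,
    4^-1 * x + 2 * b <= 2^-1 * x, 4^-1 * x + (2 * b + 2 * b) <= 2^-1 * x &
    4^-1 * x <= 2^-1 * x /\ 3 / 4 * x <= x].
Proof. by move=> b0 bx; split; [lra..|split; lra]. Qed.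

Theorem proposition2p1 (R : realType) (d1 d2 : nat)
  (omega : R) (Omega : 'I_d2.+1 -> R)
  (rho sigma rad : R) (hrho : 0 < rho) (hsigma : 0 < sigma) (hrad : 0 < rad)
  (eps0 : R) (heps0 : 0 < eps0)
  (H0 : R -> phase R d1.+1 d2.+1 -> R[i])
  (f : R -> nat -> nat -> tfseries R d1.+1 d2.+1)
  (hf0 : unperturbed eps0 f)
  (hfP : forall eps ell s, `|eps| < eps0 -> present0 ell s ->
     inP ell (f eps ell s))
  (hH0 : forall eps, `|eps| < eps0 ->
     expansion omega Omega present0 (f eps) (dom rho sigma rad) (H0 eps))
  (hH0_an : forall eps z, `|eps| < eps0 -> dom rho sigma rad z ->
     differentiable (H0 eps) z)
  (hH0_eps : forall eps z, `|eps| < eps0 -> dom rho sigma rad z ->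
     real_analytic_at (fun e => H0 e z) eps)
  (H1 : exists m : R, 0 < m /\ forall v : 'I_d1.+1 -> R,
     m * \sum_i `|v i| <=
     \sum_i cmod (\sum_j act_hessian (tfeval (f 0 4%N 0%N)) i j * (v j)%:C))
  (H2 : exists E : R, 0 < E /\ forall eps ell s, `|eps| < eps0 ->
     present0 ell s ->
     (tfnorm rho sigma rad (f eps ell s) <= (E / 2 ^+ ell * `|eps| ^+ s)%:E)%E)
  (H3 : (forall (k1 : int) (b : bool) (j : 'I_d2.+1),
           k1%:~R * omega + (-1) ^+ b * Omega j != 0) /\
        (forall (k1 : int) (b b' : bool) (l k : 'I_d2.+1), k1 != 0 ->
           k1%:~R * omega + (-1) ^+ b * Omega l + (-1) ^+ b' * Omega k != 0)) :
  forall r : nat, (1 <= r)%N ->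
  exists epsr : R, 0 < epsr /\
  exists fr0 : nat -> tfseries R d1.+1 d2.+1,
  forall qstar : 'rV[R]_d1,
  exists (Phi : R -> phase R d1.+1 d2.+1 -> phase R d1.+1 d2.+1)
         (fr : R -> nat -> nat -> tfseries R d1.+1 d2.+1),
    let D a := @dom R d1.+1 d2.+1 (a * rho) (a * sigma) (a * rad) in
    (forall ell s, present_nf r ell s ->
       exists K : R, forall eps, `|eps| < epsr ->
         (tfnorm (2^-1 * rho) (2^-1 * sigma) (2^-1 * rad) (fr eps ell s)
          <= (K * `|eps| ^+ s)%:E)%E) /\
    forall eps, `|eps| < epsr ->
    [/\ analytic_canonical (D 2^-1) (Phi eps),
        (forall z, D 4^-1 z -> exists2 w, D 2^-1 w & torus_eq (Phi eps w) z) /\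
        (forall w, D 2^-1 w -> D (3 / 4) (Phi eps w)),
        (forall ell s, present_nf r ell s -> inP ell (fr eps ell s)) /\
        (forall ell, (2 < ell)%N ->
           fr eps ell 0%N = fr0 ell /\ indep_q (D 2^-1) (tfeval (fr0 ell))),
        expansion omega Omega (present_nf r) (fr eps) (D 2^-1)
          (H0 eps \o Phi eps) &
        normal_form (D 2^-1) r qstar (fr eps)].
Proof.
move=> r r1; have [E [E0 hE]] := H2; have [m [m0 hm]] := H1; have [H31 H32] := H3.
pose rd : coordinate d1.+1 d2.+1 -> R := radii (2^-1 * rho) (2^-1 * sigma) (2^-1 * rad).
have rd_gt0 c : 0 < rd c by apply: radii_gt0; rewrite mulr_gt0.
pose wd := Num.min rho (Num.min sigma rad).
have wd0 : 0 < wd by rewrite !lt_min hrho hsigma hrad.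
have [wd1 wd2 wd3] : [/\ wd <= rho, wd <= sigma & wd <= rad].
  by rewrite /wd !ge_min !lexx !orbT.
(* The room between the half radii and the full ones, available for all losses. *)
clearbody wd; pose tau := wd / 2; have tau0 : 0 < tau by rewrite divr_gt0.
have htau c : rd c + tau <= radii rho sigma rad c.
  by rewrite /rd /tau; case: c => [[j|j]|[j|j]] /=; lra.
have fK : nle rd tau (unpert f) (2 * E).
  exact: (unpertK hrho hsigma hrad heps0 E0 hE tau0 htau).
have f_freq x (h : unpert f x != 0) : forall c, xfreq c x = 0.
  by have [] := unpert_neq0 heps0 hf0 h.
have f_deg x (h : unpert f x != 0) : (2 < xdeg x)%N.
  by have [] := unpert_neq0 heps0 hf0 h.
have f_unc x (h : unpert f x != 0) : tf_l x = 0%N \/ tf_m x = 0%N.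
  by have [] := unpert_neq0 heps0 hf0 h.
have z0 : `|0 : R| < eps0 by rewrite normr0.
have f4E : degc 4 (unpert f) = f 0 4%N 0%N by rewrite (degc_unpert heps0 hfP).
have [Ci hCi] : exists Ci : 'I_d1.+1 -> 'I_d1.+1 -> R[i], forall b i,
    \sum_j hess (unpert f) i j * (\sum_k Ci j k * b k) = b i.
  have [|||Ci hCi] := hess_inverse rd_gt0 (a := f 0 4%N 0%N) (s := tau) (M := 2 * E) tau0
    _ _ _ m0 hm.
  - by rewrite -f4E; apply: nle_degc => //; exact: ltW.
  - move=> x; rewrite -f4E /degc; case: ifP => [_|]; last by rewrite eqxx.
    exact: f_freq.
  - move=> x mx; have [h [g ->//]] := hf0; rewrite mx eqxx.
    by case: (_ && _); eexists.
  exists Ci => b i; rewrite -[RHS]hCi; apply: eq_bigr => j _; congr (_ * _).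
  rewrite /hess /dco /= -f4E /degc !xdeg_add xdeg0 !xdeg_unit_p.
  by [].
have [gam gam0 hgam] := eigval_gap d1 H31 H32.
(* The bound 1/2 serves the geometric series in [perturbation]. *)
pose ea := Num.min eps0 2^-1.
have eaP x : (x < ea) = (x < eps0) && (x < 2^-1) by rewrite lt_min.
have ea0 : 0 < ea by rewrite eaP heps0 /= invr_gt0.
clearbody ea.
have /boolp.choice[g0 hg0] : forall eps : R, exists g : tfseries R d1.+1 d2.+1, `|eps| < ea ->
    nle rd tau g (4 * E * `|eps|) /\ forall z, pdom rd tau z ->
    hs (fun k : nat * nat => if k.2 is s.+1 then tfeval (f eps k.1 k.2) z else 0)
       (tfeval g z).
  move=> eps; case: (ltP `|eps| ea) => [|_]; last by exists (fun=> 0).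
  rewrite eaP => /andP[h1 /ltW h2].
  have [g hg] := perturbation hrho hsigma hrad E0 hE tau0 htau h1 h2.
  by exists g.
(* Items of order [r.+1] are what allows the remainder to be stored beyond order [r]. *)
have st : state omega Omega rd (unpert f) g0 (level r.+1 0) (tau / 2).
  have tau2 : 0 < tau / 2 by rewrite divr_gt0.
  have tau2' : tau / 2 < tau by lra.
  apply: (normalization rd_gt0 fK f_freq f_deg f_unc hCi gam0 hgam (ltn0Sn r) _ tau2 tau2').
  move=> t t0 tt; apply: (initial_state omega Omega hrho hsigma hrad f E0 ea0 _ t0 tt).
  by move=> eps /hg0[].
have [K [e1 [K0 e10 hst]]] := st.
pose t := tau / 2; have t0 : 0 < t by rewrite divr_gt0.
have t0' := ltW t0.
have K1 : 0 < K + 1 by rewrite ltr_wpDl.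
(* The first bound makes the map injective and onto where required, the second gives the inclusions
   of domains. *)
pose ks := Num.min (t / (4 * (K + 1))) (wd / (16 * (K + 1))).
pose epsr := Num.min (Num.min e1 ea) (Num.min 1 ks).
have epsr0 : 0 < epsr by rewrite !lt_min e10 ea0 ltr01 !divr_gt0// mulr_gt0.
exists epsr; split=> //; exists (fun ell => degc ell (unpert f)) => qs.
(* Displacement and perturbation are chosen for each eps separately, with zero beyond the
   threshold. *)
have /boolp.choice[P hP] : forall eps : R,
    exists p : (phase R d1.+1 d2.+1 -> phase R d1.+1 d2.+1) * tfseries R d1.+1 d2.+1,
    `|eps| < e1 -> state_at omega Omega rd (unpert f) g0 (level r.+1 0) t K qs eps p.1 p.2.
  move=> eps; case: (ltP `|eps| e1) => [he|_]; last by exists (fun=> 0, fun=> 0).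
  by have [phi [g h]] := hst qs eps he; exists (phi, g).
exists (fun eps z => z + (P eps).1 z), (fun eps => terms r (unpert f) qs (P eps).2).
move=> D; have sm eps : `|eps| < epsr -> [/\ `|eps| < e1, `|eps| < ea, `|eps| <= 1,
    4 * (K * `|eps|) <= t & 16 * (K * `|eps|) <= wd].
  have Ke k : 0 < k -> forall x, `|eps| < x / (k * (K + 1)) -> k * (K * `|eps|) <= x.
    move=> k0 x; rewrite ltr_pdivlMr ?mulr_gt0// => /ltW; apply: le_trans.
    rewrite (_ : `|eps| * _ = k * ((K + 1) * `|eps|)); last by ring.
    by rewrite ler_wpM2l ?(ltW k0)// ler_wpM2r// lerDl.
  rewrite !lt_min => /andP[/andP[h1 h2] /and3P[h3 h4 h5]].
  by split=> //; [exact: ltW|exact: Ke|exact: Ke].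
have gI eps j : state_at omega Omega rd (unpert f) g0 (level r.+1 0) t K qs eps
    (P eps).1 (P eps).2 -> (j < 6)%N ->
    item rd qs t j (P eps).2 (K * `|eps| ^+ r.+1).
  by move=> [_ _ _ _ h] j6; have := h j j6; rewrite /level.
have tf : nle rd t (unpert f) (2 * E).
  by apply: (nle_le rd_gt0 t0' _ (lexx _) (fun=> lexx _) fK); rewrite /t; lra.
have Dp z : D 2^-1 z -> pdom rd 0 z by move=> hz c; rewrite addr0; exact: dom_csize hz.
split.
  move=> ell s _; exists (terms_bound rd t (2 * E) K) => eps /sm[he1 _ he _ _].
  have hS := hP eps he1; have [_ _ _ gK _] := hS.
  apply: tfnorm_nle; [by rewrite mulr_ge0 ?ltW|by rewrite mulr_ge0 ?ltW|].
  have h := termsK rd_gt0 t0 tf gK (fun j => gI eps j hS) (normr_ge0 _) he K0 ell s.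
  exact: (nle_le rd_gt0 (lexx 0) t0' (lexx _) (fun=> lexx _) h).
move=> eps /sm[he1 hea he bt bw].
have hS := hP eps he1; have [phiK phiS phiE gK _] := hS.
have b0 : 0 <= K * `|eps| by exact: mulr_ge0.
have heps : `|eps| < eps0 by move: hea; rewrite eaP => /andP[].
have phib z c : pdom rd 0 z -> cmod (coord c ((P eps).1 z)) <= K * `|eps|.
  by move=> hz; apply: (exv_cmod_le rd_gt0 c t0' phiK); exact: pdom_le hz.
have mrho := scaled_radius b0 (le_trans bw wd1).
have msig := scaled_radius b0 (le_trans bw wd2).
have mrad := scaled_radius b0 (le_trans bw wd3).
have D34 w : D 2^-1 w -> D (3 / 4) (w + (P eps).1 w).
  move=> hw; have := domD hw (fun c => phib w c (Dp w hw)).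
  by apply: dom_le; [by case: mrho|by case: msig|by case: mrad].
split.
- exact: (near_id_canonical rd_gt0 t0 phiK b0 bt phiS Dp).
- split=> // z hz.
  have hz2 : D 2^-1 z by apply: dom_le hz;
    [by case: mrho => _ _ _ _ []|by case: msig => _ _ _ _ []|by case: mrad => _ _ _ _ []].
  have [w wz wb] := near_id_surj rd_gt0 t0 phiK b0 bt (Dp z hz2).
  (* [w] is mapped exactly to [z] on the cover, so the integer shifts are zero. *)
  exists w; last by apply/torus_eqP; exists (fun=> 0) => c; rewrite wz; case: c => [[i|i]|i]; rewrite ?mulr0 ?addr0.
  have := domD hz wb; rewrite [z + _]addrC subrK; apply: dom_le;
    [by case: mrho|by case: msig|by case: mrad].
- split=> [ell s _ x|ell hl].
    by rewrite /terms /degc; case: (eqVneq (xdeg x) ell) => // _; rewrite eqxx.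
  split; first by rewrite /terms.
  apply: indep_q_freq => x; rewrite /degc; case: ifP => [_|]; last by rewrite eqxx.
  exact: f_freq.
- move=> z hz; apply/has_sumP => /=.
  have hz0 := Dp z hz; have hzt : pdom rd t z by exact: pdom_le hz0.
  have hw : pdom rd tau (z + (P eps).1 z).
    apply: (pdom_le _ (pdomD (fun c => phib z c hz0) hz0)).
    by rewrite add0r; move: bt; rewrite /t; lra.
  have hwd : dom rho sigma rad (z + (P eps).1 z) by apply: dom_le (D34 z hz);
    [by case: mrho => _ _ _ _ []|by case: msig => _ _ _ _ []|by case: mrad => _ _ _ _ []].
  have [_ hg] := hg0 eps hea.
  rewrite (perturbationE hrho hsigma hrad heps0 hf0 hfP hH0 E0 hE tau0 htau heps hwd hw (hg _ hw)).
  have := phiE z hzt; rewrite /ham => ->.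
  rewrite (_ : _ - _ = tfeval (unpert f) z + tfeval (P eps).2 z); last by ring.
  exact: (terms_hs rd_gt0 t0 tf gK (fun j => gI eps j hS) (normr_ge0 _) he K0 r1 f_deg hzt).
- apply: (normal_form_terms rd_gt0 (unpert f) t0 gK _ Dp).
  exact: (normpartK rd_gt0 t0 gK (fun j => gI eps j hS) (normr_ge0 _) he K0).
Qed.
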